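(* Let $\Omega\subset\mathbb C^n$ be a bounded symmetric domain on which a finite complex reflection group $G$ acts, and let $\boldsymbol\theta:\Omega\to\boldsymbol\theta(\Omega)$ be a basic polynomial map associated to $G$. For every one-dimensional representation $\varrho$ of $G$, $H^2_\varrho(\boldsymbol\theta(\Omega))$ is isometrically embedded in $L^2_\varrho(\partial\boldsymbol\theta(\Omega))$.
   Context: $\Omega\subset\mathbb C^n$ is a bounded symmetric domain (for all $a,b\in\Omega$ some involution in the group $\mathrm{Aut}(\Omega)$ of biholomorphic automorphisms interchanges $a,b$), in its standard circular realization centred at $0$ (so $0\in\Omega$ and $rt\in\Omega$ for $0\le r<1$, $t\in\overline\Omega$). $\partial\Omega$ denotes the Shilov boundary; $I_\Omega(0)=\{\phi\in\mathrm{Aut}(\Omega):\phi(0)=0\}$ acts transitively on it and $d\Theta$ is the unique normalized $I_\Omega(0)$-invariant measure on $\partial\Omega$. $H^2(\Omega)$ is the Hilbert space of holomorphic $f$ on $\Omega$ with $\|f\|^2=\sup_{0<r<1}\int_{\partial\Omega}|f(rt)|^2d\Theta(t)<\infty$; $f\mapsto$ (radial limit of $f$) embeds it isometrically in $L^2(\partial\Omega,d\Theta)$. A complex reflection on $\mathbb C^n$ is a linear map $\sigma$ of finite order with $\mathrm{rank}(I_n-\sigma)=1$. $G$ is a finite group generated by complex reflections, with $G\subset\mathrm{Aut}(\Omega)$ (acting linearly). The ring of $G$-invariant polynomials is $\mathbb C[\theta_1,\dots,\theta_n]$ with algebraically independent homogeneous $\theta_i$; $\boldsymbol\theta=(\theta_1,\dots,\theta_n):\Omega\to\boldsymbol\theta(\Omega)$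 is called a basic polynomial map associated to $G$. The Shilov boundary of $\boldsymbol\theta(\Omega)$ is $\partial\boldsymbol\theta(\Omega)=\boldsymbol\theta(\partial\Omega)$. Let $H_1,\dots,H_t$ be the distinct reflecting hyperplanes of $G$, $\ell_i$ a linear form with zero set $H_i$, and $a_i$ a generator of the cyclic subgroup of $G$ fixing $H_i$ pointwise. For a one-dimensional representation $\varrho$ let $c_i$ be the least non-negative integer with $\varrho(a_i)=\det(a_i)^{c_i}$, $\ell_\varrho=\prod_i\ell_i^{c_i}$ and $c_\varrho=\|\ell_\varrho\|_{H^2(\Omega)}$. $H^2_\varrho(\boldsymbol\theta(\Omega))$ is the Hilbert space of holomorphic $f:\boldsymbol\theta(\Omega)\to\mathbb C$ with $\|f\|_\varrho^2=\frac1{c_\varrho^2}\sup_{0<r<1}\int_{\partial\Omega}|(f\circ\boldsymbol\theta)(rt)|^2|\ell_\varrho(rt)|^2d\Theta(t)<\infty$. $L^2_\varrho(\partial\boldsymbol\theta(\Omega))$ is the $L^2$-space of the measure $\Theta_\varrho$ on $\partial\boldsymbol\theta(\Omega)$ determined by $\int f\,d\Theta_\varrho=\frac1{c_\varrho^2}\int_{\partial\Omega}(f\circ\boldsymbol\theta)|\ell_\varrho|^2d\Theta$. The embedding meant in the paper is $f\mapsto f^*$, where $\ell_\varrho\cdot(f^*\circ\boldsymbol\theta)$ is a.e. on $\partial\Omega$ the radial limit of $\ell_\varrho\cdot(f\circ\boldsymbol\theta)\in H^2(\Omega)$. *)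

(* Defs.v *)
From HB Require Import structures.
From mathcomp Require Import all_boot all_order all_algebra.
From mathcomp Require Import all_classical all_reals all_analysis.
From mathcomp Require Import measurable_realfun.
(* The notations of mpoly clash with those of the analysis library. *)
From mathcomp Require Import -(notations) mpoly.
From mathcomp Require Import complex.

Set Implicit Arguments.
Unset Strict Implicit.
Unset Printing Implicit Defensive.

Import Order.TTheory GRing.Theory Num.Theory.
Import numFieldNormedType.Exports.

Local Open Scope classical_set_scope.
Local Open Scope ring_scope.
Local Open Scope complex_scope.

(* The regular algebra [R[i]^o] carries the topology and the normed module
   structure over the complex numbers; [R[i]] itself does not. *)
Notation Cplx R := ((R[i])^o).
Notation Cn R n := 'cV[Cplx R]_n.
Notation polyCn R n := (mpoly n (Cplx R)).

Notation borelC R := (g_sigma_algebraType (@open (Cplx R))).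
Notation borelCn R n := (g_sigma_algebraType (@open (Cn R n))).

(* Real-valued modulus: the library norm of [R[i]] takes values in [R[i]]. *)
Notation cabs := (complex.ComplexField.Normc.normc) (only parsing).

Section Domains.
Context {R : realType} {n : nat}.
Implicit Types (Omega K S : set (Cn R n)) (phi : Cn R n -> Cn R n).

(* Complex (Frechet) differentiability. Maps are total on C^n; their values
   outside D are irrelevant when D is open. *)
Definition holomorphic_on (V : normedModType R[i]) (D : set (Cn R n))
    (f : Cn R n -> V) : Prop :=
  forall z, D z -> differentiable f z.

Definition automorphism Omega phi : Prop :=
  holomorphic_on Omega phi /\
  exists psi : Cn R n -> Cn R n,
    [/\ holomorphic_on Omega psi,
        forall z, Omega z -> Omega (phi z),
        forall z, Omega z -> Omega (psi z),
        forall z, Omega z -> psi (phi z) = z &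
        forall z, Omega z -> phi (psi z) = z].

Record bounded_symmetric_domain Omega : Prop := BoundedSymmetricDomain {
  bsd_open : open Omega;
  bsd_connected : connected Omega;
  bsd_bounded : bounded_set Omega;
  bsd_symmetric : forall a b, Omega a -> Omega b ->
    exists phi, [/\ automorphism Omega phi,
      forall z, Omega z -> phi (phi z) = z, phi a = b & phi b = a] }.

Record standard_circular Omega : Prop := StandardCircular {
  sc_zero : Omega 0;
  sc_circular : forall (u : Cplx R) z, `|u| = 1 -> Omega z -> Omega (u *: z);
  sc_radial : forall (r : R) t, 0 <= r < 1 -> closure Omega t ->
    Omega ((r%:C : Cplx R) *: t) }.

(* A closed subset of the closure of Omega on which every function continuous
   on the closure and holomorphic on Omega attains its maximum modulus. *)
Definition maximum_boundary Omega K : Prop :=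
  [/\ closed K, K `<=` closure Omega &
      forall f : Cn R n -> Cplx R,
        {within closure Omega, continuous f} -> holomorphic_on Omega f ->
        exists2 w, K w & forall z, closure Omega z -> cabs (f z) <= cabs (f w)].

Definition shilov_boundary Omega S : Prop :=
  maximum_boundary Omega S /\ forall K, maximum_boundary Omega K -> S `<=` K.

(* The isotropy group of 0 acts on the Shilov boundary through the continuous
   extension of its elements to the closure of Omega (by Cartan's theorem each
   of them is the restriction of a linear map, so the extension exists). *)
Definition isotropy Omega phi : Prop :=
  [/\ automorphism Omega phi, phi 0 = 0 & {within closure Omega, continuous phi}].

(* Theta is a Borel probability on C^n carried by S; as the isotropy group is
   transitive on S, there is exactly one such measure. *)
Definition invariant_measure Omega S (Theta : probability (borelCn R n) R) : Prop :=
  Theta S = 1%E /\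
  forall phi, isotropy Omega phi ->
  forall B : set (borelCn R n), measurable B -> Theta (S `&` phi @^-1` B) = Theta B.

End Domains.

Section ReflectionGroups.
Context {R : realType} {n : nat}.
Local Notation C := (Cplx R).
Implicit Types (G : set 'M[C]_n) (theta : n.-tuple (polyCn R n)).

Definition complex_reflection (s : 'M[C]_n) : Prop :=
  (exists2 k : nat, (0 < k)%N & s ^+ k = 1%:M) /\ \rank (1%:M - s) = 1%N.

Record finite_reflection_group G : Prop := FiniteReflectionGroup {
  frg_finite : finite_set G;
  frg_one : G 1%:M;
  frg_mul : forall A B, G A -> G B -> G (A *m B);
  frg_inv : forall A, G A -> A \in unitmx /\ G (invmx A);
  frg_generated : forall A, G A -> exists2 s : seq 'M[C]_n,
    forall B, B \in s -> G B /\ complex_reflection B & A = \prod_(B <- s) B }.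

Definition mpoly_eval (p : polyCn R n) (z : Cn R n) : C :=
  meval (fun i => z i ord0) p.

Definition invariant_mpoly G (p : polyCn R n) : Prop :=
  forall A z, G A -> mpoly_eval p (A *m z) = mpoly_eval p z.

Record basic_polynomials G theta : Prop := BasicPolynomials {
  bp_homogeneous : forall i, exists d,
    tnth theta i \is ishomog1 d (@mdeg n);
  bp_independent : forall q : polyCn R n, comp_mpoly theta q = 0 -> q = 0;
  bp_generate : forall p : polyCn R n,
    invariant_mpoly G p <-> exists q : polyCn R n, p = comp_mpoly theta q }.

Definition basic_map theta (z : Cn R n) : Cn R n :=
  \col_i mpoly_eval (tnth theta i) z.

Definition linear_character G (rho : 'M[C]_n -> C) : Prop :=
  (forall A, G A -> rho A != 0) /\
  (forall A B, G A -> G B -> rho (A *m B) = rho A * rho B).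

Definition reflecting_hyperplane G (H : set (Cn R n)) : Prop :=
  exists s, [/\ G s, complex_reflection s & H = [set z | s *m z = z]].

Record hyperplane_data G (m : nat) (H : 'I_m -> set (Cn R n))
    (l : 'I_m -> 'rV[C]_n) (a : 'I_m -> 'M[C]_n) : Prop := HyperplaneData {
  hd_distinct : injective H;
  hd_all : forall K, reflecting_hyperplane G K <-> exists i, H i = K;
  hd_form : forall i, H i = [set z | l i *m z = 0];
  hd_generator : forall i,
    [set A | G A /\ forall z, H i z -> A *m z = z] = range (fun k : nat => a i ^+ k) }.

Definition least_exponents (m : nat) (rho : 'M[C]_n -> C) (a : 'I_m -> 'M[C]_n)
    (c : 'I_m -> nat) : Prop :=
  forall i, rho (a i) = \det (a i) ^+ c i /\
    forall k : nat, rho (a i) = \det (a i) ^+ k -> (c i <= k)%N.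

Definition ell_rho (m : nat) (l : 'I_m -> 'rV[C]_n) (c : 'I_m -> nat)
    (z : Cn R n) : C :=
  \prod_(i < m) ((l i *m z) ord0 ord0) ^+ c i.

End ReflectionGroups.

Section HardySpaces.
Context {R : realType} {n : nat}.
Local Notation C := (Cplx R).
Variables (S : set (Cn R n)) (Theta : probability (borelCn R n) R).

Definition radial_sup (w : Cn R n -> R) : \bar R :=
  ereal_sup [set (\int[ Theta ]_(t in S) (w ((r%:C : C) *: t))%:E)%E
            | r in [set r : R | 0 < r < 1]].

Definition hardy_norm (F : Cn R n -> C) : \bar R :=
  (radial_sup (fun z => cabs (F z) ^+ 2)%R `^ 2^-1)%E.

Variables (theta : Cn R n -> Cn R n) (ell : Cn R n -> C).

Definition c_rho : R := fine (hardy_norm ell).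

Definition hardy_rho_norm (f : Cn R n -> C) : \bar R :=
  (((c_rho ^- 2)%:E *
    radial_sup (fun z => cabs (f (theta z)) ^+ 2 * cabs (ell z) ^+ 2)%R) `^ 2^-1)%E.

Definition hardy_rho (Omega : set (Cn R n)) (f : Cn R n -> C) : Prop :=
  holomorphic_on (theta @` Omega) (f : Cn R n -> C) /\ (hardy_rho_norm f < +oo)%E.

(* This determines Theta_rho, and makes it carried by [theta @` S]. *)
Definition weighted_image (Theta_rho : {measure set (borelCn R n) -> \bar R}) : Prop :=
  forall h : borelCn R n -> \bar R, measurable_fun setT h -> (forall w, 0 <= h w)%E ->
  (\int[ Theta_rho ]_w h w =
   (c_rho ^- 2)%:E * \int[ Theta ]_(t in S) (h (theta t) * (cabs (ell t) ^+ 2)%:E))%E.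

End HardySpaces.

(* Elements of the L^2 space of mu are represented by Borel functions, to be
   compared up to mu-almost everywhere equality. *)
Definition L2_norm {R : realType} {n : nat}
    (mu : {measure set (borelCn R n) -> \bar R}) (g : Cn R n -> Cplx R) : \bar R :=
  ('N[mu]_2%:E [ (fun w => (cabs (g w))%:E) ])%E.

Definition L2_space {R : realType} {n : nat}
    (mu : {measure set (borelCn R n) -> \bar R}) (g : Cn R n -> Cplx R) : Prop :=
  measurable_fun setT (g : borelCn R n -> borelC R) /\ (L2_norm mu g < +oo)%E.

(* Main.v *)
Require Import Defs.
From HB Require Import structures.
From mathcomp Require Import all_boot all_order all_algebra.
From mathcomp Require Import all_classical all_reals all_analysis.
From mathcomp Require Import measurable_realfun.
From mathcomp Require Import -(notations) mpoly.
From mathcomp Require Import complex.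
From mathcomp Require Import ring lra.

Set Implicit Arguments.
Unset Strict Implicit.
Unset Printing Implicit Defensive.

Import Order.TTheory GRing.Theory Num.Theory.
Import numFieldNormedType.Exports.
Import ComplexField.Normc.

Local Open Scope classical_set_scope.
Local Open Scope ring_scope.
Local Open Scope complex_scope.

(** Let F be the holomorphic function [ell_rho * (f o theta)] on the domain. The theorem is
    Fatou's theorem for the Hardy space of the domain, applied to F, together with a
    description of the boundary values of F as a function on the image of the Shilov
    boundary.

    Radial limits. The rotations [t |-> u t] with [|u| = 1] belong to the isotropy group,
    hence preserve the invariant measure, and for [t] in the closure of the domain the
    slice [w |-> F (w t)] is holomorphic on the unit disc. Everything about F follows
    from these two facts ([hardy_family], [rotation_action]). The Poisson formula for a
    slice ([poisson_formula]) shows that the integral means of [|F|^2] increase with the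
    radius ([mean_square_le]). It also bounds the radial maximal function by a maximal
    function of Poisson averages, for which a T T* argument gives an estimate in L^2
    ([finite_maximal], [radial_max_le]); the argument rests on the fact that, for unit
    complex numbers x, y, z, the Poisson kernels at (x, y) or those at (z, y) are at most
    four times those at (x, z), whatever their radii. Monotonicity and the parallelogram
    identity show that F is close in mean to its dilations [z |-> F (k z)], uniformly in
    the radius ([dilation_diff_uniform]); the maximal inequality then makes them close
    uniformly along almost every radius, and as the dilations have radial limits so does F
    ([radial_limit_ae]). Dominated convergence shows that the mean square of the radial
    limit is the supremum of the mean squares ([radial_limit_mean_square]).

    Integrals over circles are replaced by averages over the roots of unity of order
    [2 ^ k]. They are finite sums, so that the T T* argument takes place on a finite set
    and is transferred to the measure by integrating over the orbits of a finite group of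
    rotations. Goursat's lemma is proved for trapezoid sums ([goursat]) and, in the
    logarithmic coordinate, gives the mean value property ([mean_value]) and from it the
    Poisson formula.

    Descent to the image. The basic polynomials are homogeneous, so [theta (r t)] is the
    image of [theta t] under a weighted dilation depending on [r] only. Hence the radial
    limit of [f o theta] at [t], if it exists, depends only on [theta t] and on [f]: it is
    the limit of [f] along the dilations of [theta t] ([boundary_value]). No division of
    F by [ell_rho] at its zeros is needed, because [ell_rho] is homogeneous as well: if it
    vanishes at [t], then F vanishes along the whole radius, and the zeros do not count
    for the weighted measure. Restricting [f] to its points of continuity makes the
    boundary value a Borel function, and the two integrals to be compared are both equal to
    the energy of F up to the factor [c_rho ^- 2]. *)

(** * The real modulus of a complex number *)

Section ComplexModulus.
Variable R : realType.
Implicit Types (z w : R[i]) (x y : R).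
Local Notation nc := (@normc R).

Lemma normr_normc z : `|z| = (nc z)%:C. Proof. by case: z. Qed.

Lemma normc_ge0 z : 0 <= nc z.
Proof. by case: z => a b; exact: sqrtr_ge0. Qed.

Lemma normcB z w : nc (z - w) <= nc z + nc w.
Proof. by rewrite -(normcN w); exact: le_normcD. Qed.

Lemma normc_subC z w : nc (z - w) = nc (w - z).
Proof. by rewrite -normcN opprB. Qed.

Lemma normcR x : nc x%:C = `|x|.
Proof. by rewrite /= expr0n /= addr0 sqrtr_sqr. Qed.

Lemma normc_ge0R x : 0 <= x -> nc x%:C = x.
Proof. by move=> x0; rewrite normcR ger0_norm. Qed.

Lemma normcX z n : nc (z ^+ n) = nc z ^+ n.
Proof.
elim: n => [|n IH]; first by rewrite !expr0 normc1.
by rewrite !exprS normcM IH.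
Qed.

Lemma normc_eq0 z : (nc z == 0) = (z == 0).
Proof.
apply/eqP/eqP => [/eq0_normc//|->].
exact: normc0.
Qed.

Lemma normc_gt0 z : (0 < nc z) = (z != 0).
Proof. by rewrite lt0r normc_ge0 andbT normc_eq0. Qed.

Lemma sqr_normcE z : nc z ^+ 2 = complex.Re z ^+ 2 + complex.Im z ^+ 2.
Proof. by case: z => a b /=; rewrite sqr_sqrtr // addr_ge0 // sqr_ge0. Qed.

Lemma normc_ge_normRe z : `|complex.Re z| <= nc z.
Proof.
rewrite -(ler_pXn2r (n := 2)) ?nnegrE ?normc_ge0 //.
by rewrite sqr_normcE real_normK ?num_real // lerDl sqr_ge0.
Qed.

Lemma normc_ge_normIm z : `|complex.Im z| <= nc z.
Proof.
rewrite -(ler_pXn2r (n := 2)) ?nnegrE ?normc_ge0 //.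
by rewrite sqr_normcE real_normK ?num_real // lerDr sqr_ge0.
Qed.

Lemma normc_le_ReIm z : nc z <= `|complex.Re z| + `|complex.Im z|.
Proof.
rewrite -(ler_pXn2r (n := 2)) ?nnegrE ?normc_ge0 ?addr_ge0 //.
rewrite sqr_normcE sqrrD !real_normK ?num_real //.
by rewrite lerD2r lerDl mulrn_wge0 // mulr_ge0.
Qed.

Lemma normc_sum I (r : seq I) (P : pred I) (F : I -> R[i]) :
  nc (\sum_(i <- r | P i) F i) <= \sum_(i <- r | P i) nc (F i).
Proof.
elim/big_ind2: _ => [|z x w y zx wy|//].
  by rewrite normc0.
by apply: le_trans (le_normcD _ _) _; exact: lerD.
Qed.

Lemma normc_parallelogram z w :
  nc (z - w) ^+ 2 + nc (z + w) ^+ 2 = 2 * nc z ^+ 2 + 2 * nc w ^+ 2.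
Proof. by rewrite !sqr_normcE !raddfD !raddfN /=; ring. Qed.

End ComplexModulus.

(** * Dyadic trapezoid sums around a parallelogram *)

Section Goursat.
Variable R : realType.
Local Notation C := R[i].
Local Notation nc := (@normc R).
Implicit Types (g h : C -> C) (z u v w : C).

(** Complex differentiability with real tolerances: this is the form in which the
    bisection argument below consumes it; [cdiff_differentiable] identifies it with
    Frechet differentiability over the complex numbers. *)
Definition cdiff g z := exists b : C, forall e : R, 0 < e ->
  exists2 d : R, 0 < d & forall w, nc (w - z) < d ->
    nc (g w - g z - b * (w - z)) <= e * nc (w - z).

(** The trapezoid approximation, with 2 ^ k steps, of the integral of [g] along the
    segment from [z] to [z + u]. No limit is taken: these sums are additive under
    bisection and exact on affine functions, which is all that the proof of Goursat's
    lemma asks of an integral. The trapezoid rule, unlike one-sided sums, is in addition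
    invariant under reversal of the segment ([trapezoid_opp]). *)
Fixpoint trapezoid g k z u : C :=
  if k is k'.+1 then trapezoid g k' z (u / 2) + trapezoid g k' (z + u / 2) (u / 2)
  else u * ((g z + g (z + u)) / 2).

Lemma trapezoid_opp g k z u : trapezoid g k (z + u) (- u) = - trapezoid g k z u.
Proof.
elim: k z u => [|k IH] z u /=; first by rewrite addrK; ring.
rewrite mulNr (_ : z + u = z + u / 2 + u / 2); last by field.
by rewrite IH addrK IH opprD addrC.
Qed.

Lemma trapezoidB g h k z u :
  trapezoid (fun w => g w - h w) k z u = trapezoid g k z u - trapezoid h k z u.
Proof.
elim: k z u => [|k IH] z u /=; first by field.
by rewrite !IH; ring.
Qed.

Lemma trapezoid_affine a b k z u :
  trapezoid (fun w => a + b * w) k z u = u * (a + b * (z + u / 2)).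
Proof.
elim: k z u => [|k IH] z u /=; first by field.
by rewrite !IH; field.
Qed.

Lemma normc_trapezoid_le g k z u (M : R) :
  (forall x : R, 0 <= x <= 1 -> nc (g (z + x%:C * u)) <= M) ->
  nc (trapezoid g k z u) <= M * nc u.
Proof.
have half_nc (w : C) : nc (w / 2) = nc w / 2.
  rewrite normcM normcV.
  by rewrite -[2 : C](rmorph_nat (real_complex R) 2) normc_ge0R.
elim: k z u => [|k IH] z u gM /=.
  rewrite normcM mulrC ler_wpM2r ?normc_ge0 //.
  rewrite half_nc ler_pdivrMr // mulr_natr mulr2n.
  apply: le_trans (le_normcD _ _) _; apply: lerD.
    by have := gM 0; rewrite lexx ler01 mul0r addr0; exact.
  by have := gM 1; rewrite lexx ler01 mul1r; exact.
apply: le_trans (le_normcD _ _) _; rewrite [nc u]splitr mulrDr.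
have twoE : (2 : C) = 2%:C by rewrite (rmorph_nat (real_complex R) 2).
apply: lerD; rewrite -half_nc; apply: IH => x /andP[x0 x1].
  have := gM (x / 2); rewrite rmorphM fmorphV /= -twoE mulrAC -mulrA; apply.
  by apply/andP; split; lra.
have := gM ((1 + x) / 2); rewrite rmorphM fmorphV /= -twoE rmorphD rmorph1 /=.
rewrite (_ : z + u / 2 + x%:C * (u / 2) = z + (1 + x%:C) / 2 * u); last by field.
by apply; apply/andP; split; lra.
Qed.

(** The trapezoid sums along the boundary of the parallelogram with corner [z] and
    sides [u] and [v]. Negative multiples of a side are allowed, so that any of the four
    corners can serve as the base point. *)
Definition contour g k z u v :=
  trapezoid g k z u + trapezoid g k (z + u) v - trapezoid g k (z + v) u - trapezoid g k z v.

Lemma contourS g k z u v : contour g k.+1 z u v =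
  contour g k z (u / 2) (v / 2) + contour g k (z + u / 2) (u / 2) (v / 2) +
  (contour g k (z + v / 2) (u / 2) (v / 2) +
   contour g k (z + u / 2 + v / 2) (u / 2) (v / 2)).
Proof.
rewrite /contour /=.
rewrite (_ : z + u / 2 + u / 2 = z + u); last by field.
rewrite (_ : z + v / 2 + v / 2 = z + v); last by field.
rewrite (_ : z + v / 2 + u / 2 = z + u / 2 + v / 2); last by ring.
rewrite (_ : z + u / 2 + v / 2 + u / 2 = z + u + v / 2); last by field.
rewrite (_ : z + u / 2 + v / 2 + v / 2 = z + v + u / 2); last by field.
by ring.
Qed.

Lemma contour_oppl g k z u v : contour g k (z + u) (- u) v = - contour g k z u v.
Proof.
rewrite /contour trapezoid_opp addrK (_ : z + u + v = z + v + u); last by ring.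
by rewrite trapezoid_opp; ring.
Qed.

Lemma contour_oppr g k z u v : contour g k (z + v) u (- v) = - contour g k z u v.
Proof.
rewrite /contour trapezoid_opp addrK (_ : z + v + u = z + u + v); last by ring.
by rewrite trapezoid_opp; ring.
Qed.

Lemma contour_affine a b k z u v : contour (fun w => a + b * w) k z u v = 0.
Proof. by rewrite /contour !trapezoid_affine; field. Qed.

Lemma contourB g h k z u v :
  contour (fun w => g w - h w) k z u v = contour g k z u v - contour h k z u v.
Proof. by rewrite /contour !trapezoidB; ring. Qed.

Definition parallelogram z u v w := exists2 x : R, 0 <= x <= 1 &
  exists2 y : R, 0 <= y <= 1 & w = z + x%:C * u + y%:C * v.

Lemma normc_contour_le g k z u v (M : R) : (forall w, parallelogram z u v w -> nc (g w) <= M) ->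
  nc (contour g k z u v) <= 2 * M * (nc u + nc v).
Proof.
move=> gM.
have I0 : (0 : R) <= (0 : R) <= 1 by apply/andP; split; lra.
have I1 : (0 : R) <= (1 : R) <= 1 by apply/andP; split; lra.
have a1 : nc (trapezoid g k z u) <= M * nc u.
  by apply: normc_trapezoid_le => x xI; apply: gM; exists x => //; exists 0 => //; rewrite mul0r
    addr0.
have a2 : nc (trapezoid g k (z + u) v) <= M * nc v.
  by apply: normc_trapezoid_le => x xI; apply: gM; exists 1 => //; exists x => //; rewrite mul1r.
have a3 : nc (trapezoid g k (z + v) u) <= M * nc u.
  by apply: normc_trapezoid_le => x xI; apply: gM; exists x => //; exists 1 => //; rewrite mul1r
    addrAC.
have a4 : nc (trapezoid g k z v) <= M * nc v.
  by apply: normc_trapezoid_le => x xI; apply: gM; exists 0 => //; exists x => //; rewrite mul0r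
    addr0.
have := le_trans (normcB _ _) (lerD (le_trans (normcB _ _) (lerD
  (le_trans (le_normcD _ _) (lerD a1 a2)) a3)) a4).
by rewrite -/(contour g k z u v); lra.
Qed.

Definition contour_eventually_le g z u v (e : R) :=
  \forall k \near \oo, nc (contour g k z u v) <= e.

(** The statement that the contour integral is zero, phrased on its approximations. *)
Definition contour_vanish g z u v := forall e : R, 0 < e -> contour_eventually_le g z u v e.

(** Nested dyadic intervals have a common point: the supremum of their left ends. *)
Lemma nested_dyadic (x : nat -> R) :
  (forall n, x n.+1 = x n \/ x n.+1 = x n + 2^-1 ^+ n.+1) ->
  exists X, forall n, x n <= X <= x n + 2^-1 ^+ n.
Proof.
move=> xS.
have e0 (n : nat) : 0 <= 2^-1 ^+ n :> R by apply: exprn_ge0.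
have xle n k : x n <= x (n + k)%N.
  elim: k => [|k IH]; first by rewrite addn0.
  by rewrite addnS; apply: le_trans IH _; case: (xS (n + k)%N) => ->; rewrite ?lerDl.
have xge n k : x (n + k)%N + 2^-1 ^+ (n + k) <= x n + 2^-1 ^+ n.
  elim: k => [|k IH]; first by rewrite addn0.
  apply: le_trans IH; rewrite addnS.
  have E : 2^-1 ^+ (n + k) = 2 * 2^-1 ^+ (n + k).+1 :> R.
    by rewrite exprS mulrA divff ?mul1r ?pnatr_eq0.
  by rewrite E; have := e0 (n + k).+1; case: (xS (n + k)%N) => ->; lra.
have xub n k : x k <= x n + 2^-1 ^+ n.
  have [nk|/ltnW kn] := leqP n k.
    by rewrite -(subnKC nk); apply: le_trans (xge n (k - n)%N); rewrite lerDl.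
  by rewrite -(subnKC kn); apply: le_trans (xle k (n - k)%N) _; rewrite lerDl.
exists (sup (range x)) => n; apply/andP; split.
  apply: ub_le_sup; last by exists n.
  by exists (x 0%N + 2^-1 ^+ 0) => _ [k _ <-]; exact: xub.
apply: ge_sup; first by exists (x 0%N), 0%N.
by move=> _ [k _ <-]; exact: xub.
Qed.

Lemma contour_le_split g z u v (e1 e2 e3 e4 : R) :
  contour_eventually_le g z (u / 2) (v / 2) e1 ->
  contour_eventually_le g (z + u / 2) (u / 2) (v / 2) e2 ->
  contour_eventually_le g (z + v / 2) (u / 2) (v / 2) e3 ->
  contour_eventually_le g (z + u / 2 + v / 2) (u / 2) (v / 2) e4 ->
  contour_eventually_le g z u v (e1 + e2 + (e3 + e4)).
Proof.
move=> v1 v2 v3 v4.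
have [N _ HN] : \forall k \near \oo, nc (contour g k.+1 z u v) <= e1 + e2 + (e3 + e4).
  near=> k; rewrite contourS.
  have h1 : nc (contour g k z (u / 2) (v / 2)) <= e1 by near: k; exact: v1.
  have h2 : nc (contour g k (z + u / 2) (u / 2) (v / 2)) <= e2.
    by near: k; exact: v2.
  have h3 : nc (contour g k (z + v / 2) (u / 2) (v / 2)) <= e3.
    by near: k; exact: v3.
  have h4 : nc (contour g k (z + u / 2 + v / 2) (u / 2) (v / 2)) <= e4.
    by near: k; exact: v4.
  exact (le_trans (le_normcD _ _) (lerD (le_trans (le_normcD _ _) (lerD h1 h2))
    (le_trans (le_normcD _ _) (lerD h3 h4)))).
by exists N.+1 => // -[//|k] /= Nk; exact: HN.
Unshelve. all: by end_near. Qed.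

End Goursat.

(** * Goursat's lemma, with a possible exceptional corner *)

Section GoursatTheorem.
Variable R : realType.
Local Notation C := R[i].
Local Notation nc := (@normc R).
Implicit Types (g h : C -> C) (z u v w : C).

Let twoC : (2 : C) = 2%:C. Proof. by rewrite (rmorph_nat (real_complex R) 2). Qed.

Lemma geometric_half_lt (a : R) : 0 < a -> exists n, 2^-1 ^+ n < a.
Proof.
move=> a0; have : ((fun n => 2^-1 ^+ n) : nat -> R) @ \oo --> (0 : R).
  by apply: cvg_expr; rewrite ger0_norm ?invr_ge0 // invf_lt1 // ltr1n.
move=> /cvgr_lt /(_ a a0) [N _ HN]; exists N.
by apply: HN => /=.
Qed.

(** Bisection: if the sums do not become smaller than [e], then those of one of the
    four quarters do not become smaller than [e / 4]. Iterating, the parallelograms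
    shrink to a point of the closed parallelogram, where [g] is affine up to an error
    that is small compared to the diameter; the affine part contributes nothing, and the
    remainder is [o(4 ^- n)], which is absurd. *)
Theorem goursat g z u v :
  (forall w, parallelogram z u v w -> cdiff g w) -> contour_vanish g z u v.
Proof.
move=> gd; apply: contrapT => /existsNP[e /not_implyP[e0 eN]].
pose cell n (p : R * R) (r : R) :=
  contour_eventually_le g (z + p.1%:C * u + p.2%:C * v) ((2^-1 ^+ n)%:C * u)
    ((2^-1 ^+ n)%:C * v) r.
pose bad n (p : R * R) := ~ cell n p (e * 4^-1 ^+ n).
have step (q : nat * (R * R)) : exists p : R * R, bad q.1 q.2 ->
    [/\ bad q.1.+1 p, p.1 = q.2.1 \/ p.1 = q.2.1 + 2^-1 ^+ q.1.+1
     & p.2 = q.2.2 \/ p.2 = q.2.2 + 2^-1 ^+ q.1.+1].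
  case: q => n [x y] /=; apply: contrapT => /forallNP noP.
  have good p : (p.1 = x \/ p.1 = x + 2^-1 ^+ n.+1) ->
    (p.2 = y \/ p.2 = y + 2^-1 ^+ n.+1) -> cell n.+1 p (e * 4^-1 ^+ n.+1).
    by move=> p1 p2; apply: contrapT => bp; apply: (noP p).
  have bxy : bad n (x, y).
    by apply: contrapT => nb; apply: (noP (x, y)) => bxy; case: nb.
  have half (w : C) : (2^-1 ^+ n.+1)%:C * w = (2^-1 ^+ n)%:C * w / 2.
    by rewrite exprS rmorphM fmorphV /= -twoC; ring.
  have quarter : e * 4^-1 ^+ n.+1 = e * 4^-1 ^+ n / 4 by rewrite exprS; ring.
  have mv (a b u' v' : C) r : a = b -> contour_eventually_le g a u' v' r ->
    contour_eventually_le g b u' v' r by move=> ->.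
  apply: bxy; have quarters (r : R) : r = r / 4 + r / 4 + (r / 4 + r / 4) by field.
  rewrite /cell [e * _]quarters; apply: contour_le_split; rewrite -?half -?quarter.
  - by apply: (good (x, y)); left.
  - apply: (mv _ _ _ _ _ _ (good (x + 2^-1 ^+ n.+1, y) (or_intror erefl)
      (or_introl erefl))).
    by rewrite /= rmorphD /=; ring.
  - apply: (mv _ _ _ _ _ _ (good (x, y + 2^-1 ^+ n.+1) (or_introl erefl)
      (or_intror erefl))).
    by rewrite /= rmorphD /=; ring.
  - apply: (mv _ _ _ _ _ _ (good (x + 2^-1 ^+ n.+1, y + 2^-1 ^+ n.+1)
      (or_intror erefl) (or_intror erefl))).
    by rewrite /= !rmorphD /=; ring.
have [nxt nxtP] := choice step.
pose p := fix p n := if n is n'.+1 then nxt (n', p n') else (0 : R, 0 : R).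
have badp n : bad n (p n).
  elim: n => [|n IH]; last by have [] := nxtP (n, p n) IH.
  by rewrite /bad /cell /= !expr0 !mul0r !addr0 !mul1r mulr1.
have [X XP] := @nested_dyadic _ (fun n => (p n).1)
  (fun n => let: And3 _ h _ := nxtP (n, p n) (badp n) in h).
have [Y YP] := @nested_dyadic _ (fun n => (p n).2)
  (fun n => let: And3 _ _ h := nxtP (n, p n) (badp n) in h).
pose c := z + X%:C * u + Y%:C * v; pose s := nc u + nc v.
have s0 : 0 <= s by rewrite addr_ge0 // normc_ge0.
(* The parallelograms shrink to c, where g is differentiable. *)
have [b bP] : cdiff g c.
  apply: gd; exists X; first by have := XP 0%N; rewrite /= expr0 add0r.
  by exists Y => //; have := YP 0%N; rewrite /= expr0 add0r.
have s2 : 0 < 2 * (s ^+ 2 + 1) by rewrite mulr_gt0 // ltr_wpDl // sqr_ge0.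
have [d d0 dP] := bP (e / (2 * (s ^+ 2 + 1))) (divr_gt0 e0 s2).
have [n nd] : exists n, 2^-1 ^+ n < d / (s + 1).
  by apply: geometric_half_lt; rewrite divr_gt0 // ltr_wpDl.
apply: (badp n); apply: filterE => k.
set r := 2^-1 ^+ n in nd *; have r0 : 0 < r by rewrite exprn_gt0.
rewrite -[contour _ _ _ _ _]subr0.
rewrite -(contour_affine (g c - b * c) b k (z + (p n).1%:C * u + (p n).2%:C * v)
  (r%:C * u) (r%:C * v)) -contourB.
have rs : r * s < d.
  by move: nd; rewrite ltr_pdivlMr ?ltr_wpDl // mulrDr mulr1; lra.
pose M := e / (2 * (s ^+ 2 + 1)) * (r * s).
apply: (@le_trans _ _ (2 * M * (nc (r%:C * u) + nc (r%:C * v)))).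
  apply: normc_contour_le => w [x /andP[x0 x1] [y /andP[y0 y1] ->]].
  set w' := (X in g X).
  have dist : nc (w' - c) <= r * s.
    have -> : w' - c = ((p n).1 + x * r - X)%:C * u + ((p n).2 + y * r - Y)%:C * v.
      by rewrite /w' /c !(rmorphD, rmorphN, rmorphM) /=; ring.
    apply: le_trans (le_normcD _ _) _.
    rewrite !normcM !normcR /s mulrDr.
    have [/andP[Xl Xr] /andP[Yl Yr]] := (XP n, YP n); rewrite -/r in Xr Yr.
    have xr : 0 <= x * r <= r.
      by rewrite mulr_ge0 ?(ltW r0) // ler_piMl // ltW.
    have yr : 0 <= y * r <= r.
      by rewrite mulr_ge0 ?(ltW r0) // ler_piMl // ltW.
    case/andP: xr => xr0 xr1; case/andP: yr => yr0 yr1.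
    by apply: lerD; rewrite ler_wpM2r ?normc_ge0 // ler_norml;
      apply/andP; split; lra.
  have := dP w' (le_lt_trans dist rs).
  rewrite (_ : g w' - g c - b * (w' - c) = g w' - (g c - b * c + b * w'));
    last by ring.
  move=> /le_trans; apply; rewrite ler_wpM2l // ltW //; exact: divr_gt0.
rewrite !normcM !normcR (gtr0_norm r0) -mulrDr -/s /M.
have -> : 4^-1 ^+ n = r ^+ 2 :> R.
  by rewrite -exprM mulnC exprM; congr (_ ^+ _); rewrite exprVn; congr (_^-1); ring.
rewrite (_ : 2 * (e / (2 * (s ^+ 2 + 1)) * (r * s)) * (r * s) =
  e * r ^+ 2 * (s ^+ 2 / (s ^+ 2 + 1))); last first.
  by field; apply: lt0r_neq0; rewrite ltr_wpDl // sqr_ge0.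
rewrite ler_piMr //; first by rewrite mulr_ge0 ?sqr_ge0 // ltW.
by rewrite ler_pdivrMr ?mul1r ?lerDl // ltr_wpDl // sqr_ge0.
Qed.

(** A function bounded near the corner [z] may fail to be differentiable there: after
    cutting off three quarters, on which [goursat] applies, only a parallelogram based
    at [z] remains, and its contour sums are bounded by its perimeter. *)
Lemma contour_vanish_corner g z u v (d M : R) : 0 < d ->
  (forall w, nc (w - z) < d -> nc (g w) <= M) ->
  (forall x y : R, x%:C * u + y%:C * v = 0 -> x = 0 /\ y = 0) ->
  (forall w, parallelogram z u v w -> w != z -> cdiff g w) ->
  contour_vanish g z u v.
Proof.
move=> d0 gM uv gd.
have M0 : 0 <= M.
  by apply: le_trans (gM z _); rewrite ?normc_ge0 // subrr normc0.
pose r n : R := 2^-1 ^+ n; pose s := nc u + nc v.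
have s0 : 0 <= s by rewrite addr_ge0 // normc_ge0.
have r0 n : 0 < r n by rewrite exprn_gt0.
pose cell n c (e : R) := contour_eventually_le g c ((r n)%:C * u) ((r n)%:C * v) e.
have half n (w : C) : (r n.+1)%:C * w = (r n)%:C * w / 2.
  by rewrite /r exprS rmorphM fmorphV /= -twoC; ring.
have rS n : r n = r n.+1 + r n.+1 by rewrite /r exprS; field.
have rle1 n : r n <= 1 by apply: exprn_ile1; lra.
have regular n x y : (x != 0) || (y != 0) -> 0 <= x -> 0 <= y ->
    x + r n <= 1 -> y + r n <= 1 ->
    forall e, 0 < e -> cell n (z + x%:C * u + y%:C * v) e.
  move=> xy x0 y0 x1 y1; apply: goursat => w [a /andP[a0 a1] [b /andP[b0 b1] ->]].
  have ar : 0 <= a * r n by rewrite mulr_ge0 // ltW.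
  have br : 0 <= b * r n by rewrite mulr_ge0 // ltW.
  have ar1 : a * r n <= r n by rewrite ler_piMl // ltW.
  have br1 : b * r n <= r n by rewrite ler_piMl // ltW.
  have -> : z + x%:C * u + y%:C * v + a%:C * ((r n)%:C * u) + b%:C * ((r n)%:C * v) =
     z + (x + a * r n)%:C * u + (y + b * r n)%:C * v.
    by rewrite !(rmorphD, rmorphM) /=; ring.
  apply: gd.
    exists (x + a * r n); first by apply/andP; split; lra.
    by exists (y + b * r n) => //; apply/andP; split; lra.
  apply/negP => /eqP; rewrite -addrA => /(canRL (addKr _)); rewrite addNr => /uv[x' y'].
  by case/orP: xy => /eqP; apply; lra.
have zoom n e : (forall t, 0 < t -> cell n z (e + t)) ->
    forall t, 0 < t -> cell 0%N z (e + t).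
  move=> H; elim: n H => [//|n IH] H; apply: IH => t t0.
  have -> : e + t = (e + t / 4) + t / 4 + (t / 4 + t / 4) by field.
  have t4 : 0 < t / 4 by apply: divr_gt0.
  have rn := rS n; have := rle1 n; have := r0 n.+1 => rn0 rn1.
  have mv (a b u' v' : C) q : a = b -> contour_eventually_le g a u' v' q ->
    contour_eventually_le g b u' v' q by move=> ->.
  apply: contour_le_split; rewrite -!half.
  - exact: H.
  - apply: (mv (z + (r n.+1)%:C * u + 0%:C * v)); first by rewrite rmorph0 mul0r addr0.
    by apply: regular => //; [rewrite gt_eqF| apply: ltW | lra | lra].
  - apply: (mv (z + 0%:C * u + (r n.+1)%:C * v)); first by rewrite rmorph0 mul0r addr0.
    by apply: regular => //; [rewrite [X in _ || ~~ X]gt_eqF ?orbT| apply: ltW | lra | lra].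
  - by apply: regular => //; [rewrite gt_eqF| apply: ltW | apply: ltW| lra | lra].
move=> e e0.
have [n nP] : exists n, 2^-1 ^+ n < Num.min (d / (s + 1)) (e / 2 / (2 * M * s + 1)).
  have Ms : 0 < 2 * M * s + 1 by rewrite ltr_wpDl // !mulr_ge0.
  apply: geometric_half_lt; rewrite lt_min !divr_gt0 //.
  by rewrite ltr_wpDl.
move: nP; rewrite lt_min -/(r n) => /andP[].
rewrite ltr_pdivlMr ?ltr_wpDl // ltr_pdivlMr ?ltr_wpDl ?mulr_ge0 //.
rewrite [_ * (s + 1)]mulrDr [_ * (2 * M * s + 1)]mulrDr !mulr1 => nd ne.
have small : cell n z (e / 2).
  apply: filterE => k.
  apply: (@le_trans _ _ (2 * M * (nc ((r n)%:C * u) + nc ((r n)%:C * v)))).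
    apply: normc_contour_le => w [x /andP[x0 x1] [y /andP[y0 y1] ->]]; apply: gM.
    have -> : z + x%:C * ((r n)%:C * u) + y%:C * ((r n)%:C * v) - z =
       (x * r n)%:C * u + (y * r n)%:C * v by rewrite !rmorphM /=; ring.
    apply: (@le_lt_trans _ _ (r n * s)); last by have := r0 n; lra.
    apply: le_trans (le_normcD _ _) _.
    rewrite !normcM !normcR /s mulrDr.
    by apply: lerD; rewrite ler_wpM2r ?normc_ge0 // ger0_norm ?mulr_ge0 ?ler_piMl // ltW.
  rewrite !normcM !normcR (gtr0_norm (r0 n)) -mulrDr -/s.
  by have := r0 n; lra.
have := zoom n (e / 2) _ (e / 2); rewrite -splitr /cell /r !expr0 !mul1r; apply.
  by move=> t t0; apply: filterS small => k /le_trans; apply; lra.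
by apply: divr_gt0.
Qed.

End GoursatTheorem.

(** * Complex derivatives and the exponential *)

Lemma difference_quotientE (K : numFieldType) (g : K^o -> K^o) (z h : K^o) :
  h^-1 *: ((g \o shift z) (h *: 1) - g z) = (h : K)^-1 * (g (h + z) - g z).
Proof. by have h1 : h *: 1 = h := mulr1 h; rewrite h1. Qed.

Section ComplexDerivative.
Variable R : realType.
Local Notation C := R[i].
Local Notation nc := (@normc R).
Implicit Types (z u v w : C).

Lemma complex_gt0P (e : C) : 0 < e -> exists2 d : R, 0 < d & e = d%:C.
Proof.
case: e => a b; rewrite ltcE /= => /andP[/eqP -> a0].
by exists a.
Qed.

(** The norm of the topology takes its values in the complex numbers; this lemma and
    [cvg_normcP] restate neighbourhoods and limits with the real modulus. *)
Lemma nbhs_normcP (z : Cplx R) (A : set (Cplx R)) :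
  nbhs z A <-> exists2 d : R, 0 < d & forall w : Cplx R, nc (w - z) < d -> A w.
Proof.
split=> [/nbhs_normP[e /= e0 eA]|[d d0 dA]].
  have [d d0 de] := complex_gt0P e0; exists d => // w wd; apply: eA.
  by rewrite /ball_ /= distrC de normr_normc ltcR.
apply/nbhs_ballP; exists d%:C; rewrite /= ?ltcR // => w.
by rewrite -ball_normE /ball_ /= distrC normr_normc ltcR; exact: dA.
Qed.

Lemma cvg_normcP {T : Type} {F : set_system T} {FF : Filter F} (f : T -> Cplx R) (l : Cplx R) :
  f x @[x --> F] --> l <-> forall e : R, 0 < e -> \forall x \near F, nc (f x - l) <= e.
Proof.
split=> [/cvgrPdist_le fl e e0|fl].
  have e0' : 0 < e%:C by rewrite ltcR.
  by apply: filterS (fl _ e0') => x; rewrite distrC normr_normc lecR.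
apply/cvgrPdist_le => e /complex_gt0P[d d0 ->]; apply: filterS (fl d d0) => x.
by rewrite distrC normr_normc lecR.
Qed.

Lemma cdiff_differentiable (g : Cplx R -> Cplx R) (z : Cplx R) :
  cdiff g z <-> differentiable g z.
Proof.
split=> [[b bP]|].
  apply/derivable1_diffP; apply/cvg_ex; exists b; apply/cvg_normcP => e e0.
  have [d d0 dP] := bP e e0.
  apply/nbhs_normcP; exists d => // h; rewrite subr0 => hd h0.
  have := dP (h + z); rewrite addrK => /(_ hd).
  rewrite -(@ler_pM2r _ (nc h)^-1) ?invr_gt0 ?normc_gt0 //.
  rewrite -mulrA divff ?mulr1 ?normc_eq0 // -normcV.
  rewrite -normcM; apply: le_trans.
  rewrite difference_quotientE le_eqVlt; apply/orP; left; apply/eqP; congr nc.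
  by field.
move=> /derivable1_diffP /cvg_ex[b /cvg_normcP bP]; exists b => e e0.
have /nbhs_normcP[d d0 dP] := bP e e0; exists d => // w wd.
have [->|wz] := eqVneq w z.
  by rewrite !subrr mulr0 subr0 normc0 mulr0.
have h0 : w - z != 0 by rewrite subr_eq0.
have := dP (w - z); rewrite subr0 => /(_ wd h0).
rewrite difference_quotientE subrK.
rewrite -(@ler_pM2r _ (nc (w - z))) ?normc_gt0 //.
rewrite -normcM; apply: le_trans.
rewrite le_eqVlt; apply/orP; left; apply/eqP; congr nc.
by rewrite mulrBl mulrAC mulVf // mul1r.
Qed.

Lemma cdiff_continuous (g : C -> C) z : cdiff g z -> forall e : R, 0 < e ->
  exists2 d : R, 0 < d & forall w, nc (w - z) < d -> nc (g w - g z) <= e.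
Proof.
move=> [b bP] e e0.
have [d d0 dP] := bP 1 ltr01.
have K0 : 0 < nc b + 1 by rewrite ltr_wpDl // normc_ge0.
exists (Num.min d (e / (nc b + 1))).
  by rewrite lt_min d0 divr_gt0.
move=> w; rewrite lt_min => /andP[/dP wd].
rewrite ltr_pdivlMr // => we.
rewrite -[g w - g z](subrK (b * (w - z))).
apply: le_trans (le_normcD _ _) _.
rewrite normcM.
by have := normc_ge0 (w - z); lra.
Qed.

(** The complex exponential, in terms of its real and imaginary parts. *)
Definition cexp z : C :=
  (expR (complex.Re z) * cos (complex.Im z)) +i* (expR (complex.Re z) * sin (complex.Im z)).

Lemma cexpD z w : cexp (z + w) = cexp z * cexp w.
Proof.
case: z w => [a b] [c d]; apply/eqP; rewrite eq_complex /=.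
rewrite expRD cosD sinD.
by apply/andP; split; apply/eqP; ring.
Qed.

Lemma normc_cexp z : nc (cexp z) = expR (complex.Re z).
Proof.
apply/eqP; rewrite -(@eqrXn2 _ 2) ?normc_ge0 ?expR_ge0 // sqr_normcE /=.
by rewrite !exprMn -mulrDr cos2Dsin2 mulr1.
Qed.

Lemma derive1_real_bound (f : R -> R) (x df : R) : is_derive x 1 f df ->
  forall e : R, 0 < e -> exists2 d : R, 0 < d & forall y, `|y| < d ->
    `|f (y + x) - f x - df * y| <= e * `|y|.
Proof.
move=> [fx <-] e e0; have /cvgrPdist_le/(_ e e0) := fx.
rewrite /derive => /nbhs_normP[d /= d0 dP]; exists d => // y yd.
have [->|y0] := eqVneq y 0.
  by rewrite add0r subrr mulr0 subr0 normr0 mulr0.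
have := dP y; rewrite /ball_ /= sub0r normrN => /(_ yd y0).
rewrite difference_quotientE.
rewrite -(@ler_pM2r _ `|y|) ?normr_gt0 // -normrM; apply: le_trans.
rewrite le_eqVlt; apply/orP; left; apply/eqP; rewrite -normrN; congr `|_|.
rewrite opprB mulrBl; congr (_ - _).
by rewrite mulrAC mulVf // mul1r.
Qed.

Lemma cexp_near0 (e : R) : 0 < e -> exists2 d : R, 0 < d & forall w, nc w < d ->
  nc (cexp w - 1 - w) <= e * nc w.
Proof.
move=> e0; have e8 : 0 < e / 8 by apply: divr_gt0.
have [d1 d10 d1P] := derive1_real_bound (is_derive_expR (0 : R)) e8.
have [d2 d20 d2P] := derive1_real_bound (is_derive_cos (0 : R)) e8.
have [d3 d30 d3P] := derive1_real_bound (is_derive_sin (0 : R)) e8.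
exists (Num.min (Num.min d1 d2) (Num.min d3 (Num.min 1 (e / 8)))).
  by rewrite !lt_min d10 d20 d30 e8 ltr01.
move=> w; rewrite !lt_min => /andP[/andP[w1 w2] /and3P[w3 wl1 we]].
have := normc_ge_normRe w; have := normc_ge_normIm w.
set x := complex.Re w; set y := complex.Im w => yw xw.
have := d1P x (le_lt_trans xw w1); rewrite addr0 expR0 mul1r => Ex.
have := d2P y (le_lt_trans yw w2); rewrite addr0 cos0 sin0 oppr0 mul0r subr0 => Cy.
have := d3P y (le_lt_trans yw w3); rewrite addr0 cos0 sin0 mul1r subr0 => Sy.
have c1 : `|cos y| <= 1 by rewrite ler_norml cos_geN1 cos_le1.
have s1 : `|sin y| <= 1 by rewrite ler_norml sin_geN1 sin_le1.
have x1 : `|1 + x| <= 2.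
  by apply: le_trans (ler_normD _ _) _; rewrite normr1; lra.
apply: le_trans (normc_le_ReIm _) _.
have -> : complex.Re (cexp w - 1 - w) =
    (expR x - 1 - x) * cos y + (1 + x) * (cos y - 1).
  by rewrite !raddfB /=; ring.
have -> : complex.Im (cexp w - 1 - w) =
    (expR x - 1 - x) * sin y + (1 + x) * (sin y - y) + x * y.
  by rewrite !raddfB /= -/y -/x; ring.
have nx := normr_ge0 x; have ny := normr_ge0 y; have nw := normc_ge0 w.
have k1 : `|(expR x - 1 - x) * cos y| <= e / 8 * nc w.
  rewrite normrM -[leRHS]mulr1; apply: ler_pM => //; apply: le_trans Ex _.
  by rewrite ler_wpM2l // ltW.
have k2 : `|(1 + x) * (cos y - 1)| <= 2 * (e / 8 * nc w).
  rewrite normrM; apply: ler_pM => //; apply: le_trans Cy _.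
  by rewrite ler_wpM2l // ltW.
have k3 : `|(expR x - 1 - x) * sin y| <= e / 8 * nc w.
  rewrite normrM -[leRHS]mulr1; apply: ler_pM => //; apply: le_trans Ex _.
  by rewrite ler_wpM2l // ltW.
have k4 : `|(1 + x) * (sin y - y)| <= 2 * (e / 8 * nc w).
  rewrite normrM; apply: ler_pM => //; apply: le_trans Sy _.
  by rewrite ler_wpM2l // ltW.
have k5 : `|x * y| <= e / 8 * nc w.
  by rewrite normrM; apply: ler_pM => //; apply: le_trans xw (ltW we).
have := lerD (le_trans (ler_normD _ _) (lerD k1 k2)) (le_trans (ler_normD _ _)
  (lerD (le_trans (ler_normD _ _) (lerD k3 k4)) k5)).
have ew : 0 <= e * nc w by rewrite mulr_ge0 // ltW.
by move=> /le_trans; apply; lra.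
Qed.

Lemma cdiff_cexp z : cdiff cexp z.
Proof.
exists (cexp z) => e e0.
have K0 : 0 < nc (cexp z) by rewrite normc_cexp expR_gt0.
have [d d0 dP] := cexp_near0 (divr_gt0 e0 K0); exists d => // w /dP.
rewrite -(@ler_pM2l _ (nc (cexp z))) // -normcM.
rewrite mulrA mulrCA divff ?gt_eqF // mulr1; apply: le_trans.
rewrite le_eqVlt; apply/orP; left; apply/eqP; congr nc.
by rewrite !mulrBr mulr1 -cexpD [z + _]addrC subrK.
Qed.

Lemma cdiff_comp (g h : C -> C) z : cdiff h z -> cdiff g (h z) ->
  cdiff (fun w => g (h w)) z.
Proof.
move=> /cdiff_differentiable hz /cdiff_differentiable ghz.
by apply/cdiff_differentiable; exact: (@differentiable_comp _ (Cplx R) (Cplx R) (Cplx R) h g z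
  hz ghz).
Qed.

End ComplexDerivative.

(** * Averages over roots of unity *)

Section CircleAverages.
Variable R : realType.
Local Notation C := R[i].
Local Notation nc := (@normc R).
Implicit Types (g G : C -> C) (z u v w : C) (k : nat).

Lemma trapezoid_sum g k z u : trapezoid g k z u =
  u / 2 ^+ k * (\sum_(j < 2 ^ k) g (z + j%:R * (u / 2 ^+ k)) + (g (z + u) - g z) / 2).
Proof.
elim: k z u => [|k IH] z u.
  by rewrite /= big_ord1 expr0 mul0r addr0; field.
rewrite /= !IH expnS mul2n -addnn big_split_ord /=.
have -> : u / 2 ^+ k.+1 = u / 2 / 2 ^+ k.
  by rewrite exprS; field; rewrite expf_neq0.
rewrite [X in _ = _ * (_ + X + _)](_ : _ = \sum_(j < 2 ^ k) g (z + u / 2 + j%:R * (u / 2 / 2 ^+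
  k))).
  rewrite (_ : z + u / 2 + u / 2 = z + u); last by field.
  by field; rewrite expf_neq0.
apply: eq_bigr => j _; congr g.
by rewrite natrD natrX; field; rewrite expf_neq0.
Qed.

Lemma trapezoid_periodic g k z u v : (forall w, g (w + v) = g w) ->
  trapezoid g k (z + v) u = trapezoid g k z u.
Proof.
move=> gv; elim: k z u => [|k IH] z u /=; first by rewrite addrAC !gv.
by rewrite addrAC !IH.
Qed.

(** 2 i pi, the period of the exponential. *)
Definition turn : C := 0 +i* (2 * pi).

Lemma cexp_turn : cexp turn = 1.
Proof.
apply/eqP; rewrite eq_complex /= expR0 !mul1r.
by rewrite mulr_natl cos2pi sin2pi !eqxx.
Qed.

(** A primitive root of unity of order 2 ^ k. *)
Definition unity k : C := cexp (turn / 2 ^+ k).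

Lemma cexp_natmul z n : cexp (n%:R * z) = cexp z ^+ n.
Proof.
elim: n => [|n IH]; last by rewrite exprS -IH -cexpD mulrS mulrDl mul1r.
by rewrite mul0r expr0; apply/eqP; rewrite eq_complex /= expR0 cos0 sin0 mulr1 mulr0 !eqxx.
Qed.

Lemma unity_expn k : unity k ^+ (2 ^ k) = 1.
Proof.
rewrite /unity -cexp_natmul natrX mulrC divfK ?expf_neq0 //.
exact: cexp_turn.
Qed.

Lemma normc_unity k : nc (unity k) = 1.
Proof.
rewrite /unity normc_cexp.
suff -> : complex.Re (turn / 2 ^+ k) = 0 by rewrite expR0.
rewrite -[2](rmorph_nat (real_complex R) 2) -rmorphXn -fmorphV.
by rewrite /turn /= mul0r mulr0 subrr.
Qed.

Lemma normc_unityX k j : nc (unity k ^+ j) = 1.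
Proof. by rewrite normcX normc_unity expr1n. Qed.

(** The average over the 2 ^ k-th roots of unity replaces the integral over the unit
    circle throughout. *)
Definition avg k (G : C -> C) : C := (2 ^+ k)^-1 * \sum_(j < 2 ^ k) G (unity k ^+ j).

Lemma cexpR (x : R) : cexp x%:C = (expR x)%:C.
Proof. by apply/eqP; rewrite eq_complex /= cos0 sin0 mulr1 mulr0 !eqxx. Qed.

(** In the coordinate log, an annulus is a rectangle of height 2 i pi. The sums along
    its horizontal sides cancel by periodicity, and those along the vertical sides are
    averages over circles. *)
Lemma contour_annulus G k (x y : R) :
  contour (fun w => G (cexp w)) k x%:C (y - x)%:C turn =
  turn * (avg k (fun w => G ((expR y)%:C * w)) - avg k (fun w => G ((expR x)%:C * w))).
Proof.
have period w : G (cexp (w + turn)) = G (cexp w).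
  by rewrite cexpD cexp_turn mulr1.
have circle (t : R) : trapezoid (fun w => G (cexp w)) k t%:C turn =
    turn * avg k (fun w => G ((expR t)%:C * w)).
  rewrite trapezoid_sum period subrr mul0r addr0 /avg mulrA.
  by congr (_ * _); apply: eq_bigr => j _; rewrite cexpD cexpR cexp_natmul.
rewrite /contour (trapezoid_periodic _ _ _ period) -rmorphD /= addrC subrKC.
by rewrite !circle; ring.
Qed.

Definition avg_vanish (G : nat -> C) := forall e : R, 0 < e ->
  \forall k \near \oo, nc (G k) <= e.

Lemma turn_neq0 : turn != 0.
Proof. by rewrite eq_complex /= negb_and mulf_eq0 pnatr_eq0 /= (gt_eqF (pi_gt0 R)) orbT. Qed.

Lemma annulus_of_contour G (x y : R) :
  contour_vanish (fun w => G (cexp w)) x%:C (y - x)%:C turn ->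
  avg_vanish (fun k => avg k (fun w => G ((expR y)%:C * w)) -
    avg k (fun w => G ((expR x)%:C * w))).
Proof.
move=> v e e0; have t0 : 0 < nc turn by rewrite normc_gt0 turn_neq0.
have := v (nc turn * e) (mulr_gt0 t0 e0).
apply: filterS => k; rewrite contour_annulus normcM.
by rewrite ler_pM2l.
Qed.

Lemma annulus_regular G (x y : R) : x <= y ->
  (forall w, expR x <= nc w <= expR y -> cdiff G w) ->
  avg_vanish (fun k => avg k (fun w => G ((expR y)%:C * w)) -
    avg k (fun w => G ((expR x)%:C * w))).
Proof.
move=> xy Gd; apply: annulus_of_contour; apply: goursat.
move=> w [a /andP[a0 a1] [b /andP[b0 b1] ->]].
apply: cdiff_comp; first exact: cdiff_cexp.
apply: Gd; rewrite normc_cexp !ler_expR.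
rewrite !raddfD /= !mul0r mulr0 !subr0 addr0.
have : 0 <= a * (y - x) by rewrite mulr_ge0 // subr_ge0.
have : a * (y - x) <= y - x by rewrite ler_piMl // subr_ge0.
by move=> h1 h2; apply/andP; split; lra.
Qed.

(** In the coordinate log, the exceptional point [q] is a corner of this rectangle:
    [P] is a logarithm of [q], and the rectangle, of width [- ln q] and height pi, is too
    low to contain another logarithm of [q]. *)
Lemma quadrant_vanish G (q d M : R) (P : C) (s t : R) : 0 < q < 1 ->
  0 < d -> (forall w, nc (w - q%:C) < d -> nc (G w) <= M) ->
  (forall w, q ^+ 2 <= nc w <= 1 -> w != q%:C -> cdiff G w) ->
  cexp P = q%:C -> `|s| = - ln q -> `|t| = pi ->
  contour_vanish (fun w => G (cexp w)) P s%:C (0 +i* t).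
Proof.
move=> /andP[q0 q1] d0 GM Gd Pq sq tpi.
have lnq : 0 < - ln q by rewrite oppr_gt0 ln_lt0 // q0.
have s0 : s != 0 by rewrite -normr_gt0 sq.
have t0 : t != 0 by rewrite -normr_gt0 tpi pi_gt0.
have [e e0 eP] := cdiff_continuous (cdiff_cexp P) (divr_gt0 d0 (ltr0Sn R 1)).
apply: (@contour_vanish_corner _ _ _ _ _ e M) => //.
- move=> w /eP; rewrite Pq => we; apply: GM; apply: le_lt_trans we _.
  by rewrite ltr_pdivrMr // ltr_pMr // ltr1n.
- move=> x y /eqP; rewrite eq_complex /= !mul0r !mulr0 !subr0 ?addr0 ?add0r ?addr0.
  by rewrite !mulf_eq0 (negbTE s0) (negbTE t0) !orbF => /andP[/eqP -> /eqP ->].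
- move=> w [x /andP[x0 x1] [y /andP[y0 y1] ->]] wP.
  apply: cdiff_comp; first exact: cdiff_cexp.
  have xs : ln q <= x * s <= - ln q.
    rewrite -[X in X <= _]opprK -ler_norml normrM sq ger0_norm // ler_piMl //.
    exact: ltW.
  have mod : nc (cexp (P + x%:C * s%:C + y%:C * (0 +i* t))) = q * expR (x * s).
    rewrite !cexpD !normcM Pq normcR gtr0_norm //.
    by rewrite !normc_cexp /= !mul0r !mulr0 !subr0 expR0 mulr1.
  case/andP: xs => xs1 xs2.
  apply: Gd.
    rewrite mod; apply/andP; split.
      by rewrite expr2 ler_pM2l // -[X in X <= _]lnK ?posrE // ler_expR.
    rewrite mulrC -ler_pdivlMr // -[leRHS]lnK ?posrE ?divr_gt0 // ler_expR.
    by rewrite div1r lnV ?posrE.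
  apply: contra wP => /eqP E.
  have x0' : x = 0.
    have := mod; rewrite E normcR gtr0_norm // => /eqP.
    rewrite -[X in X == _]mulr1 (inj_eq (mulfI (lt0r_neq0 q0))) eq_sym.
    move=> /eqP/(congr1 (@ln R)); rewrite expRK ln1 => /eqP.
    by rewrite mulf_eq0 (negbTE s0) orbF => /eqP.
  have y0' : y = 0.
    move: E; rewrite x0' mul0r addr0 cexpD Pq -[RHS]mulr1 => /mulfI.
    have qC : q%:C != 0 by rewrite (inj_eq (@complexI R)) gt_eqF.
    have yt : y%:C * (0 +i* t) = 0 +i* (y * t).
      by apply/eqP; rewrite eq_complex /= !mul0r mulr0 subr0 addr0 !eqxx.
    move=> /(_ qC) /(congr1 (@complex.Re R)).
    rewrite yt /= expR0 mul1r -(cos_norm (y * t)) -[X in _ = X]cos0.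
    rewrite normrM tpi ger0_norm // => /cos_inj.
    rewrite !in_itv /= lexx pi_ge0 mulr_ge0 ?pi_ge0 //= ler_piMl ?pi_ge0 //.
    by move=> /(_ isT isT) /eqP; rewrite mulf_eq0 (gt_eqF (pi_gt0 R)) orbF => /eqP.
  by rewrite x0' y0' !mul0r !addr0.
Qed.

End CircleAverages.

(** * The mean value property *)

Section Poisson.
Variable R : realType.
Local Notation C := R[i].
Local Notation nc := (@normc R).
Implicit Types (g G : C -> C) (z u v w : C) (k : nat).

Lemma contour_vanish_oppl g z u v :
  contour_vanish g z u v -> contour_vanish g (z + u) (- u) v.
Proof.
by move=> H e /H; apply: filterS => k; rewrite contour_oppl normcN.
Qed.

Lemma contour_vanish_oppr g z u v :
  contour_vanish g z u v -> contour_vanish g (z + v) u (- v).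
Proof.
by move=> H e /H; apply: filterS => k; rewrite contour_oppr normcN.
Qed.

(** The annulus from radius [q ^+ 2] to radius 1 has been chosen so that [ln q] is the
    midpoint of its logarithmic width. A first bisection then makes the logarithms
    [ln q] and [ln q + 2 i pi] corners of all four quarters. *)
Lemma annulus_exceptional G (q d M : R) : 0 < q < 1 -> 0 < d ->
  (forall w, nc (w - q%:C) < d -> nc (G w) <= M) ->
  (forall w, q ^+ 2 <= nc w <= 1 -> w != q%:C -> cdiff G w) ->
  avg_vanish (fun k => avg k G - avg k (fun w => G ((q ^+ 2)%:C * w))).
Proof.
move=> q01 d0 GM Gd; have /andP[q0 q1] := q01.
have lnq : ln q < 0 by rewrite ln_lt0.
pose x := ln q + ln q; pose s := - ln q.
have Ex : expR x = q ^+ 2 by rewrite expRD lnK ?posrE // expr2.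
suff : avg_vanish (fun k => avg k (fun w => G ((expR 0)%:C * w)) -
    avg k (fun w => G ((expR x)%:C * w))).
  move=> H e /H; apply: filterS => k; rewrite Ex expR0.
  by rewrite (_ : (fun w => G (1%:C * w)) = G) //; apply: funext => w; rewrite mul1r.
apply: annulus_of_contour => e e0.
have quarters (r : R) : r = r / 4 + r / 4 + (r / 4 + r / 4) by field.
have e4 : 0 < e / 4 by rewrite divr_gt0.
have np : `|pi| = pi :> R by rewrite gtr0_norm ?pi_gt0.
have ns : `|s| = - ln q by rewrite gtr0_norm // oppr_gt0.
have quad P S T (PE : cexp P = q%:C) (SE : `|S| = - ln q) (TE : `|T| = pi) :=
  quadrant_vanish q01 d0 GM Gd PE SE TE.
have p1 : cexp (ln q)%:C = q%:C by rewrite cexpR lnK.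
have p2 : cexp ((ln q)%:C + turn R) = q%:C by rewrite cexpD cexp_turn mulr1.
have mv (g : C -> C) (z u v z' u' v' : C) :  z = z' -> u = u' -> v = v' ->
  contour_vanish g z u v -> contour_eventually_le g z' u' v' (e / 4) by move=> -> -> -> /(_ _ e4).
have twoC : (2 : C) = 2%:C by rewrite (rmorph_nat (real_complex R) 2).
have uE : s%:C = (0 - x)%:C / 2.
  by rewrite twoC -fmorphV -rmorphM; congr _%:C; rewrite /s /x; field.
have vE : 0 +i* pi = turn R / 2.
  rewrite twoC -fmorphV; apply/eqP; rewrite eq_complex /= !mulr0 !mul0r subr0 add0r.
  by rewrite mulrAC divff ?mul1r ?pnatr_eq0 ?eqxx.
have nE : 0 +i* (- pi) = - (turn R / 2).
  by rewrite -vE; apply/eqP; rewrite eq_complex /= oppr0 !eqxx.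
rewrite [e]quarters; apply: contour_le_split.
- have := contour_vanish_oppl (quad _ (- s) pi p1 (etrans (normrN _) ns) np).
  apply: mv; last exact: vE.
    by rewrite -rmorphD; congr _%:C; rewrite /s /x opprK.
  by rewrite rmorphN opprK -uE.
- have := quad _ s pi p1 ns np.
  apply: mv; [|exact: uE|exact: vE].
  by rewrite -uE -rmorphD; congr _%:C; rewrite /s /x; ring.
- have := contour_vanish_oppl (contour_vanish_oppr
    (quad _ (- s) (- pi) p2 (etrans (normrN _) ns) (etrans (normrN _) np))).
  apply: mv.
  + by rewrite nE /x /s opprK !rmorphD /=; field.
  + by rewrite rmorphN opprK -uE.
  + by rewrite nE opprK.
- have := contour_vanish_oppr (quad _ s (- pi) p2 ns (etrans (normrN _) np)).
  apply: mv; [|exact: uE|by rewrite nE opprK].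
  by rewrite nE -uE /x /s rmorphN rmorphD /=; field.
Qed.

Lemma normc_avg k G (e : R) : (forall j, nc (G (unity R k ^+ j)) <= e) ->
  nc (avg k G) <= e.
Proof.
move=> Ge; rewrite /avg normcM normcV.
have n0 : 0 < (2 : R) ^+ k by rewrite exprn_gt0.
rewrite -[2](rmorph_nat (real_complex R) 2) -rmorphXn normcR gtr0_norm //.
rewrite mulrC ler_pdivrMr //; apply: le_trans (normc_sum _ _ _) _.
apply: (@le_trans _ _ (\sum_(j < 2 ^ k) e)); first by apply: ler_sum.
by rewrite sumr_const card_ord -[leLHS]mulr_natr natrX.
Qed.

Lemma avgB k G g : avg k (fun w => G w - g w) = avg k G - avg k g.
Proof. by rewrite /avg sumrB mulrBr. Qed.

Lemma avgZ k G (c : C) : avg k (fun w => c * G w) = c * avg k G.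
Proof. by rewrite /avg -mulr_sumr mulrCA. Qed.

Lemma avg_cst k (c : C) : avg k (fun=> c) = c.
Proof.
by rewrite /avg sumr_const card_ord -[X in _ * X]mulr_natr natrX mulrCA mulVf ?mulr1.
Qed.

(** The exceptional point [q] is present because the function to which this is applied
    is a difference quotient at [q], of which only boundedness is known there. *)
Theorem mean_value G (q d M : R) : 0 < q < 1 -> 0 < d ->
  (forall w, nc (w - q%:C) < d -> nc (G w) <= M) ->
  (forall w, nc w <= 1 -> w != q%:C -> cdiff G w) ->
  avg_vanish (fun k => avg k G - G 0).
Proof.
move=> q01 d0 GM Gd e e0; have /andP[q0 q1] := q01.
have q0C : 0 != q%:C by rewrite eq_sym (inj_eq (@complexI R)) gt_eqF.
have e3 : 0 < e / 3 by rewrite divr_gt0.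
have G0 : cdiff G 0 by apply: Gd => //; rewrite normc0.
have [r r0 rP] := cdiff_continuous G0 e3.
pose a := Num.min (r / 2) (q ^+ 2).
have q20 : 0 < q ^+ 2 by rewrite exprn_gt0.
have a0 : 0 < a by rewrite lt_min q20 divr_gt0.
have aq : a <= q ^+ 2 by rewrite ge_min lexx orbT.
have ar : a < r.
  by apply: (@le_lt_trans _ _ (r / 2)); rewrite ?ge_min ?lexx // ltr_pdivrMr // ltr_pMr // ltr1n.
have q2q : q ^+ 2 < q by rewrite expr2 gtr_pMl.
have small k : nc (avg k (fun w => G (a%:C * w)) - G 0) <= e / 3.
  rewrite -{1}(avg_cst k (G 0)) -avgB; apply: normc_avg => j; apply: rP.
  rewrite subr0 normcM normcR gtr0_norm //.
  by rewrite normc_unityX mulr1.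
have inner : avg_vanish (fun k => avg k (fun w => G ((q ^+ 2)%:C * w)) -
    avg k (fun w => G (a%:C * w))).
  have := @annulus_regular _ G (ln a) (ln (q ^+ 2)).
  rewrite !lnK ?posrE //; apply; first by rewrite ler_ln.
  move=> w /andP[wa wq]; apply: Gd; first by lra.
  apply: contraTneq wq => ->; rewrite -ltNge normcR gtr0_norm //.
have outer : avg_vanish (fun k => avg k G - avg k (fun w => G ((q ^+ 2)%:C * w))).
  apply: (annulus_exceptional q01 d0 GM) => w /andP[_ w1]; exact: Gd.
near=> k.
have h1 : nc (avg k G - avg k (fun w => G ((q ^+ 2)%:C * w))) <= e / 3.
  by near: k; exact: outer.
have h2 : nc (avg k (fun w => G ((q ^+ 2)%:C * w)) -
    avg k (fun w => G (a%:C * w))) <= e / 3 by near: k; exact: inner.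
have := le_trans (le_normcD _ _) (lerD (le_trans (le_normcD _ _) (lerD h1 h2)) (small k)).
rewrite !subrKA => /le_trans; apply; lra.
Unshelve. all: by end_near. Qed.

(** For [z] and [w] on the unit circle this is the Poisson kernel of the unit disc at
    the point [q * w] and the boundary point [z], a symmetric function of [z] and [w]
    ([poisson_sym]). *)
Definition poisson (q : R) (z w : C) : R := (1 - q ^+ 2) / nc (z - q%:C * w) ^+ 2.

End Poisson.

(** * The Poisson formula and the geometry of the Poisson kernel *)

Section PoissonIntegral.
Variable R : realType.
Local Notation C := R[i].
Local Notation nc := (@normc R).
Implicit Types (g G phi : C -> C) (z u v w : C) (k : nat).

Lemma cdiffM (f g : C -> C) z : cdiff f z -> cdiff g z -> cdiff (fun w => f w * g w) z.
Proof.
move=> /cdiff_differentiable hz /cdiff_differentiable ghz.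
by apply/cdiff_differentiable; exact: (@differentiableM _ (Cplx R) f g z hz ghz).
Qed.

Lemma cdiffB (f g : C -> C) z : cdiff f z -> cdiff g z -> cdiff (fun w => f w - g w) z.
Proof.
move=> /cdiff_differentiable hz /cdiff_differentiable ghz.
by apply/cdiff_differentiable; exact: (@differentiableB _ (Cplx R) (Cplx R) f g z hz ghz).
Qed.

Lemma cdiffV (f : C -> C) z : f z != 0 -> cdiff f z -> cdiff (fun w => (f w)^-1) z.
Proof.
move=> fz0 /cdiff_differentiable hz.
by apply/cdiff_differentiable; exact: (@differentiableV _ (Cplx R) f z hz fz0).
Qed.

Lemma cdiff_cst (c : C) z : cdiff (fun=> c) z.
Proof.
exists 0 => e e0; exists 1 => // w _.
by rewrite subrr mul0r subr0 normc0 mulr_ge0 ?normc_ge0 // ltW.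
Qed.

Lemma cdiff_id z : cdiff (fun w => w) z.
Proof.
exists 1 => e e0; exists 1 => // w _.
by rewrite mul1r subrr normc0 mulr_ge0 ?normc_ge0 // ltW.
Qed.

Lemma cdiff_bounded g z : cdiff g z ->
  exists2 d : R, 0 < d & forall w, nc (w - z) < d -> nc (g w) <= nc (g z) + 1.
Proof.
move=> /cdiff_continuous /(_ _ ltr01)[d d0 dP]; exists d => // w /dP wd.
rewrite -[g w](subrK (g z)) addrC; apply: le_trans (le_normcD _ _) _.
by rewrite lerD2l.
Qed.

Lemma sqr_normc_conj z : ((nc z) ^+ 2)%:C = z * z^*%C.
Proof. by rewrite -sqr_normc normr_normc rmorphXn. Qed.

Lemma unit_conj w : nc w = 1 -> w * w^*%C = 1.
Proof. by move=> w1; rewrite -sqr_normc_conj w1 expr1n. Qed.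

Section Kernel.
Variable q : R.
Hypothesis q01 : 0 < q < 1.
Let q0 : 0 < q. Proof. by case/andP: q01. Qed.
Let q1 : q < 1. Proof. by case/andP: q01. Qed.

Lemma disc_denominator w : nc w <= 1 -> 1 - q%:C * w != 0.
Proof.
move=> w1; apply/negP => /eqP /subr0_eq /(congr1 nc).
rewrite normc1 normcM.
rewrite normcR gtr0_norm // => E.
have : q * nc w <= q by rewrite ler_piMr // ltW.
by rewrite -E leNgt q1.
Qed.

Lemma conj_denominator w : (1 - q%:C * w)^*%C = 1 - q%:C * w^*%C.
Proof.
by rewrite rmorphB rmorphM rmorph1; congr (1 - _ * _); exact: conjc_real.
Qed.

(** On the unit circle the Poisson kernel is the restriction of a rational function with
    a simple pole at [q]. *)
Lemma poisson_cauchy w : nc w = 1 ->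
  (poisson q 1 w)%:C = w * (1 - q%:C ^+ 2) / ((w - q%:C) * (1 - q%:C * w)).
Proof.
move=> w1; have ww := unit_conj w1.
have d1 : 1 - q%:C * w != 0 by rewrite disc_denominator // w1.
have d2 : 1 - q%:C * w^*%C != 0 by rewrite -conj_denominator conjc_eq0.
have w0 : w != 0 by rewrite -normc_gt0 w1.
rewrite /poisson rmorphM fmorphV /= sqr_normc_conj conj_denominator.
rewrite rmorphB rmorph1 rmorphXn /=.
have -> : w - q%:C = w * (1 - q%:C * w^*%C).
  by rewrite mulrBr mulr1 mulrCA ww mulr1.
by field; rewrite d1 d2 w0.
Qed.

Lemma poisson_Re w : nc w = 1 ->
  (poisson q 1 w)%:C = (1 - q%:C * w)^-1 - 1 + ((1 - q%:C * w)^-1)^*%C.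
Proof.
move=> w1; have ww := unit_conj w1.
have d1 : 1 - q%:C * w != 0 by rewrite disc_denominator // w1.
have d2 : 1 - q%:C * w^*%C != 0 by rewrite -conj_denominator conjc_eq0.
rewrite /poisson rmorphM fmorphV /= sqr_normc_conj conj_denominator.
rewrite rmorphB rmorph1 rmorphXn /= conjc_inv conj_denominator.
have -> : 1 - q%:C ^+ 2 = 1 - q%:C ^+ 2 * (w * w^*%C) by rewrite ww mulr1.
by field; rewrite d1 d2.
Qed.

Lemma poisson_ge0 z w : 0 <= poisson q z w.
Proof.
rewrite divr_ge0 // ?sqr_ge0 // subr_ge0.
by rewrite expr_le1 // ltW.
Qed.

Lemma eq_avg k G g : (forall w, nc w = 1 -> G w = g w) -> avg k G = avg k g.
Proof.
by move=> Gg; congr (_ * _); apply: eq_bigr => j _; rewrite Gg ?normc_unityX.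
Qed.

Lemma avgD k G g : avg k (fun w => G w + g w) = avg k G + avg k g.
Proof. by rewrite /avg big_split mulrDr. Qed.

Lemma avg_conj k G : avg k (fun w => (G w)^*%C) = (avg k G)^*%C.
Proof.
rewrite /avg rmorphM raddf_sum; congr (_ * _).
rewrite -[2](rmorph_nat (real_complex R) 2) -rmorphXn -fmorphV.
exact/esym/conjc_real.
Qed.

Lemma cdiff_kernel w : nc w <= 1 -> cdiff (fun w => (1 - q%:C * w)^-1) w.
Proof.
move=> w1; apply: cdiffV; first exact: disc_denominator.
by apply: cdiffB; [exact: cdiff_cst|apply: cdiffM; [exact: cdiff_cst|exact: cdiff_id]].
Qed.

Lemma normc_q : nc q%:C <= 1.
Proof. by rewrite normcR gtr0_norm // ltW. Qed.

(** The Poisson kernel is twice the real part of [1 / (1 - q w)], minus 1, and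
    [1 / (1 - q w)] has mean value 1. *)
Lemma poisson_mass : avg_vanish (fun k => avg k (fun w => (poisson q 1 w)%:C) - 1).
Proof.
pose h w := (1 - q%:C * w)^-1.
have [d d0 dM] := cdiff_bounded (cdiff_kernel normc_q).
have mv : avg_vanish (fun k => avg k h - h 0).
  by apply: (mean_value q01 d0 dM) => w w1 _; exact: cdiff_kernel.
move=> e e0; have e2 : 0 < e / 2 by rewrite divr_gt0.
apply: filterS (mv _ e2) => k; rewrite /h mulr0 subr0 invr1 => hk.
rewrite (eq_avg k poisson_Re) avgD avgB avg_cst avg_conj.
set A := avg k _ in hk *.
have -> : A - 1 + A^*%C - 1 = (A - 1) + (A - 1)^*%C.
  by rewrite rmorphB rmorph1 addrA.
apply: le_trans (le_normcD _ _) _.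
have -> : nc (A - 1)^*%C = nc (A - 1).
  by apply: complexI; rewrite -!normr_normc normcJ.
by rewrite [e]splitr lerD.
Qed.

(** The mean value property is applied to [phi w - phi q] times the rational function
    of [poisson_cauchy]: the pole at [q] is cancelled up to a bounded function, and the
    value at 0 is 0. The averages of the kernel tend to 1 by [poisson_mass]. *)
Theorem poisson_formula phi : (forall w, nc w <= 1 -> cdiff phi w) ->
  avg_vanish (fun k => avg k (fun w => (poisson q 1 w)%:C * phi w) - phi q%:C).
Proof.
move=> phid.
pose G w := (phi w - phi q%:C) * (w - q%:C)^-1 * (w * (1 - q%:C ^+ 2) * (1 - q%:C * w)^-1).
have kd w : nc w <= 1 -> cdiff (fun w => w * (1 - q%:C ^+ 2) * (1 - q%:C * w)^-1) w.
  move=> w1; apply: cdiffM; last exact: cdiff_kernel.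
  by apply: cdiffM; [exact: cdiff_id|exact: cdiff_cst].
have [d1 d10 d1M] := cdiff_bounded (kd _ normc_q).
have [b /(_ _ ltr01)[d2 d20 d2M]] := phid _ normc_q.
have [d d0 [M GM]] : exists2 d : R, 0 < d & exists M : R,
    forall w, nc (w - q%:C) < d -> nc (G w) <= M.
  exists (Num.min d1 d2); first by rewrite lt_min d10.
  eexists => w; rewrite lt_min => /andP[w1 w2].
  rewrite /G normcM; apply: ler_pM (d1M _ w1); rewrite ?normc_ge0 //.
  instantiate (1 := nc b + 1).
  have [->|wq] := eqVneq w q%:C.
    by rewrite subrr mul0r normc0 addr_ge0 ?normc_ge0.
  have wq0 : 0 < nc (w - q%:C) by rewrite normc_gt0 subr_eq0.
  rewrite normcM normcV ler_pdivrMr //.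
  rewrite -[X in nc X](subrK (b * (w - q%:C))); apply: le_trans (le_normcD _ _) _.
  have := d2M _ w2; rewrite normcM; lra.
have mv : avg_vanish (fun k => avg k G - G 0).
  apply: (mean_value q01 d0 GM) => w w1 wq; apply: cdiffM; last exact: kd.
  apply: cdiffM; first by apply: cdiffB; [exact: phid|exact: cdiff_cst].
  apply: cdiffV; first by rewrite subr_eq0.
  by apply: cdiffB; [exact: cdiff_id|exact: cdiff_cst].
have G0 : G 0 = 0 by rewrite /G !mul0r mulr0.
move=> e e0; have e2 : 0 < e / 2 by rewrite divr_gt0.
have K0 : 0 < nc (phi q%:C) + 1 by rewrite ltr_wpDl ?normc_ge0.
near=> k.
have h1 : nc (avg k G) <= e / 2.
  by rewrite -[avg k G]subr0 -G0; near: k; exact: mv.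
have h2 : nc (avg k (fun w => (poisson q 1 w)%:C) - 1) <= e / 2 / (nc (phi q%:C) + 1).
  by near: k; apply: poisson_mass; rewrite divr_gt0.
have -> : avg k (fun w => (poisson q 1 w)%:C * phi w) - phi q%:C =
    avg k G + phi q%:C * (avg k (fun w => (poisson q 1 w)%:C) - 1).
  rewrite (_ : avg k G = avg k (fun w => (poisson q 1 w)%:C * phi w -
      phi q%:C * (poisson q 1 w)%:C)).
    by rewrite avgB avgZ; ring.
  apply: eq_avg => w w1; rewrite poisson_cauchy // /G invfM.
  by ring.
apply: le_trans (le_normcD _ _) _.
rewrite [e]splitr lerD // normcM mulrC.
move: h2; rewrite ler_pdivlMr // mulrDr mulr1 => h2.
have := normc_ge0 (avg k (fun w => (poisson q 1 w)%:C) - 1); lra.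
Unshelve. all: by end_near. Qed.

End Kernel.

(** The denominator of the kernel depends on the two points through their distance
    only, and increases with it. *)
Lemma sqr_normc_poisson q z w : nc z = 1 -> nc w = 1 ->
  nc (z - q%:C * w) ^+ 2 = (1 - q) ^+ 2 + q * nc (z - w) ^+ 2.
Proof.
case: z => a b; case: w => c d z1 w1.
have E1 : a ^+ 2 + b ^+ 2 = 1 by rewrite -(sqr_normcE (a +i* b)) z1 expr1n.
have E2 : c ^+ 2 + d ^+ 2 = 1 by rewrite -(sqr_normcE (c +i* d)) w1 expr1n.
rewrite !sqr_normcE /= mul0r subr0 mul0r addr0.
have -> : (a - q * c) ^+ 2 + (b - q * d) ^+ 2 =
  (a ^+ 2 + b ^+ 2) + q ^+ 2 * (c ^+ 2 + d ^+ 2) - 2 * q * (a * c + b * d) by ring.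
have -> : (a - c) ^+ 2 + (b - d) ^+ 2 =
  (a ^+ 2 + b ^+ 2) + (c ^+ 2 + d ^+ 2) - 2 * (a * c + b * d) by ring.
by rewrite E1 E2; ring.
Qed.

Lemma poisson_sym q z w : nc z = 1 -> nc w = 1 -> poisson q z w = poisson q w z.
Proof.
by move=> z1 w1; rewrite /poisson !sqr_normc_poisson // normc_subC.
Qed.

(** If [w] is at least half as far from [z] as [x] is, then the kernel at [w] is at most
    four times the kernel at [x]. *)
Lemma poisson_far z w x : nc z = 1 -> nc w = 1 -> nc x = 1 ->
  nc (z - x) <= 2 * nc (z - w) ->
  forall q : R, 0 < q < 1 -> poisson q z w <= 4 * poisson q z x.
Proof.
move=> z1 w1 x1 far q /andP[q0 q1].
have pos y : nc y = 1 -> 0 < nc (z - q%:C * y) ^+ 2.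
  move=> y1; rewrite sqr_normc_poisson //; apply: ltr_wpDr.
    by rewrite mulr_ge0 ?sqr_ge0 // ltW.
  by rewrite exprn_gt0 // subr_gt0.
rewrite /poisson mulrCA ler_wpM2l ?subr_ge0 ?expr_le1 ?(ltW q0) ?(ltW q1) //.
rewrite -[X in X <= _]mul1r ler_pdivrMr ?pos // mulrAC ler_pdivlMr ?pos // mul1r.
rewrite !sqr_normc_poisson // [4 * _]mulrDr [4 * (q * _)]mulrCA.
apply: lerD; first by rewrite ler_peMl ?sqr_ge0 // ler1n.
rewrite ler_wpM2l ?(ltW q0) //.
have -> : 4 * nc (z - w) ^+ 2 = (2 * nc (z - w)) ^+ 2 by ring.
by rewrite ler_pXn2r // nnegrE ?normc_ge0 // mulr_ge0 ?normc_ge0.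
Qed.

(** One of two sides of a triangle is at least half of the third. The alternative does
    not depend on [q], as [finite_maximal] requires. *)
Lemma poisson_quasi_triangle z w x : nc z = 1 -> nc w = 1 -> nc x = 1 ->
  (forall q : R, 0 < q < 1 -> poisson q z w <= 4 * poisson q z x) \/
  (forall q : R, 0 < q < 1 -> poisson q x w <= 4 * poisson q z x).
Proof.
move=> z1 w1 x1.
have [far|near] := leP (nc (z - x)) (2 * nc (z - w)).
  by left; exact: poisson_far.
right => q q01; rewrite (poisson_sym _ z1) //; apply: poisson_far => //.
rewrite (normc_subC x z); have : nc (z - x) <= nc (z - w) + nc (x - w).
  have -> : z - x = (z - w) - (x - w) by ring.
  exact: normcB.
lra.
Qed.

End PoissonIntegral.

(** * A maximal inequality on a finite set *)

Section FiniteMaximal.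
Variables (R : realFieldType) (X : finType) (I : Type).
Variables (kap : I -> X -> X -> R) (A M : R).
Hypotheses (A0 : 0 < A) (M0 : 0 < M).
Hypothesis kap_ge0 : forall i x y, 0 <= kap i x y.
Hypothesis kap_sym : forall i x y, kap i x y = kap i y x.
Hypothesis kap_quasi : forall x y z,
  (forall i, kap i x y <= A * kap i x z) \/ (forall i, kap i z y <= A * kap i x z).
Hypothesis kap_mass : forall i x, \sum_y kap i x y <= M.

(** For each [y], one of the two factors is controlled by the same kernel at the pair
    [x, x']; the sum over [y] of the other factor is at most [M]. *)
Lemma kap_compose i i' x x' :
  \sum_y kap i x y * kap i' x' y <= A * M * (kap i x x' + kap i' x x').
Proof.
apply: (@le_trans _ _ (\sum_y (A * kap i x x' * kap i' x' y + A * kap i' x x' * kap i x y))).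
  apply: ler_sum => y _; have [H|H] := kap_quasi x y x'.
    apply: ler_wpDr; first by rewrite !mulr_ge0 // ltW.
    by rewrite ler_wpM2r.
  apply: ler_wpDl; first by rewrite !mulr_ge0 // ltW.
  by rewrite mulrC ler_wpM2r.
rewrite big_split /= -!mulr_sumr mulrDr; apply: lerD.
  by rewrite mulrAC ler_wpM2r // ler_wpM2l // ltW.
by rewrite mulrAC ler_wpM2r // ler_wpM2l // ltW.
Qed.

(** The T T* argument. Let T h be the linearized maximal function, whose value at [x]
    uses the kernel of index [sel x]. By [kap_compose], the kernel of T T* is at most
    [A M] times the sum of the kernels of T and of T*, hence for nonnegative [g]
    the square of the norm of [T* g] is at most [2 A M] times the pairing of [g] and
    [T* g]. This bounds the norm of T*, hence that of T, by [2 A M]. *)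
Theorem finite_maximal (sel : X -> I) (h : X -> R) : (forall x, 0 <= h x) ->
  \sum_x (\sum_y kap (sel x) x y * h y) ^+ 2 <= (2 * A * M) ^+ 2 * \sum_x h x ^+ 2.
Proof.
move=> h0; set B := 2 * A * M; have B0 : 0 < B by rewrite !mulr_gt0.
pose g x := \sum_y kap (sel x) x y * h y.
pose u y := \sum_x kap (sel x) x y * g x.
have g0 x : 0 <= g x by apply: sumr_ge0 => y _; rewrite mulr_ge0.
have Nhu : \sum_x g x ^+ 2 = \sum_y h y * u y.
  under eq_bigr do rewrite expr2 {2}/g mulr_sumr.
  rewrite exchange_big /=; apply: eq_bigr => y _; rewrite mulr_sumr.
  by apply: eq_bigr => x _; ring.
pose V := \sum_y g y * u y.
have UV : \sum_y u y ^+ 2 <= B * V.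
  have -> : \sum_y u y ^+ 2 =
      \sum_x \sum_x' (\sum_y kap (sel x) x y * kap (sel x') x' y) * (g x * g x').
    under eq_bigr => y _ do rewrite expr2 {1}/u mulr_suml.
    rewrite exchange_big /=; apply: eq_bigr => x _.
    under eq_bigr => y _ do rewrite /u mulr_sumr.
    rewrite exchange_big /=; apply: eq_bigr => x' _; rewrite mulr_suml.
    by apply: eq_bigr => y _; ring.
  have V1 : \sum_x \sum_x' kap (sel x) x x' * (g x * g x') = V.
    rewrite exchange_big /=; apply: eq_bigr => x' _; rewrite mulr_sumr.
    by apply: eq_bigr => x _; ring.
  have V2 : \sum_x \sum_x' kap (sel x') x x' * (g x * g x') = V.
    apply: eq_bigr => x _; rewrite mulr_sumr.
    by apply: eq_bigr => x' _; rewrite kap_sym; ring.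
  have -> : B * V = \sum_x \sum_x'
      (A * M * (kap (sel x) x x' + kap (sel x') x x')) * (g x * g x').
    rewrite (_ : B * V = A * M * V + A * M * V); last by rewrite /B; ring.
    rewrite -{1}V1 -V2 !mulr_sumr -big_split; apply: eq_bigr => x _.
    rewrite !mulr_sumr -big_split; apply: eq_bigr => x' _ /=; ring.
  apply: ler_sum => x _; apply: ler_sum => x' _.
  by rewrite ler_wpM2r ?mulr_ge0 ?kap_compose.
(* The inequality 2 a b <= a^2 + b^2 stands in for the Cauchy-Schwarz inequality and
   avoids dividing by norms. *)
have amgm (a b : R) : a * b <= (a ^+ 2 + b ^+ 2) / 2.
  by have := sqr_ge0 (a - b); rewrite sqrrB; lra.
have U1 : \sum_y u y ^+ 2 <= B ^+ 2 * \sum_x g x ^+ 2.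
  suff : B * V <= (B ^+ 2 * \sum_x g x ^+ 2 + \sum_y u y ^+ 2) / 2 by lra.
  rewrite mulr_sumr -big_split /= mulr_suml mulr_sumr; apply: ler_sum => y _.
  by rewrite mulrA -exprMn; exact: amgm.
have : B ^+ 2 * \sum_x g x ^+ 2 <=
    (B ^+ 2 * (B ^+ 2 * \sum_x h x ^+ 2) + \sum_y u y ^+ 2) / 2.
  rewrite Nhu mulrA !mulr_sumr -big_split /= mulr_suml; apply: ler_sum => y _.
  by rewrite mulrA -[B ^+ 2 * B ^+ 2]expr2 -exprMn; exact: amgm.
move=> H; rewrite -/g -(@ler_pM2l _ (B ^+ 2)) ?exprn_gt0 //.
by lra.
Qed.

End FiniteMaximal.

(** * The maximal inequality for Poisson averages on the circle *)

Section CircleMaximal.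
Variable R : realType.
Local Notation C := R[i].
Local Notation nc := (@normc R).
Implicit Types (z u v w : C) (k : nat).

Definition ravg k (f : C -> R) : R := (2 ^+ k)^-1 * \sum_(j < 2 ^ k) f (unity R k ^+ j).

Lemma avg_real k (f : C -> R) : avg k (fun w => (f w)%:C) = (ravg k f)%:C.
Proof.
rewrite /avg /ravg rmorphM fmorphV rmorphXn raddf_sum.
by rewrite (rmorph_nat (real_complex R) 2).
Qed.

Lemma unity_sum_shift (V : nmodType) k l (f : C -> V) :
  \sum_(j < 2 ^ k) f (unity R k ^+ j * unity R k ^+ l) =
  \sum_(j < 2 ^ k) f (unity R k ^+ j).
Proof.
elim: l => [|l IH]; first by apply: eq_bigr => j _; rewrite expr0 mulr1.
rewrite -{}IH.
have [N NE] : exists N, (2 ^ k = N.+1)%N.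
  by exists (2 ^ k).-1; rewrite prednK // expn_gt0.
have := unity_expn R k; rewrite NE => w1.
rewrite big_ord_recr [RHS]big_ord_recl /= addrC; congr (_ + _).
  by rewrite exprS mulrA -exprSr w1 ?expr0 !mul1r.
by apply: eq_bigr => j _; rewrite /bump /= add1n (exprS _ l) (exprSr _ j) mulrA.
Qed.

Lemma poisson_rot q u z w : nc u = 1 -> poisson q (z * u) (w * u) = poisson q z w.
Proof.
move=> u1; rewrite /poisson; congr (_ / _ ^+ 2).
by rewrite mulrA -mulrBl normcM u1 mulr1.
Qed.

Definition pavg k q z (h : C -> R) := ravg k (fun w => poisson q z w * h w).

Lemma pavg_rot k l q (h : C -> R) :
  pavg k q (unity R k ^+ l) h = pavg k q 1 (fun w => h (w * unity R k ^+ l)).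
Proof.
congr (_ * _).
rewrite -(unity_sum_shift k l (fun w => poisson q (unity R k ^+ l) w * h w)).
apply: eq_bigr => j _.
by rewrite -[X in poisson q X _]mul1r poisson_rot // normc_unityX.
Qed.

Lemma pavg_ge0 k q z (h : C -> R) : 0 < q < 1 -> (forall w, 0 <= h w) ->
  0 <= pavg k q z h.
Proof.
move=> q01 h0; rewrite mulr_ge0 ?invr_ge0 ?exprn_ge0 //.
by apply: sumr_ge0 => j _; rewrite mulr_ge0 // poisson_ge0.
Qed.

(** [finite_maximal] on the group of roots of unity, with A = 4 from the quasi-triangle
    inequality and M = 2: the constant 256 is the square of [2 * 4 * 2]. *)
Lemma maximal_circle k m (qs : 'I_m.+1 -> R) (h : C -> R) :
  (forall i, 0 < qs i < 1) -> (forall i, ravg k (poisson (qs i) 1) <= 2) ->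
  (forall w, 0 <= h w) ->
  \sum_(x < 2 ^ k) (\big[Num.max/0]_i pavg k (qs i) (unity R k ^+ x) h) ^+ 2 <=
  256 * \sum_(x < 2 ^ k) h (unity R k ^+ x) ^+ 2.
Proof.
move=> q01 mass h0.
have sel x : exists i, \big[Num.max/0]_i pavg k (qs i) (unity R k ^+ x) h =
    pavg k (qs i) (unity R k ^+ x) h.
  have [|i _ ->] := @eq_bigmax _ _ _ 0 ord0 predT
    (fun i => pavg k (qs i) (unity R k ^+ x) h) isT; last by exists i.
  by move=> i _; exact: pavg_ge0.
have [s sP] := choice sel.
pose kap i (x y : 'I_(2 ^ k)) :=
  (2 ^+ k)^-1 * poisson (qs i) (unity R k ^+ x) (unity R k ^+ y).
have p0 : 0 < (2 ^+ k)^-1 :> R by rewrite invr_gt0 exprn_gt0.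
have ux j := normc_unityX R k j.
have := @finite_maximal R _ _ kap 4 2 _ _ _ _ _ _ (fun x : 'I_(2 ^ k) => s x)
  (fun x : 'I_(2 ^ k) => h (unity R k ^+ x)).
rewrite (_ : (2 * 4 * 2) ^+ 2 = 256 :> R); last by ring.
move=> H; apply: le_trans (H _ _ _ _ _ _ _) => //.
- rewrite le_eqVlt; apply/orP; left; apply/eqP; apply: eq_bigr => x _.
  rewrite sP /pavg /ravg mulr_sumr; congr (_ ^+ 2).
  by apply: eq_bigr => y _; rewrite /kap mulrA.
- by move=> i x y; rewrite mulr_ge0 ?(ltW p0) // poisson_ge0.
- by move=> i x y; rewrite /kap poisson_sym.
- move=> x y z; rewrite /kap.
  have [K|K] := poisson_quasi_triangle (ux x) (ux y) (ux z); [left|right] => i;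
    by rewrite [4 * _]mulrCA ler_pM2l // K.
- move=> i x; apply: le_trans (mass i).
  rewrite -mulr_sumr ler_pM2l // -(unity_sum_shift k x (poisson (qs i) (unity R k ^+ x)))
    le_eqVlt; apply/orP; left.
  apply/eqP; apply: eq_bigr => j _.
  by rewrite -[X in poisson _ X _]mul1r poisson_rot.
Qed.

(** The modulus of a holomorphic function is subharmonic. *)
Lemma poisson_subharmonic (phi : C -> C) q : 0 < q < 1 ->
  (forall w, nc w <= 1 -> cdiff phi w) ->
  forall e, 0 < e -> \forall k \near \oo,
    nc (phi q%:C) - e <= pavg k q 1 (fun w => nc (phi w)).
Proof.
move=> q01 phid e e0; apply: filterS (poisson_formula q01 phid e0) => k.
set A := avg k _ => Ae.
have : nc A <= pavg k q 1 (fun w => nc (phi w)).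
  rewrite /A /avg normcM normcV.
  rewrite -[2](rmorph_nat (real_complex R) 2) -rmorphXn normcR gtr0_norm ?exprn_gt0 //.
  rewrite /pavg /ravg ler_pM2l ?invr_gt0 ?exprn_gt0 //.
  apply: le_trans (normc_sum _ _ _) _; apply: ler_sum => j _.
  by rewrite normcM normcR ger0_norm // poisson_ge0.
have : nc (phi q%:C) <= nc A + nc (A - phi q%:C).
  rewrite -{1}[phi q%:C](subKr A); exact: normcB.
lra.
Qed.

Lemma poisson_mass_real q e : 0 < q < 1 -> 0 < e ->
  \forall k \near \oo, ravg k (poisson q 1) <= 1 + e.
Proof.
move=> q01 e0; apply: filterS (poisson_mass q01 e0) => k.
rewrite avg_real -(rmorph1 (real_complex R)) -rmorphB normcR ler_norml => /andP[_]; lra.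
Qed.

End CircleMaximal.

(** * Mean squares of holomorphic families on a rotated measure space *)

Section FatouTools.
Context d (T : measurableType d) (R : realType) (mu : {measure set T -> \bar R}).
Local Open Scope ereal_scope.

Lemma limn_einf_ge (u : nat -> \bar R) (a : \bar R) :
  (forall e : R, (0 < e)%R -> \forall k \near \oo, a - e%:E <= u k) -> a <= limn_einf u.
Proof.
move=> H; apply/lee_subgt0Pr => e e0.
have [N _ NP] := H e e0.
rewrite limn_einf_lim (cvg_lim _ (@cvg_einfs_sup _ u)) //.
apply: le_trans (ereal_sup_ubound _); last by exists N.
by apply/ereal_infP => _ [k /= Nk <-]; exact: NP.
Qed.

Lemma limn_einf_le (u : nat -> \bar R) (b : \bar R) :
  (\forall k \near \oo, u k <= b) -> limn_einf u <= b.
Proof.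
move=> [N _ NP]; rewrite limn_einf_lim (cvg_lim _ (@cvg_einfs_sup _ u)) //.
apply/ereal_supP => _ [n _ <-].
apply: le_trans (NP (maxn n N) (leq_maxr _ _)).
by apply: ereal_inf_lbound; exists (maxn n N) => //=; exact: leq_maxl.
Qed.

Lemma measurable_limn_einf (f : nat -> T -> \bar R) :
  (forall k, measurable_fun setT (f k)) ->
  measurable_fun setT (fun t => limn_einf (fun k => f k t)).
Proof.
move=> mf.
have -> : (fun t => limn_einf (fun k => f k t)) =
    (fun t => - limn_esup (fun k => - f k t)).
  apply: funext => t; rewrite -limn_einfN; congr limn_einf.
  by apply: funext => k; rewrite /= oppeK.
apply: measurableT_comp => //.
apply: (measurable_fun_limn_esup (f := fun k t => - f k t)) => k.
exact: measurableT_comp.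
Qed.

(** Fatou's lemma in the form used here: [Y] is dominated in the limit by functions
    whose integrals are at most [b]. *)
Lemma fatou_eventually (Y : T -> R) (G : nat -> T -> R) (b : \bar R) :
  measurable_fun setT Y -> (forall k, measurable_fun setT (G k)) ->
  (forall t, 0 <= Y t)%R -> (forall k t, 0 <= G k t)%R ->
  (forall t e, 0 < e -> \forall k \near \oo, Y t - e <= G k t)%R ->
  (\forall k \near \oo, \int[mu]_t (G k t)%:E <= b) ->
  \int[mu]_t (Y t)%:E <= b.
Proof.
move=> mY mG Y0 G0 YG Gb.
have mGE k : measurable_fun setT (fun t => (G k t)%:E) by exact/measurable_EFinP.
apply: (@le_trans _ _ (\int[mu]_t limn_einf (fun k => (G k t)%:E))).
  apply: ge0_le_integral => //.
  - by move=> t _; rewrite lee_fin.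
  - exact/measurable_EFinP.
  - exact: (measurable_limn_einf (f := fun k t => (G k t)%:E)).
  - move=> t _; apply: limn_einf_ge => e e0.
    by apply: filterS (YG t e e0) => k; rewrite -EFinB lee_fin.
apply: le_trans (fatou _ _ _ _) _ => //.
  by move=> n t _; rewrite lee_fin.
exact: limn_einf_le.
Qed.

Lemma integral_preserved (phi : T -> T) (f : T -> \bar R) :
  measurable_fun setT phi ->
  (forall A, measurable A -> mu (phi @^-1` A) = mu A) ->
  measurable_fun setT f -> (forall t, 0 <= f t) ->
  \int[mu]_t f (phi t) = \int[mu]_t f t.
Proof.
move=> mphi inv mf f0.
rewrite -[LHS](@ge0_integral_pushforward _ _ _ _ _ _ mphi mu setT f) //.
by apply: eq_measure_integral => A mA _; exact: inv.
Qed.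

End FatouTools.

Section HardyFamilies.
Context d (T : measurableType d) (R : realType) (mu : {measure set T -> \bar R}).
Local Notation C := R[i].
Local Notation nc := (@normc R).
Implicit Types (u w z : C) (t : T) (r : R).

(** Measurability of complex functions is handled through real and imaginary parts, to
    which the results on real functions apply; [cmeasurable_borelC] relates it to the
    Borel sets of the plane. *)
Definition cmeasurable (f : T -> C) :=
  measurable_fun setT (fun t => complex.Re (f t)) /\
  measurable_fun setT (fun t => complex.Im (f t)).

Lemma measurable_sqr_normc (f : T -> C) : cmeasurable f ->
  measurable_fun setT (fun t => nc (f t) ^+ 2).
Proof.
move=> [mRe mIm]; under eq_fun do rewrite sqr_normcE.
by apply: measurable_funD; exact: measurable_funX.
Qed.

Lemma measurable_normc (f : T -> C) : cmeasurable f ->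
  measurable_fun setT (fun t => nc (f t)).
Proof.
move=> /measurable_sqr_normc mf.
have -> : (fun t => nc (f t)) = Num.sqrt \o (fun t => nc (f t) ^+ 2).
  by apply: funext => t /=; rewrite sqrtr_sqr ger0_norm ?normc_ge0.
apply: measurableT_comp mf.
by apply: continuous_measurable_fun; exact: sqrt_continuous.
Qed.

Record rotation_action (rot : C -> T -> T) : Prop := RotationAction {
  ra_measurable : forall u, nc u = 1 -> measurable_fun setT (rot u);
  ra_preserving : forall u, nc u = 1 -> forall A, measurable A ->
    mu (rot u @^-1` A) = mu A }.

(** The slices of a holomorphic function on a circular domain: [Phi w t] stands for
    F (w t). Only the rotation action on the parameters [t] matters for the Hardy space
    arguments, so the domain itself is left out. *)
Record hardy_family (rot : C -> T -> T) (Phi : C -> T -> C) : Prop := HardyFamily {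
  hf_cdiff : forall t w, nc w < 1 -> cdiff (fun z => Phi z t) w;
  hf_measurable : forall w, nc w < 1 -> cmeasurable (Phi w);
  hf_rotation : forall w u t, nc u = 1 -> Phi (w * u) t = Phi w (rot u t) }.

Definition mean_square (Phi : C -> T -> C) (r : R) : \bar R :=
  (\int[mu]_t (nc (Phi r%:C t) ^+ 2)%:E)%E.

Variables (rot : C -> T -> T) (ra : rotation_action rot).
Variables (Phi : C -> T -> C) (hf : hardy_family rot Phi).

Lemma hf_measurable_circle r w : 0 <= r < 1 -> nc w = 1 -> cmeasurable (Phi (r%:C * w)).
Proof.
move=> /andP[r0 r1] w1; apply: (hf_measurable hf).
by rewrite normcM normc_ge0R // w1 mulr1.
Qed.

Lemma hf_measurable_real r : 0 <= r < 1 -> cmeasurable (Phi r%:C).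
Proof. by move=> /andP[r0 r1]; apply: (hf_measurable hf); rewrite normc_ge0R. Qed.

Lemma mean_square_rot r u : 0 <= r < 1 -> nc u = 1 ->
  (\int[mu]_t (nc (Phi (r%:C * u) t) ^+ 2)%:E)%E = mean_square Phi r.
Proof.
move=> r01 u1; rewrite /mean_square.
under eq_integral do rewrite (hf_rotation hf) //.
apply: (integral_preserved (f := fun t => (nc (Phi r%:C t) ^+ 2)%:E)).
- exact: (ra_measurable ra).
- exact: (ra_preserving ra).
- by apply/measurable_EFinP/measurable_sqr_normc; exact: hf_measurable_real.
- by move=> t; rewrite lee_fin sqr_ge0.
Qed.

Lemma hf_cdiff_disc r t : 0 < r < 1 -> forall w, nc w <= 1 ->
  cdiff (fun w => Phi (r%:C * w) t) w.
Proof.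
move=> /andP[r0 r1] w w1; apply: (@cdiff_comp _ (fun z => Phi z t) (fun w => r%:C * w)).
  by apply: cdiffM; [exact: cdiff_cst|exact: cdiff_id].
apply: (hf_cdiff hf); rewrite normcM normc_ge0R ?(ltW r0) //.
by apply: le_lt_trans r1; rewrite ler_piMr // ltW.
Qed.

Lemma measurable_ravg k (h : C -> T -> R) :
  (forall w, nc w = 1 -> measurable_fun setT (h w)) ->
  measurable_fun setT (fun t => ravg k (fun w => h w t)).
Proof.
move=> mh; apply: measurable_funM => //.
by apply: measurable_sum => j; apply: mh; exact: normc_unityX.
Qed.

Lemma measurable_pavg k q z (h : C -> T -> R) :
  (forall w, nc w = 1 -> measurable_fun setT (h w)) ->
  measurable_fun setT (fun t => pavg k q z (fun w => h w t)).
Proof.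
move=> mh; apply: (measurable_ravg k (h := fun w t => poisson q z w * h w t)) => w w1.
by apply: measurable_funM => //; exact: mh.
Qed.

Lemma mean_square_ge0 r : (0 <= mean_square Phi r)%E.
Proof. by apply: integral_ge0 => t _; rewrite lee_fin sqr_ge0. Qed.

(** Integral means increase with the radius: [Phi ^+ 2] is holomorphic in the first
    variable, so the square of its modulus at radius [r] is at most the limit of the
    Poisson averages at radius [s], and each of these averages has the mean
    [mean_square Phi s] up to a factor that tends to 1, as rotations preserve [mu]. *)
Theorem mean_square_le r s : 0 < r -> r < s -> s < 1 ->
  (mean_square Phi r <= mean_square Phi s)%E.
Proof.
move=> r0 rs s1; have s0 := lt_trans r0 rs.
have s01 : 0 < s < 1 by rewrite s0.
have s01' : 0 <= s < 1 by rewrite ltW.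
pose q := r / s; have q01 : 0 < q < 1 by rewrite divr_gt0 //= ltr_pdivrMr // mul1r.
have [->|fin] := eqVneq (mean_square Phi s) +oo%E; first exact: leey.
have msfin : mean_square Phi s \is a fin_num.
  by rewrite ge0_fin_numE ?mean_square_ge0 // ltey.
apply/lee_addgt0Pr => e e0.
have F0 : 0 <= fine (mean_square Phi s) by rewrite fine_ge0 // mean_square_ge0.
pose e' := e / (fine (mean_square Phi s) + 1).
have e'0 : 0 < e' by rewrite divr_gt0 // ltr_wpDl.
apply: (@fatou_eventually _ _ _ _ _ (fun k t => pavg k q 1 (fun w => nc (Phi (s%:C * w) t) ^+ 2))).
- apply: measurable_sqr_normc; apply: hf_measurable_real; rewrite ltW //=; lra.
- move=> k; apply: (measurable_pavg k q 1 (h := fun w t => nc (Phi (s%:C * w) t) ^+ 2)) => w w1.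
  by apply: measurable_sqr_normc; exact: hf_measurable_circle.
- by move=> t; exact: sqr_ge0.
- by move=> k t; apply: pavg_ge0 => // w; exact: sqr_ge0.
- move=> t e1 e10.
  have D w : nc w <= 1 -> cdiff (fun w => Phi (s%:C * w) t * Phi (s%:C * w) t) w.
    by move=> w1; apply: cdiffM; exact: hf_cdiff_disc.
  have := poisson_subharmonic q01 D e10; apply: filterS => k.
  have -> : s%:C * q%:C = r%:C by rewrite -rmorphM /= /q mulrC divfK // gt_eqF.
  rewrite normcM -expr2 => /le_trans; apply.
  rewrite le_eqVlt; apply/orP; left; apply/eqP; congr pavg.
  by apply: funext => w; rewrite normcM expr2.
- apply: filterS (poisson_mass_real q01 e'0) => k massk.
  have -> : (\int[mu]_t (pavg k q 1 (fun w => nc (Phi (s%:C * w) t) ^+ 2))%:E)%E =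
      ((ravg k (poisson q 1))%:E * mean_square Phi s)%E.
    rewrite /pavg /ravg.
    under eq_integral do rewrite EFinM -sumEFin.
    have p0 : 0 <= (2 ^+ k)^-1 :> R by rewrite invr_ge0 exprn_ge0.
    have mterm (j : 'I_(2 ^ k)) : measurable_fun setT
        (fun t => (poisson q 1 (unity R k ^+ j) * nc (Phi (s%:C * unity R k ^+ j) t) ^+ 2)%:E).
      apply/measurable_EFinP; apply: measurable_funM => //.
      by apply: measurable_sqr_normc; apply: hf_measurable_circle => //; exact: normc_unityX.
    have pterm (j : 'I_(2 ^ k)) t : (0 <= (poisson q 1 (unity R k ^+ j) *
        nc (Phi (s%:C * unity R k ^+ j) t) ^+ 2)%:E)%E.
      by rewrite lee_fin mulr_ge0 ?sqr_ge0 ?poisson_ge0.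
    rewrite ge0_integralZl_EFin //; first last.
    - by apply: emeasurable_sum.
    - by move=> t _; apply: sume_ge0.
    rewrite ge0_integral_sum // EFinM -muleA; congr (_ * _)%E.
    rewrite -sumEFin ge0_sume_distrl; last by move=> j _; rewrite lee_fin poisson_ge0.
    apply: eq_bigr => j _.
    under eq_integral do rewrite EFinM.
    rewrite ge0_integralZl_EFin ?poisson_ge0 //.
    + by rewrite mean_square_rot // normc_unityX.
    + by move=> t _; rewrite lee_fin sqr_ge0.
    + apply/measurable_EFinP/measurable_sqr_normc/hf_measurable_circle => //.
      exact: normc_unityX.
  rewrite -(fineK msfin) -EFinM -EFinD lee_fin.
  apply: (@le_trans _ _ ((1 + e') * fine (mean_square Phi s))); first by rewrite ler_wpM2r.
  rewrite mulrDl mul1r lerD2l /e' mulrAC ler_pdivrMr ?ltr_wpDl //.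
  by rewrite ler_wpM2l ?(ltW e0) // lerDl.
Qed.

End HardyFamilies.

(** * The radial maximal function *)

Section RadialMaximal.
Context d (T : measurableType d) (R : realType) (mu : {measure set T -> \bar R}).
Local Notation C := R[i].
Local Notation nc := (@normc R).
Implicit Types (u w z : C) (t : T) (r : R).

Lemma measurable_bigmax (I : Type) (s : seq I) (f : I -> T -> R) :
  (forall i, measurable_fun setT (f i)) ->
  measurable_fun setT (fun t => \big[Num.max/0]_(i <- s) f i t).
Proof.
move=> mf; elim: s => [|i s IH].
  by under eq_fun do rewrite big_nil; exact: measurable_cst.
by under eq_fun do rewrite big_cons; exact: measurable_maxr.
Qed.

Lemma bigmax_nneg m (f : 'I_m -> R) : 0 <= \big[Num.max/0]_i f i.
Proof. exact: bigmax_ge_id. Qed.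

Lemma sume_cst n (x : \bar R) : (\sum_(i < n) x = n%:R%:E * x)%E.
Proof.
elim: n => [|n IH]; first by rewrite big_ord0 mul0e.
by rewrite big_ord_recr /= IH -natr1 EFinD ge0_muleDl ?mul1e ?lee_fin.
Qed.

Lemma sqr_lower (y g e : R) : 0 <= y -> 0 <= g -> 0 <= e -> y - e <= g ->
  y ^+ 2 - 2 * y * e <= g ^+ 2.
Proof.
move=> y0 g0 e0 yg; have [ye|ye] := leP e y.
  have : (y - e) ^+ 2 <= g ^+ 2 by rewrite ler_pXn2r // nnegrE // subr_ge0.
  by have := sqr_ge0 e; rewrite sqrrB; lra.
apply: le_trans (sqr_ge0 g).
have -> : y ^+ 2 - 2 * y * e = y * (y - 2 * e) by ring.
by rewrite mulr_ge0_le0 //; lra.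
Qed.

Variables (rot : C -> T -> T) (ra : rotation_action mu rot).
Variables (Phi : C -> T -> C) (hf : hardy_family rot Phi).

Definition radial_max (rs : nat -> R) m t : R :=
  \big[Num.max/0]_(i < m.+1) nc (Phi (rs i)%:C t).

Lemma measurable_radial_max rs m : (forall i, 0 < rs i < 1) ->
  measurable_fun setT (radial_max rs m).
Proof.
move=> rs01; apply: (measurable_bigmax _ (f := fun (i : 'I_m.+1) t => nc (Phi (rs i)%:C t))) => i.
apply: measurable_normc; apply: (hf_measurable_real hf).
by have /andP[/ltW -> ->] := rs01 i.
Qed.

(** The radial maximal function is dominated by the maximum of the Poisson averages.
    Restricted to an orbit of the group of roots of unity, this maximum is controlled by
    [maximal_circle]; integrating over the parameter and using that rotations preserve
    [mu] turns the inequality on orbits into one for [mu]. *)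
Theorem radial_max_le rs m r : (forall i, 0 < rs i < 1) -> 0 < r < 1 ->
  (forall i, (i <= m)%N -> rs i < r) ->
  (\int[mu]_t (radial_max rs m t ^+ 2)%:E <= 256%:E * mean_square mu Phi r)%E.
Proof.
move=> rs01 r01 rsr; have /andP[r0 r1] := r01.
have r01' : 0 <= r < 1 by rewrite ltW.
pose qs (i : 'I_m.+1) := rs i / r.
have q01 i : 0 < qs i < 1.
  have /andP[ri0 _] := rs01 i.
  by rewrite divr_gt0 //= ltr_pdivrMr // mul1r rsr // -ltnS.
pose h w t := nc (Phi (r%:C * w) t).
pose A k t := \big[Num.max/0]_(i < m.+1) pavg k (qs i) 1 (fun w => h w t).
have mh w : nc w = 1 -> measurable_fun setT (h w).
  by move=> w1; apply: measurable_normc; exact: (hf_measurable_circle hf).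
have mA k : measurable_fun setT (A k).
  apply: (measurable_bigmax _ (f := fun i t => pavg k (qs i) 1 (fun w => h w t))) => i.
  exact: measurable_pavg.
have A0 k t : 0 <= A k t by exact: bigmax_nneg.
apply: (@fatou_eventually _ _ _ _ _ (fun k t => A k t ^+ 2)).
- by apply: measurable_funX; exact: measurable_radial_max.
- by move=> k; exact: measurable_funX.
- by move=> t; exact: sqr_ge0.
- by move=> k t; exact: sqr_ge0.
- move=> t e e0; pose y := radial_max rs m t.
  have y0 : 0 <= y by exact: bigmax_nneg.
  pose e' := e / (2 * y + 1).
  have e'0 : 0 < e' by rewrite divr_gt0 // ltr_wpDl // mulr_ge0.
  have : \forall k \near \oo, forall i : 'I_m.+1,
      nc (Phi (rs i)%:C t) - e' <= pavg k (qs i) 1 (fun w => h w t).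
    apply: filter_forall => i.
    have := poisson_subharmonic (q01 i) (hf_cdiff_disc hf t r01) e'0.
    apply: filterS => k.
    by rewrite -rmorphM /= /qs mulrC divfK // gt_eqF.
  apply: filterS => k yA.
  apply: le_trans (sqr_lower y0 (A0 k t) (ltW e'0) _).
    rewrite lerD2l lerN2 /e' mulrA ler_pdivrMr ?ltr_wpDl ?mulr_ge0 //.
    by rewrite mulrC ler_wpM2l ?(ltW e0) // lerDl.
  rewrite lerBlDr; apply: bigmax_le; first by rewrite addr_ge0 // ltW.
  move=> i _; rewrite -lerBlDr; apply: le_trans (yA i) _.
  exact: (le_bigmax 0 (fun i => pavg k (qs i) 1 (fun w => h w t))).
- have : \forall k \near \oo, forall i : 'I_m.+1, ravg k (poisson (qs i) 1) <= 1 + 1.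
    by apply: filter_forall => i; exact: poisson_mass_real.
  apply: filterS => k mass.
  (* Along an orbit, rotating the parameter amounts to moving the centre of the average. *)
  have Arot (x : 'I_(2 ^ k)) t : A k (rot (unity R k ^+ x) t) =
      \big[Num.max/0]_(i < m.+1) pavg k (qs i) (unity R k ^+ x) (fun w => h w t).
    apply: eq_bigr => i _; rewrite pavg_rot; congr pavg; apply: funext => w.
    by rewrite /h mulrA -(hf_rotation hf) ?normc_unityX.
  have N0 : (0 < ((2 ^ k)%:R : R)) by rewrite ltr0n expn_gt0.
  rewrite -(@lee_pmul2l _ ((2 ^ k)%:R)%:E) ?lte_fin //.
  have -> : (((2 ^ k)%:R)%:E * \int[mu]_t (A k t ^+ 2)%:E =
      \int[mu]_t (\sum_(x < 2 ^ k) (A k (rot (unity R k ^+ x) t) ^+ 2)%:E))%E.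
    rewrite ge0_integral_sum //; first last.
    - by move=> x t _; rewrite lee_fin sqr_ge0.
    - move=> x; apply/measurable_EFinP; apply: measurable_funX.
      by apply: measurableT_comp => //; apply: (ra_measurable ra); exact: normc_unityX.
    under eq_bigr => x _.
      rewrite (integral_preserved (f := fun t => (A k t ^+ 2)%:E)).
      - over.
      - by apply: (ra_measurable ra); exact: normc_unityX.
      - by apply: (ra_preserving ra); exact: normc_unityX.
      - by apply/measurable_EFinP; exact: measurable_funX.
      - by move=> t; rewrite lee_fin sqr_ge0.
    by rewrite sume_cst.
  have -> : (((2 ^ k)%:R)%:E * (256%:E * mean_square mu Phi r) =
      \int[mu]_t (256%:E * \sum_(x < 2 ^ k) (h (unity R k ^+ x) t ^+ 2)%:E))%E.
    rewrite ge0_integralZl_EFin //; first last.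
    - apply: emeasurable_sum => x; apply/measurable_EFinP; apply: measurable_funX.
      by apply: mh; exact: normc_unityX.
    - by move=> t _; apply: sume_ge0 => x _; rewrite lee_fin sqr_ge0.
    rewrite ge0_integral_sum //; first last.
    - by move=> x t _; rewrite lee_fin sqr_ge0.
    - move=> x; apply/measurable_EFinP; apply: measurable_funX.
      by apply: mh; exact: normc_unityX.
    under eq_bigr => x _ do rewrite (mean_square_rot ra hf) ?normc_unityX //.
    by rewrite sume_cst muleCA.
  apply: ge0_le_integral => //.
  + by move=> t _; apply: sume_ge0 => x _; rewrite lee_fin sqr_ge0.
  + apply: emeasurable_sum => x; apply/measurable_EFinP; apply: measurable_funX.
    by apply: measurableT_comp => //; apply: (ra_measurable ra); exact: normc_unityX.
  + apply: emeasurable_funM => //.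
    apply: emeasurable_sum => x; apply/measurable_EFinP; apply: measurable_funX.
    by apply: mh; exact: normc_unityX.
  + move=> t _; rewrite !sumEFin -EFinM lee_fin.
    under eq_bigr => x _ do rewrite Arot.
    by apply: maximal_circle => // w; exact: normc_ge0.
Qed.

Definition radial_sup_sq (rs : nat -> R) t : \bar R :=
  limn (fun m => (radial_max rs m t ^+ 2)%:E).

Lemma radial_max_nd rs t : {homo (fun m => (radial_max rs m t ^+ 2)%:E) : n m / (n <= m)%N >->
  (n <= m)%E}.
Proof.
apply: homo_leq => //; first by move=> ? ? ?; exact: le_trans.
move=> m; rewrite lee_fin ler_pXn2r ?nnegrE ?bigmax_nneg //.
apply: bigmax_le => [|i _]; first exact: bigmax_nneg.
exact: (le_bigmax 0 (fun j : 'I_m.+2 => nc (Phi (rs j)%:C t)) (widen_ord (leqnSn _) i)).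
Qed.

Lemma radial_sup_sq_ge rs t i : ((nc (Phi (rs i)%:C t) ^+ 2)%:E <= radial_sup_sq rs t)%E.
Proof.
have := ereal_nondecreasing_cvgn (@radial_max_nd rs t) => /cvg_lim; rewrite /radial_sup_sq => -> //.
apply: (@le_trans _ _ (radial_max rs i t ^+ 2)%:E); last first.
  by apply: ereal_sup_ubound; exists i.
rewrite lee_fin ler_pXn2r ?nnegrE ?normc_ge0 ?bigmax_nneg //.
exact: (le_bigmax 0 (fun j : 'I_i.+1 => nc (Phi (rs j)%:C t)) ord_max).
Qed.

Lemma measurable_radial_sup_sq rs : (forall i, 0 < rs i < 1) ->
  measurable_fun setT (radial_sup_sq rs).
Proof.
move=> rs01; apply: (emeasurable_fun_cvg (fun m t => (radial_max rs m t ^+ 2)%:E)).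
- by move=> m; apply/measurable_EFinP; apply: measurable_funX; exact: measurable_radial_max.
- by move=> t _; apply: ereal_nondecreasing_is_cvgn; exact: radial_max_nd.
Qed.

Theorem integral_radial_sup_sq rs (L : \bar R) : (forall i, 0 < rs i < 1) ->
  (forall r, 0 < r < 1 -> (mean_square mu Phi r <= L)%E) ->
  (\int[mu]_t radial_sup_sq rs t <= 256%:E * L)%E.
Proof.
move=> rs01 PL.
have := @cvg_monotone_convergence _ _ _ mu setT measurableT
  (fun m t => (radial_max rs m t ^+ 2)%:E).
move=> /(_ _ _ _)/cvg_lim <- //.
- apply: lime_le; last first.
    apply: nearW => m.
    pose M := \big[Num.max/0]_(i < m.+1) rs i.
    have M0 : 0 <= M by exact: bigmax_nneg.
    have M1 : M < 1 by apply: bigmax_lt => // i _; case/andP: (rs01 i).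
    apply: le_trans (@radial_max_le rs m ((M + 1) / 2) rs01 _ _) _.
    + by apply/andP; split; lra.
    + move=> i im; apply: (@le_lt_trans _ _ M); last by lra.
      exact: (le_bigmax 0 (fun i : 'I_m.+1 => rs i) (Ordinal (im : (i < m.+1)%N))).
    + by apply: lee_wpmul2l => //; apply: PL; apply/andP; split; lra.
  apply: ereal_nondecreasing_is_cvgn => n p np; apply: ge0_le_integral => //.
  + by move=> t _; rewrite lee_fin sqr_ge0.
  + by apply/measurable_EFinP; apply: measurable_funX; exact: measurable_radial_max.
  + by apply/measurable_EFinP; apply: measurable_funX; exact: measurable_radial_max.
  + by move=> t _; exact: radial_max_nd.
- by move=> m; apply/measurable_EFinP; apply: measurable_funX; exact: measurable_radial_max.
- by move=> m t _; rewrite lee_fin sqr_ge0.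
- by move=> t _; exact: radial_max_nd.
Qed.

End RadialMaximal.

(** * Comparison of a family with its dilations *)

Section DilationDifferences.
Context d (T : measurableType d) (R : realType) (mu : {measure set T -> \bar R}).
Local Notation C := R[i].
Local Notation nc := (@normc R).
Implicit Types (u w z : C) (t : T) (r : R).
Variables (rot : C -> T -> T).

Lemma cdiffD (f g : C -> C) z : cdiff f z -> cdiff g z -> cdiff (fun w => f w + g w) z.
Proof.
move=> /cdiff_differentiable hz /cdiff_differentiable ghz.
by apply/cdiff_differentiable; exact: (@differentiableD _ (Cplx R) (Cplx R) f g z hz ghz).
Qed.

Lemma hardy_familyD (P Q : C -> T -> C) : hardy_family rot P -> hardy_family rot Q ->
  hardy_family rot (fun w t => P w t + Q w t).
Proof.
move=> hP hQ; split.
- by move=> t w w1; apply: cdiffD; [exact: (hf_cdiff hP)|exact: (hf_cdiff hQ)].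
- move=> w w1; have [P1 P2] := hf_measurable hP w1; have [Q1 Q2] := hf_measurable hQ w1.
  split.
    by under eq_fun do rewrite raddfD; exact: measurable_funD.
  by under eq_fun do rewrite raddfD; exact: measurable_funD.
- by move=> w u t u1; rewrite (hf_rotation hP) // (hf_rotation hQ).
Qed.

Lemma hardy_familyN (P : C -> T -> C) : hardy_family rot P ->
  hardy_family rot (fun w t => - P w t).
Proof.
move=> hP; split.
- move=> t w w1; apply: (_ : cdiff (fun z => 0 - P z t) w -> _).
    by under [X in cdiff X]eq_fun do rewrite sub0r.
  by apply: cdiffB; [exact: cdiff_cst|exact: (hf_cdiff hP)].
- move=> w w1; have [P1 P2] := hf_measurable hP w1; split.
    by under eq_fun do rewrite raddfN; exact: measurableT_comp.
  by under eq_fun do rewrite raddfN; exact: measurableT_comp.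
- by move=> w u t u1; rewrite (hf_rotation hP).
Qed.

Lemma hardy_family_dilation (P : C -> T -> C) r : 0 < r < 1 -> hardy_family rot P ->
  hardy_family rot (fun w t => P (r%:C * w) t).
Proof.
move=> /andP[r0 r1] hP.
have small w : nc w < 1 -> nc (r%:C * w) < 1.
  move=> w1; rewrite normcM normcR gtr0_norm //.
  by apply: le_lt_trans r1; rewrite ler_piMr // ltW.
split.
- move=> t w w1; apply: (@cdiff_comp _ (fun z => P z t) (fun w => r%:C * w)).
    by apply: cdiffM; [exact: cdiff_cst|exact: cdiff_id].
  by apply: (hf_cdiff hP); exact: small.
- by move=> w w1; apply: (hf_measurable hP); exact: small.
- by move=> w u t u1; rewrite mulrA (hf_rotation hP).
Qed.

Definition rational_radius (i : nat) : R :=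
  if @unpickle rat i is Some q then
    if 0 < (ratr q : R) < 1 then ratr q else 2^-1 else 2^-1.

Lemma rational_radius01 i : 0 < rational_radius i < 1.
Proof.
have half01 : 0 < (2^-1 : R) < 1 by apply/andP; split; lra.
by rewrite /rational_radius; case: unpickle => // q; case: ifP.
Qed.

Lemma rational_radius_dense r e : 0 < r < 1 -> 0 < e ->
  exists i, `|rational_radius i - r| < e.
Proof.
move=> /andP[r0 r1] e0.
have lt : Num.max 0 (r - e) < r by rewrite gt_max r0 gtrBl.
have [q] := rat_in_itvoo lt.
rewrite in_itv /= gt_max => /andP[/andP[q0 qe] qr].
exists (pickle q); rewrite /rational_radius pickleK q0 (lt_trans qr r1) /=.
by rewrite ltr_norml; apply/andP; split; lra.
Qed.

Variables (ra : rotation_action mu rot).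

Section Family.
Variables (Phi : C -> T -> C) (hf : hardy_family rot Phi).

Let rs := rational_radius.

Lemma radial_continuous t r : 0 < r < 1 -> forall e, 0 < e ->
  exists2 dl : R, 0 < dl & forall s, `|s - r| < dl -> nc (Phi s%:C t - Phi r%:C t) <= e.
Proof.
move=> /andP[r0 r1] e e0.
have rd : cdiff (fun z => Phi z t) r%:C.
  by apply: (hf_cdiff hf); rewrite normcR gtr0_norm.
have [dl dl0 dlP] := cdiff_continuous rd e0; exists dl => // s sr.
by apply: dlP; rewrite -rmorphB normcR.
Qed.

(** By continuity in the radius, the supremum over a dense sequence of radii bounds the
    values at all radii. *)
Lemma radial_sup_sq_bound t r : 0 < r < 1 ->
  ((nc (Phi r%:C t) ^+ 2)%:E <= radial_sup_sq Phi rs t)%E.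
Proof.
move=> r01; have S0 : (0 <= radial_sup_sq Phi rs t)%E.
  by apply: le_trans (radial_sup_sq_ge Phi rs t 0); rewrite lee_fin sqr_ge0.
have [->|S1] := eqVneq (radial_sup_sq Phi rs t) +oo%E; first exact: leey.
have Sf : radial_sup_sq Phi rs t \is a fin_num by rewrite ge0_fin_numE // ltey.
rewrite -(fineK Sf) lee_fin.
set s := fine _; have s0 : 0 <= s by exact: fine_ge0.
rewrite -(@sqr_sqrtr _ s) // ler_pXn2r ?nnegrE ?normc_ge0 ?sqrtr_ge0 //.
apply/ler_addgt0Pr => e e0.
have [dl dl0 dlP] := radial_continuous t r01 e0.
have [i id] := rational_radius_dense r01 dl0.
rewrite -[Phi r%:C t](subKr (Phi (rs i)%:C t)).
apply: le_trans (normcB _ _) _; apply: lerD; last exact: dlP.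
rewrite -(ler_pXn2r (n := 2)) ?nnegrE ?normc_ge0 ?sqrtr_ge0 // sqr_sqrtr //.
by rewrite -lee_fin fineK //; exact: radial_sup_sq_ge.
Qed.

Lemma mean_square_parallelogram (P Q : C -> T -> C) r : 0 <= r < 1 ->
  hardy_family rot P -> hardy_family rot Q ->
  (mean_square mu (fun w t => P w t - Q w t)%R r +
   mean_square mu (fun w t => P w t + Q w t)%R r =
   2%:E * mean_square mu P r + 2%:E * mean_square mu Q r)%E.
Proof.
move=> r01 hP hQ.
have m h : hardy_family rot h -> measurable_fun setT (fun t => (nc (h r%:C t) ^+ 2)%:E).
  by move=> hh; apply/measurable_EFinP; apply: measurable_sqr_normc; exact: (hf_measurable_real hh).
have mD := m _ (hardy_familyD hP (hardy_familyN hQ)).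
have mS := m _ (hardy_familyD hP hQ).
rewrite -!ge0_integralZl_EFin //;
  try (by move=> t _; rewrite lee_fin sqr_ge0); try exact: m.
rewrite -!ge0_integralD //.
- by apply: eq_integral => t _; rewrite -!EFinM -!EFinD normc_parallelogram.
- by move=> t _; apply: mule_ge0 => //; rewrite lee_fin sqr_ge0.
- by apply: emeasurable_funM => //; exact: m.
- by move=> t _; apply: mule_ge0 => //; rewrite lee_fin sqr_ge0.
- by apply: emeasurable_funM => //; exact: m.
- by move=> t _; rewrite lee_fin sqr_ge0.
- by move=> t _; rewrite lee_fin sqr_ge0.
Qed.

Variable L : R.
Hypothesis PhiL : forall r, 0 < r < 1 -> (mean_square mu Phi r <= L%:E)%E.

Lemma integrable_radial_sup_sq : mu.-integrable setT (radial_sup_sq Phi rs).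
Proof.
have S0 t : (0 <= radial_sup_sq Phi rs t)%E.
  by apply: le_trans (radial_sup_sq_ge Phi rs t 0); rewrite lee_fin sqr_ge0.
apply/integrableP; split.
  by apply: (measurable_radial_sup_sq hf); exact: rational_radius01.
under eq_integral do rewrite gee0_abs //.
apply: le_lt_trans (integral_radial_sup_sq ra hf rational_radius01 PhiL) _.
by rewrite -EFinM ltry.
Qed.

(** Radii, or dilation factors, that increase to 1. *)
Definition shrink (j : nat) : R := 1 - j.+2%:R^-1.

Lemma shrink01 j : 0 < shrink j < 1.
Proof.
by rewrite /shrink subr_gt0 invf_lt1 ?ltr1n //= gtrBl invr_gt0.
Qed.

Lemma shrink_near e : 0 < e -> \forall j \near \oo, 1 - e < shrink j.
Proof.
move=> e0; have [N NP] : exists N : nat, e^-1 < N%:R.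
  by exists (Num.truncn e^-1).+1; exact: truncnS_gt.
exists N => // j /= Nj; rewrite /shrink ltrD2l ltrN2.
rewrite invf_plt ?posrE //; apply: lt_le_trans NP _.
by rewrite ler_nat; apply: leq_trans Nj _; rewrite -addn2 leq_addr.
Qed.

Definition dilation_diff (k : R) w t : C := Phi w t - Phi (k%:C * w) t.

Lemma hf_dilation_diff k : 0 < k < 1 -> hardy_family rot (dilation_diff k).
Proof. by move=> k01; exact: (hardy_familyD hf (hardy_familyN (hardy_family_dilation k01 hf))). Qed.

(** At a fixed radius, the dilations converge pointwise and are dominated by the square
    of the radial maximal function. *)
Lemma dilation_diff_cvg0 r : 0 < r < 1 ->
  (mean_square mu (dilation_diff (shrink j)) r @[j --> \oo] --> 0)%E.
Proof.
move=> r01; have /andP[r0 r1] := r01.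
have r01' : 0 <= r < 1 by rewrite ltW.
have S0 t : (0 <= radial_sup_sq Phi rs t)%E.
  by apply: le_trans (radial_sup_sq_ge Phi rs t 0); rewrite lee_fin sqr_ge0.
have hD j := hf_dilation_diff (shrink01 j).
have mD j : measurable_fun setT (fun t => (nc (dilation_diff (shrink j) r%:C t) ^+ 2)%:E).
  by apply/measurable_EFinP; apply: measurable_sqr_normc; exact: (hf_measurable_real (hD j)).
have [|||_ _] := @dominated_convergence _ _ _ mu setT measurableT
  (fun j t => (nc (dilation_diff (shrink j) r%:C t) ^+ 2)%:E) (cst 0%E)
  (fun t => 4%:E * radial_sup_sq Phi rs t)%E mD (measurable_cst _); last first.
- by rewrite integral0.
- apply/nearW => t j _; rewrite gee0_abs ?lee_fin ?sqr_ge0 //.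
  have k01 := shrink01 j; have /andP[k0 k1] := k01.
  have kr01 : 0 < shrink j * r < 1.
    by rewrite mulr_gt0 //=; apply: lt_trans r1; rewrite gtr_pMl.
  have := leeD (lee_wpmul2l (_ : 0 <= 2%:E)%E (radial_sup_sq_bound t r01))
    (lee_wpmul2l (_ : 0 <= 2%:E)%E (radial_sup_sq_bound t kr01)).
  have four : (2%:E + 2%:E = 4%:E :> \bar R)%E by rewrite -EFinD; congr _%:E; ring.
  rewrite -ge0_muleDl // four.
  move=> H; apply: le_trans (H _ _) => //.
  rewrite -!EFinM -EFinD lee_fin /dilation_diff -rmorphM /= -normc_parallelogram.
  by rewrite lerDl sqr_ge0.
- exact: integrableZl integrable_radial_sup_sq.
- apply/nearW => t _; apply/fine_cvgP; split; first exact: nearW.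
  apply/cvgrPdist_le => e e0; rewrite /=.
  have se : 0 < Num.sqrt e by rewrite sqrtr_gt0.
  have [dl dl0 dlP] := radial_continuous t r01 se.
  apply: filterS (shrink_near dl0) => j kj; rewrite sub0r normrN ger0_norm ?sqr_ge0 //.
  have /andP[k0 k1] := shrink01 j.
  rewrite -(@sqr_sqrtr _ e) ?(ltW e0) // ler_pXn2r ?nnegrE ?normc_ge0 ?sqrtr_ge0 //.
  rewrite normc_subC -rmorphM; apply: dlP.
  have : (1 - shrink j) * r < dl.
    by apply: le_lt_trans (_ : 1 - shrink j < dl); [rewrite ler_piMr ?ltW // subr_gt0|lra].
  have : 0 < (1 - shrink j) * r by rewrite mulr_gt0 // subr_gt0.
  by rewrite ltr_norml => h1 h2; apply/andP; split; lra.
Qed.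

End Family.
End DilationDifferences.

(** * Radial limits almost everywhere *)

Section RadialLimits.
Context d (T : measurableType d) (R : realType) (mu : {measure set T -> \bar R}).
Local Notation C := R[i].
Local Notation nc := (@normc R).
Implicit Types (u w z : C) (t : T) (r : R).
Variables (rot : C -> T -> T) (ra : rotation_action mu rot).
Variables (Phi : C -> T -> C) (hf : hardy_family rot Phi).
Variable L : R.
Hypothesis PhiL : forall r, 0 < r < 1 -> (mean_square mu Phi r <= L%:E)%E.
Hypothesis Lsup : forall e, 0 < e ->
  exists2 r, 0 < r < 1 & ((L - e)%:E <= mean_square mu Phi r)%E.

Let rs := @rational_radius R.
Let Dk j := dilation_diff Phi (@shrink R j).

Let fin_between (x y : \bar R) (a : R) : (0 <= x)%E -> (0 <= y)%E -> (x + y = a%:E)%E ->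
  exists b c : R, [/\ x = b%:E, y = c%:E & b + c = a].
Proof.
case: x => [b| |] //; case: y => [c| |] // _ _.
by move=> [bc]; exists b, c.
Qed.

(** The mean squares of [Phi w - Phi (k w)] are small for [k] near 1, uniformly in the
    radius. By the parallelogram identity it is enough to bound from below the mean
    square of [Phi w + Phi (k w)]; as it increases with the radius, a fixed radius [r']
    suffices, and there [dilation_diff_cvg0] applies. *)
Lemma dilation_diff_uniform e : 0 < e -> \forall j \near \oo,
  forall r, 0 < r < 1 -> (mean_square mu (Dk j) r <= e%:E)%E.
Proof.
move=> e0; have e8 : 0 < e / 8 by rewrite divr_gt0.
have [r0 r001 Lr0] := Lsup e8; have /andP[r00 r01] := r001.
pose r' := (1 + r0) / 2; have r'0 : r0 < r' by rewrite /r'; lra.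
have r'1 : r' < 1 by rewrite /r'; lra.
have r'01 : 0 < r' < 1 by apply/andP; split; lra.
have gap : 0 < 1 - r0 / r' by rewrite subr_gt0 ltr_pdivrMr ?mul1r //; lra.
have /fine_cvgP[Dfin /cvgrPdist_le/(_ (e / 2))] := dilation_diff_cvg0 ra hf PhiL r'01.
rewrite divr_gt0 // => /(_ isT) Dsmall.
near=> j => r r01'.
have k01 := @shrink01 R j; have /andP[k0 k1] := k01.
have hD : hardy_family rot (Dk j) by exact: hf_dilation_diff.
have hS : hardy_family rot (fun w t => Phi w t + Phi ((shrink R j)%:C * w) t).
  exact: (hardy_familyD hf (hardy_family_dilation k01 hf)).
have para s : 0 < s < 1 -> exists b c x y : R, [/\
    mean_square mu (Dk j) s = b%:E,
    mean_square mu (fun w t => Phi w t + Phi ((shrink R j)%:C * w) t) s = c%:E,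
    mean_square mu Phi s = x%:E, mean_square mu Phi (shrink R j * s) = y%:E &
    b + c = 2 * x + 2 * y].
  move=> s01; have /andP[s0 s1] := s01.
  have ks01 : 0 < shrink R j * s < 1.
    by rewrite mulr_gt0 //=; apply: lt_trans s1; rewrite gtr_pMl.
  have s01' : 0 <= s < 1 by rewrite ltW.
  have := mean_square_parallelogram mu s01' hf (hardy_family_dilation k01 hf).
  have finite v : 0 < v < 1 -> exists x : R, mean_square mu Phi v = x%:E.
    move=> v01; exists (fine (mean_square mu Phi v)); rewrite fineK //.
    rewrite ge0_fin_numE ?mean_square_ge0 //.
    by apply: le_lt_trans (PhiL v01) _; rewrite ltry.
  have [x xE] := finite _ s01; have [y yE] := finite _ ks01.
  have -> : mean_square mu (fun w t => Phi ((shrink R j)%:C * w) t) s = y%:E.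
    by rewrite -yE /mean_square rmorphM.
  rewrite xE -!EFinM -EFinD => /fin_between[||b [c [bE cE bc]]]; try exact: mean_square_ge0.
  by exists b, c, x, y.
have [b [c [x [y [bE cE xE yE bc]]]]] := para _ r01'.
have [b' [c' [x' [y' [bE' cE' xE' yE' bc']]]]] := para _ r'01.
have b'e : b' <= e / 2.
  have : `|0 - fine (mean_square mu (Dk j) r')| <= e / 2 by near: j; exact: Dsmall.
  by rewrite bE' sub0r normrN => /(le_trans (ler_norm _)).
rewrite bE lee_fin.
have [rr'|r'r] := ltP r r'.
  have : (mean_square mu (Dk j) r <= mean_square mu (Dk j) r')%E.
    by case/andP: r01' => *; exact: (mean_square_le ra hD).
  by rewrite bE bE' lee_fin; lra.
have cc : c' <= c.
  move: r'r; rewrite le_eqVlt => /orP[/eqP E|r'r].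
    by have := cE; rewrite -E cE' => -[->].
  rewrite -lee_fin -cE -cE'; case/andP: r01' => *.
  by apply: (mean_square_le ra hS) => //; lra.
have kr : r0 < shrink R j * r'.
  rewrite -ltr_pdivrMr; last by lra.
  have : 1 - (1 - r0 / r') < shrink R j by near: j; exact: shrink_near.
  by lra.
have krr : shrink R j * r' < 1 by apply: lt_trans r'1; rewrite gtr_pMl; lra.
have Ly' : L - e / 8 <= y'.
  rewrite -lee_fin -yE'; apply: le_trans Lr0 _.
  exact: (mean_square_le ra hf).
have Lx' : L - e / 8 <= x'.
  by rewrite -lee_fin -xE'; apply: le_trans Lr0 _; exact: (mean_square_le ra hf).
have xL : x <= L by rewrite -lee_fin -xE; exact: PhiL.
have yL : y <= L.
  rewrite -lee_fin -yE; apply: PhiL; case/andP: r01' => r0' r1'.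
  by rewrite mulr_gt0 //=; apply: lt_trans r1'; rewrite gtr_pMl.
lra.
Unshelve. all: by end_near. Qed.

(** The maximal inequality turns the uniform smallness of the mean squares into
    smallness of suprema over all radii, and Fatou's lemma makes it hold for almost
    every parameter along a subsequence that depends on the parameter. *)
Lemma dilation_sup_ae : {ae mu, forall t, limn_einf (fun j => radial_sup_sq (Dk j) rs t) = 0%E}.
Proof.
have hD j : hardy_family rot (Dk j) by exact: (hf_dilation_diff hf (@shrink01 R j)).
have W0 j t : (0 <= radial_sup_sq (Dk j) rs t)%E.
  by apply: le_trans (radial_sup_sq_ge (Dk j) rs t 0); rewrite lee_fin sqr_ge0.
have mW j : measurable_fun setT (radial_sup_sq (Dk j) rs).
  by apply: (measurable_radial_sup_sq (hD j)); exact: rational_radius01.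
have mlim : measurable_fun setT (fun t => limn_einf (fun j => radial_sup_sq (Dk j) rs t)).
  exact: (measurable_limn_einf (f := fun j => radial_sup_sq (Dk j) rs)).
have lim0 t : (0 <= limn_einf (fun j => radial_sup_sq (Dk j) rs t))%E.
  apply: limn_einf_ge => e e0; apply: nearW => j.
  by apply: le_trans (W0 j t); rewrite sub0e leeNl oppe0 lee_fin ltW.
have : (\int[mu]_t `|limn_einf (fun j => radial_sup_sq (Dk j) rs t)| = 0)%E.
  under eq_integral do rewrite gee0_abs //.
  apply/eqP; rewrite eq_le integral_ge0 ?andbT //.
  apply: le_trans (fatou mu measurableT mW _) _ => //.
  apply/lee_addgt0Pr => e e0; rewrite add0e; apply: limn_einf_le.
  have e2 : 0 < e / 256 by rewrite divr_gt0.
  apply: filterS (dilation_diff_uniform e2) => j Dj.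
  apply: le_trans (integral_radial_sup_sq ra (hD j) (@rational_radius01 R) Dj) _.
  by rewrite -EFinM lee_fin mulrC divfK.
move=> /ae_eq_integral_abs => /(_ measurableT mlim).
by apply: filterS => t /(_ I).
Qed.

Lemma near_left1 (P : R -> Prop) : (\forall r \near 1^'-, P r) <->
  exists2 dl : R, 0 < dl & forall r, 1 - dl < r < 1 -> P r.
Proof.
split=> [/nbhs_normP[dl /= dl0 dlP]|[dl dl0 dlP]].
  exists dl => // r /andP[r1 r2]; apply: dlP => //.
  by rewrite /ball_ /= ltr_norml; apply/andP; split; lra.
apply/nbhs_normP; exists dl => //= r; rewrite /ball_ /= ltr_norml => /andP[r1 r2] r3.
by apply: dlP; apply/andP; split; lra.
Qed.

Lemma complex_cauchy_left (f : R -> C) :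
  (forall e, 0 < e -> exists2 dl : R, 0 < dl &
    forall r s, 1 - dl < r < 1 -> 1 - dl < s < 1 -> nc (f r - f s) <= e) ->
  exists c : Cplx R, (f r : Cplx R) @[r --> 1^'-] --> c.
Proof.
move=> H.
have part (p : C -> R) : (forall z w, `|p z - p w| <= nc (z - w)) ->
    exists a : R, p (f r) @[r --> 1^'-] --> a.
  move=> pL; apply/cvg_ex; apply/cauchy_cvgP/cauchyP => e e0.
  have [dl dl0 dlP] := H (e / 2) (divr_gt0 e0 (ltr0Sn R 1)).
  exists (p (f (1 - dl / 2))); apply/near_left1; exists dl => // r rI.
  rewrite -ball_normE /ball_ /=; apply: le_lt_trans (pL _ _) _.
  apply: le_lt_trans (dlP _ _ _ rI) _; last by lra.
  by apply/andP; split; lra.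
have [|a aP] := part (@complex.Re R).
  by move=> z w; have := normc_ge_normRe (z - w); rewrite raddfB.
have [|b bP] := part (@complex.Im R).
  by move=> z w; have := normc_ge_normIm (z - w); rewrite raddfB.
exists (a +i* b); apply/cvg_normcP => e e0.
have e2 : 0 < e / 2 by rewrite divr_gt0.
move: aP => /cvgrPdist_le /(_ _ e2) aP; move: bP => /cvgrPdist_le /(_ _ e2) bP.
near=> r; apply: le_trans (normc_le_ReIm _) _.
rewrite !raddfB /= [e]splitr; apply: lerD; rewrite distrC.
  by near: r.
by near: r.
Unshelve. all: by end_near. Qed.

(** For each [k < 1] the radial limit of the dilation [Phi (k r) t] exists, since
    [Phi] is continuous at [k]. By [dilation_sup_ae] these dilations approximate [Phi]
    uniformly along almost every radius, which makes [Phi r t] a Cauchy family. *)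
Theorem radial_limit_ae : {ae mu, forall t, exists c : Cplx R,
  (Phi r%:C t : Cplx R) @[r --> 1^'-] --> c}.
Proof.
apply: filterS dilation_sup_ae => t W0.
have hD j : hardy_family rot (Dk j) by exact: (hf_dilation_diff hf (@shrink01 R j)).
apply: complex_cauchy_left => e e0.
have e3 : 0 < e / 3 by rewrite divr_gt0.
have [j Wj] : exists j, (radial_sup_sq (Dk j) rs t <= ((e / 3) ^+ 2)%:E)%E.
  apply: contrapT => /forallNP noj.
  have : (((e / 3) ^+ 2)%:E <= limn_einf (fun j => radial_sup_sq (Dk j) rs t))%E.
    apply: limn_einf_ge => e' e'0; apply: nearW => j.
    have /negP := noj j; rewrite -ltNge => /ltW; apply: le_trans.
    by rewrite -EFinB lee_fin gerBl ltW.
  by rewrite W0 lee_fin leNgt exprn_gt0.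
have near_dil r : 0 < r < 1 -> nc (Phi r%:C t - Phi (shrink R j * r)%:C t) <= e / 3.
  move=> r01; have := le_trans (radial_sup_sq_bound (hD j) t r01) Wj.
  rewrite lee_fin ler_pXn2r ?nnegrE ?normc_ge0 ?(ltW e3) //.
  by rewrite /Dk /dilation_diff -rmorphM.
have k01 := @shrink01 R j; have /andP[k0 k1] := k01.
have e6 : 0 < e / 6 by rewrite divr_gt0.
have [dl dl0 dlP] := radial_continuous hf t k01 e6.
exists (Num.min dl 1); first by rewrite lt_min dl0 ltr01.
have cont r : 1 - Num.min dl 1 < r < 1 -> 0 < r < 1 /\
    nc (Phi (shrink R j * r)%:C t - Phi (shrink R j)%:C t) <= e / 6.
  move=> /andP[]; rewrite ltrBlDl -ltrBlDr lt_min => /andP[rd r0] r1.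
  split; first by apply/andP; split; lra.
  apply: dlP; have : shrink R j * (1 - r) < dl.
    by apply: le_lt_trans (_ : 1 - r < dl); [rewrite ler_piMl ?subr_ge0 ?ltW|lra].
  have : 0 < shrink R j * (1 - r) by rewrite mulr_gt0 // subr_gt0.
  by rewrite ltr_norml => h1 h2; apply/andP; split; lra.
move=> r s /cont[r01 rc] /cont[s01 sc].
set A := Phi r%:C t; set B := Phi (shrink R j * r)%:C t.
set A' := Phi s%:C t; set B' := Phi (shrink R j * s)%:C t.
set K := Phi (shrink R j)%:C t.
have -> : A - A' = (A - B + (B - K)) - (A' - B' + (B' - K)) by ring.
apply: le_trans (normcB _ _) _.
have := le_normcD (A - B) (B - K); have := le_normcD (A' - B') (B' - K).
have : nc (A - B) <= e / 3 by exact: near_dil.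
have : nc (A' - B') <= e / 3 by exact: near_dil.
move: rc sc; rewrite -/B -/B' -/K; lra.
Qed.

(** Dominated convergence, with the radial maximal function as the dominating function,
    and the monotonicity of the mean squares. *)
Theorem radial_limit_mean_square (Psi : T -> C) : cmeasurable Psi ->
  {ae mu, forall t, (Phi r%:C t : Cplx R) @[r --> 1^'-] --> (Psi t : Cplx R)} ->
  (\int[mu]_t (nc (Psi t) ^+ 2)%:E = L%:E)%E.
Proof.
move=> mPsi Plim.
have mP j : measurable_fun setT (fun t => (nc (Phi (shrink R j)%:C t) ^+ 2)%:E).
  apply/measurable_EFinP; apply: measurable_sqr_normc; apply: (hf_measurable_real hf).
  by case/andP: (@shrink01 R j) => /ltW -> ->.
have S0 t : (0 <= radial_sup_sq Phi rs t)%E.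
  by apply: le_trans (radial_sup_sq_ge Phi rs t 0); rewrite lee_fin sqr_ge0.
have [||||_ _ lim1] := @dominated_convergence _ _ _ mu setT measurableT
  (fun j t => (nc (Phi (shrink R j)%:C t) ^+ 2)%:E) (fun t => (nc (Psi t) ^+ 2)%:E)
  (radial_sup_sq Phi rs) mP; last first.
- have lim2 : (mean_square mu Phi (shrink R j) @[j --> \oo] --> L%:E)%E.
    apply/fine_cvgP; split.
      apply: nearW => j; rewrite ge0_fin_numE ?mean_square_ge0 //.
      by apply: le_lt_trans (PhiL (@shrink01 R j)) _; rewrite ltry.
    apply/cvgrPdist_le => e e0; have [r0 /andP[r00 r01] Lr] := Lsup e0.
    have gap : 0 < 1 - r0 by rewrite subr_gt0.
    apply: filterS (shrink_near gap) => j; rewrite subKr /= => rj.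
    have /andP[k0 k1] := @shrink01 R j.
    have m1 := mean_square_le ra hf r00 rj k1.
    have m2 := PhiL (@shrink01 R j).
    have mf : mean_square mu Phi (shrink R j) \is a fin_num.
      by rewrite ge0_fin_numE ?mean_square_ge0 //; apply: le_lt_trans m2 _; rewrite ltry.
    move: (le_trans Lr m1) m2; rewrite -(fineK mf) !lee_fin => h1 h2.
    by rewrite ler_norml; apply/andP; split; lra.
  by rewrite -(cvg_lim _ lim1) // -(cvg_lim _ lim2).
- by apply: nearW => t j _; rewrite gee0_abs ?lee_fin ?sqr_ge0 //; apply: (radial_sup_sq_bound
  hf); exact: shrink01.
- exact: (integrable_radial_sup_sq ra hf PhiL).
- apply: filterS Plim => t Pt _; apply/fine_cvgP; split; first exact: nearW.
  have Pj : nc (Phi (shrink R j)%:C t) @[j --> \oo] --> nc (Psi t).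
    apply/cvgrPdist_le => e e0.
    move/cvg_normcP : Pt => /(_ e e0) /near_left1[dl dl0 dlP].
    apply: filterS (shrink_near dl0) => j kj.
    have /andP[_ k1] := @shrink01 R j.
    have := dlP (shrink R j); rewrite kj k1 => /(_ isT) close.
    have h1 := le_normcD (Psi t) (Phi (shrink R j)%:C t - Psi t).
    have h2 := normcB (Phi (shrink R j)%:C t) (Phi (shrink R j)%:C t - Psi t).
    move: h1 h2; rewrite subrKC subKr => h1 h2.
    by rewrite ler_norml; apply/andP; split; lra.
  exact: (cvgM Pj Pj).
- by apply/measurable_EFinP; exact: measurable_sqr_normc.
Qed.

End RadialLimits.

(** * Borel functions obtained by restriction to points of continuity *)

Lemma continuous_normcP (R : realType) (X : topologicalType) (h : X -> Cplx R) (t : X) :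
  {for t, continuous h} <-> forall e : R, 0 < e ->
    \forall z \near t, normc (h z - h t) <= e.
Proof. exact: cvg_normcP. Qed.

Lemma continuous_Re (R : realType) (X : topologicalType) (h : X -> Cplx R) (t : X) : {for t,
  continuous h} ->
  {for t, continuous (fun z => complex.Re (h z))}.
Proof.
move=> /continuous_normcP hc; apply/cvgrPdist_le => e e0.
have := hc e e0; apply: filterS => z; apply: le_trans.
by rewrite distrC; have := normc_ge_normRe (h z - h t); rewrite raddfB.
Qed.

Lemma continuous_Im (R : realType) (X : topologicalType) (h : X -> Cplx R) (t : X) : {for t,
  continuous h} ->
  {for t, continuous (fun z => complex.Im (h z))}.
Proof.
move=> /continuous_normcP hc; apply/cvgrPdist_le => e e0.
have := hc e e0; apply: filterS => z; apply: le_trans.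
by rewrite distrC; have := normc_ge_normIm (h z - h t); rewrite raddfB.
Qed.

Lemma continuous_col (R : realType) (n : nat) (X : topologicalType) (f : X -> Cn R n) (z : X) :
  (forall i, {for z, continuous (fun x => f x i ord0)}) ->
  {for z, continuous f}.
Proof.
move=> fc A [P PN PA].
have : \forall x \near z, forall i j, P i j (f x i j).
  apply: filter_forall => i; apply: filter_forall => j.
  by rewrite (ord1 j); apply: fc; have := PN i j; rewrite (ord1 j).
by apply: filterS => x Px; exact: PA.
Qed.

Section BorelMaps.
Variables (R : realType) (n : nat).
Local Notation C := (Cplx R).
Local Notation V := (Cn R n).
Local Notation B := (borelCn R n).
Local Notation nc := (@normc R).

Lemma open_borel (U : set V) : open U -> measurable (U : set B).
Proof. by move=> oU; apply: sub_gen_smallest. Qed.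

Lemma closed_borel (D : set V) : closed D -> measurable (D : set B).
Proof.
by move=> cD; rewrite -(setCK D); apply: measurableC; apply: open_borel; exact: closed_openC.
Qed.

Lemma continuous_borel (phi : V -> V) : continuous phi ->
  measurable_fun setT (phi : B -> B).
Proof.
move=> /continuousP cphi; apply: (@measurability _ _ B B setT phi (@open V) erefl).
by move=> _ [U oU <-]; rewrite setTI; apply: open_borel; exact: cphi.
Qed.

Lemma measurable_restrict_continuous (D : set V) (p : V -> R) : measurable (D : set B) ->
  (forall t, D t -> {for t, continuous p}) ->
  measurable_fun setT (fun t : B => if t \in D then p t else 0).
Proof.
move=> mD pc; apply: (measurability _ (RGenOInfty.measurableE R)) => _ [_ [a ->] <-].
rewrite setTI; set U := `]a, +oo[%classic.
have oU : open U by exact: interval_open.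
have -> : (fun t : B => if t \in D then p t else 0) @^-1` U =
    (D `&` (p @^-1` U)°) `|` (if 0 \in U then ~` D else set0).
  apply/seteqP; split=> t /=.
    have [tD|tD] := boolP (t \in D).
      move=> Ut; left; split; first exact/set_mem.
      by apply: (pc t (set_mem tD)); exact: open_nbhs_nbhs.
    move=> U0; right; have -> : (0 \in U) by exact/mem_set.
    by move=> Dt; move/negP: tD; apply; exact/mem_set.
  move=> [[Dt Ut]|]; first by rewrite mem_set //; exact: (nbhs_singleton Ut).
  case: ifPn => // /set_mem U0 nDt; case: ifPn => // tD.
  by case: nDt; exact: set_mem.
apply: measurableU.
  by apply: measurableI => //; apply: open_borel; exact: open_interior.
by case: ifP => _; [exact: measurableC|exact: measurable0].
Qed.

Lemma cmeasurable_restrict_continuous (D : set V) (h : V -> C) : measurable (D : set B) ->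
  (forall t, D t -> {for t, continuous h}) ->
  cmeasurable (fun t : B => if t \in D then h t else 0).
Proof.
move=> mD hc; split.
  have := measurable_restrict_continuous mD (fun t Dt => continuous_Re (hc t Dt)).
  by congr measurable_fun; apply: funext => t; case: ifP.
have := measurable_restrict_continuous mD (fun t Dt => continuous_Im (hc t Dt)).
by congr measurable_fun; apply: funext => t; case: ifP.
Qed.

(** An open set of the plane is a countable union of rational squares. *)
Lemma cmeasurable_borelC (g : B -> C) : cmeasurable g ->
  measurable_fun setT (g : B -> borelC R).
Proof.
move=> [mRe mIm]; apply: (@measurability _ _ B (borelC R) setT g (@open C) erefl) => _ [U oU
  <-]; rewrite setTI.
pose box (q : rat * rat * rat) : set C :=
  [set z | `|complex.Re z - ratr q.1.1| < ratr q.2 /\ `|complex.Im z - ratr q.1.2| < ratr q.2].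
pose P k : set B := if @unpickle (rat * rat * rat)%type k is Some q then
   if `[< box q `<=` U >] then g @^-1` box q else set0 else set0.
have -> : g @^-1` U = \bigcup_k P k.
  apply/seteqP; split=> [t Ut|t [k _]]; last first.
    rewrite /P; case: unpickle => // q; case: ifP => // /asboolP qU; exact: qU.
  have /nbhs_normcP[dl dl0 dlU] : nbhs (g t) U by exact: open_nbhs_nbhs.
  have [e] := rat_in_itvoo (divr_gt0 dl0 (ltr0Sn R 3)).
  rewrite in_itv /= => /andP[e0 edl].
  have near_rat (x : R) : exists q : rat, `|x - ratr q| < ratr e.
    have [|q] := @rat_in_itvoo _ (x - ratr e) (x + ratr e); first by lra.
    rewrite in_itv /= => /andP[q1 q2]; exists q.
    by rewrite ltr_norml; apply/andP; split; lra.
  have [a aP] := near_rat (complex.Re (g t)); have [b bP] := near_rat (complex.Im (g t)).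
  have [k kE] : exists k, @unpickle (rat * rat * rat)%type k = Some (a, b, e).
    by exists (pickle (a, b, e)); exact: pickleK.
  exists k; first exact: I.
  rewrite /P kE; case: asboolP => nU; first by split.
  exfalso; apply: nU => z [/= za zb]; apply: dlU.
  apply: le_lt_trans (normc_le_ReIm _) _; rewrite !raddfB /=.
  have h1 : `|complex.Re z - complex.Re (g t)| <= `|complex.Re z - ratr a| + `|complex.Re (g t)
    - ratr a|.
    by rewrite [X in _ <= _ + X]distrC; exact: ler_distD.
  have h2 : `|complex.Im z - complex.Im (g t)| <= `|complex.Im z - ratr b| + `|complex.Im (g t)
    - ratr b|.
    by rewrite [X in _ <= _ + X]distrC; exact: ler_distD.
  by lra.
apply: bigcupT_measurable => k; rewrite /P; case: unpickle => [q|//].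
case: asboolP => // _.
have -> : g @^-1` box q =
   [set t | `|complex.Re (g t) - ratr q.1.1| < ratr q.2] `&`
   [set t | `|complex.Im (g t) - ratr q.1.2| < ratr q.2] by [].
have part (p : B -> R) (x : R) : measurable_fun setT p ->
    measurable [set t : B | `|p t - x| < ratr q.2].
  move=> mp; have := measurable_fun_ltr
    (measurableT_comp (@normr_measurable R setT) (measurable_funB mp (measurable_cst x)))
    (measurable_cst (ratr q.2 : R)).
  move=> /(_ measurableT [set true] I); rewrite setTI.
  by congr measurable; apply/seteqP; split.
by apply: measurableI; exact: part.
Qed.

Definition continuity_set (f : V -> C) : set V := [set w | {for w, continuous f}].

(** The set of points of continuity is a countable intersection of open sets, whatever
    the function. *)
Lemma measurable_continuity_set f : measurable (continuity_set f : set B).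
Proof.
pose O k : set V := [set w | exists2 U : set V, open U & U w /\
  forall x y, U x -> U y -> nc (f x - f y) <= k.+1%:R^-1].
have -> : continuity_set f = \bigcap_k O k.
  apply/seteqP; split=> [w /continuous_normcP fw k _|w Ow].
    have e0 : 0 < k.+1%:R^-1 / 2 :> R by rewrite divr_gt0 ?invr_gt0.
    have /nbhs_interior := fw _ e0 => wU.
    exists [set x | nc (f x - f w) <= k.+1%:R^-1 / 2]°; first exact: open_interior.
    split; first exact: nbhs_singleton wU.
    move=> x y /nbhs_singleton /= fx /nbhs_singleton /= fy.
    have -> : f x - f y = (f x - f w) - (f y - f w) by rewrite opprB addrA subrK.
    by apply: le_trans (normcB _ _) _; rewrite [X in _ <= X]splitr lerD.
  apply/continuous_normcP => e e0.
  have [N NP] : exists N : nat, e^-1 < N%:R.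
    by exists (Num.truncn e^-1).+1; exact: truncnS_gt.
  have [U oU [Uw Usmall]] := Ow N I.
  have : nbhs w U by exact: open_nbhs_nbhs.
  apply: filterS => x Ux; apply: le_trans (Usmall _ _ Ux Uw) _.
  rewrite invf_ple ?posrE //; apply/ltW; apply: lt_le_trans NP _.
  by rewrite ler_nat.
apply: bigcapT_measurable => k; apply: open_borel.
rewrite openE => w [U oU [Uw Usmall]].
have : nbhs w U by exact: open_nbhs_nbhs.
by apply: filterS => x Ux; exists U.
Qed.

(** An element of the Hardy space is an arbitrary function off the image of the domain.
    Replacing it by 0 at its points of discontinuity yields a Borel function and does not
    change it on that image. *)
Definition truncate_continuous (f : V -> C) : V -> C :=
  fun w => if w \in continuity_set f then f w else 0.

Lemma cmeasurable_truncate f : cmeasurable (truncate_continuous f : B -> C).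
Proof.
by apply: cmeasurable_restrict_continuous; [exact: measurable_continuity_set|].
Qed.

End BorelMaps.

(** * Homogeneous maps and circular domains *)

Section HomogeneousMaps.
Variables (R : realType) (n : nat).
Local Notation C := (Cplx R).
Local Notation V := (Cn R n).
Local Notation nc := (@normc R).

Lemma continuous_constc (X : topologicalType) (c : C) (z : X) :
  {for z, continuous (fun=> c : C)}.
Proof. exact: cvg_cst. Qed.

Lemma continuous_mulc (X : topologicalType) (f g : X -> C) (z : X) :
  {for z, continuous f} -> {for z, continuous g} ->
  {for z, continuous (fun x => f x * g x : C)}.
Proof. by move=> fc gc; exact: (@continuousM R[i] X f g z fc gc). Qed.

Lemma continuous_addc (X : topologicalType) (f g : X -> C) (z : X) :
  {for z, continuous f} -> {for z, continuous g} ->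
  {for z, continuous (fun x => f x + g x : C)}.
Proof. by move=> fc gc; exact: (@continuousD R[i] C X f g z fc gc). Qed.

Lemma continuous_sum_seq (X : topologicalType) (I : Type) (s : seq I) (f : I -> X -> C) (z : X) :
  (forall i, {for z, continuous (f i)}) ->
  {for z, continuous (fun x => \sum_(i <- s) f i x)}.
Proof.
move=> fc; elim: s => [|i s IH].
  by rewrite /prop_for; under eq_fun do rewrite big_nil; exact: cvg_cst.
by rewrite /prop_for; under eq_fun do rewrite big_cons;
  exact: (@continuous_addc _ (f i) (fun x => \sum_(j <- s) f j x) z (fc i) IH).
Qed.

Lemma continuous_prod_seq (X : topologicalType) (I : Type) (s : seq I) (f : I -> X -> C) (z : X) :
  (forall i, {for z, continuous (f i)}) ->
  {for z, continuous (fun x => \prod_(i <- s) f i x)}.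
Proof.
move=> fc; elim: s => [|i s IH].
  by rewrite /prop_for; under eq_fun do rewrite big_nil; exact: cvg_cst.
by rewrite /prop_for; under eq_fun do rewrite big_cons;
  exact: (@continuous_mulc _ (f i) (fun x => \prod_(j <- s) f j x) z (fc i) IH).
Qed.

Lemma continuous_expr (X : topologicalType) (f : X -> C) (z : X) k :
  {for z, continuous f} -> {for z, continuous (fun x => f x ^+ k)}.
Proof.
move=> fc; elim: k => [|k IH].
  by rewrite /prop_for; under eq_fun do rewrite expr0; exact: cvg_cst.
by rewrite /prop_for; under eq_fun do rewrite exprS;
  exact: (@continuous_mulc _ f (fun x => f x ^+ k) z fc IH).
Qed.

Lemma continuous_coord (z : V) i : {for z, continuous (fun x : V => x i ord0 : C)}.
Proof. exact: coord_continuous. Qed.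

Lemma continuous_mpoly_eval (p : polyCn R n) (z : V) : {for z, continuous (mpoly_eval p)}.
Proof.
rewrite /prop_for /mpoly_eval; under eq_fun do rewrite mevalE.
apply: continuous_sum_seq => m.
apply: (@continuous_mulc _ (fun=> mcoeff m p) (fun x : V => \prod_i x i ord0 ^+ m i)).
  exact: continuous_constc.
by apply: continuous_prod_seq => i; apply: continuous_expr; exact: continuous_coord.
Qed.

Lemma continuous_basic_map (theta : n.-tuple (polyCn R n)) (z : V) :
  {for z, continuous (basic_map theta)}.
Proof.
apply: continuous_col => i; rewrite /basic_map.
by rewrite /prop_for; under eq_fun do rewrite mxE; exact: continuous_mpoly_eval.
Qed.

Lemma continuous_ell_rho m (l : 'I_m -> 'rV[C]_n) (c : 'I_m -> nat) (z : V) :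
  {for z, continuous (ell_rho l c)}.
Proof.
apply: continuous_prod_seq => i; apply: continuous_expr.
rewrite /prop_for; under eq_fun do rewrite mxE.
apply: continuous_sum_seq => j.
apply: (@continuous_mulc _ (fun=> l i ord0 j) (fun x : V => x j ord0)).
  exact: continuous_constc.
exact: continuous_coord.
Qed.

Lemma ell_rho_homogeneous m (l : 'I_m -> 'rV[C]_n) (c : 'I_m -> nat) (u : C) (z : V) :
  ell_rho l c (u *: z) = u ^+ (\sum_i c i) * ell_rho l c z.
Proof.
rewrite /ell_rho -prodrXr -big_split; apply: eq_bigr => i _ /=.
by rewrite -scalemxAr mxE exprMn.
Qed.

Lemma mpoly_eval_homogeneous (p : polyCn R n) d (u : C) (z : V) :
  p \is ishomog1 d (@mdeg n) -> mpoly_eval p (u *: z) = u ^+ d * mpoly_eval p z.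
Proof.
move=> /dhomogP ph; rewrite /mpoly_eval !mevalE mulr_sumr.
rewrite big_seq [RHS]big_seq; apply: eq_bigr => k kp.
have kd : mdeg k = d := ph k kp.
rewrite -kd mulrCA; congr (_ * _); rewrite mdegE -prodrXr -big_split.
by apply: eq_bigr => i _; rewrite mxE exprMn.
Qed.

Lemma cdiffX (k : nat) (u : R[i]) : cdiff (fun v => v ^+ k) u.
Proof.
elim: k => [|k IH]; first by under [X in cdiff X]eq_fun do rewrite expr0; exact: cdiff_cst.
by under [X in cdiff X]eq_fun do rewrite exprS; apply: cdiffM IH; exact: cdiff_id.
Qed.

(** The dilation of the target space that the basic map intertwines with scalar
    multiplication ([basic_map_weighted]). Through it, radial limits of [f] composed with
    the basic map become limits of [f] along curves determined by the image point
    alone. *)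
Definition weighted_dilation (deg : 'I_n -> nat) (u : C) (w : V) : V :=
  \col_i (u ^+ deg i * w i ord0).

Lemma continuous_weighted_dilation deg u : continuous (weighted_dilation deg u).
Proof.
move=> w; apply: continuous_col => i.
rewrite /prop_for /weighted_dilation; under eq_fun do rewrite mxE.
apply: (@continuous_mulc _ (fun=> u ^+ deg i) (fun x : V => x i ord0)).
  exact: continuous_constc.
exact: continuous_coord.
Qed.

Lemma differentiable_weighted_dilation deg (w : V) (u : C) :
  differentiable (fun u : C => weighted_dilation deg u w) u.
Proof.
have -> : (fun u : C => weighted_dilation deg u w) =
    \sum_i (fun u : C => u ^+ deg i *: (w i ord0 *: (delta_mx i ord0 : V))).
  apply: funext => v; rewrite fct_sumE; apply/matrixP => i j.
  rewrite summxE (bigD1 i) //= !mxE (ord1 j) !eqxx mulr1 big1 ?addr0 // => k ki.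
  by rewrite !mxE eq_sym (negbTE ki) /= !mulr0.
apply: differentiable_sum => i; apply: differentiableZl.
by apply/cdiff_differentiable; exact: cdiffX.
Qed.

Lemma basic_map_weighted (theta : n.-tuple (polyCn R n)) (deg : 'I_n -> nat) :
  (forall i, tnth theta i \is ishomog1 (deg i) (@mdeg n)) ->
  forall (u : C) z, basic_map theta (u *: z) = weighted_dilation deg u (basic_map theta z).
Proof.
move=> th u z; apply/colP => i; rewrite !mxE.
by rewrite (mpoly_eval_homogeneous _ _ (th i)) ?mxE.
Qed.

End HomogeneousMaps.

Section CircularDomain.
Variables (R : realType) (n : nat).
Local Notation C := (Cplx R).
Local Notation V := (Cn R n).
Local Notation B := (borelCn R n).
Local Notation nc := (@normc R).
Variables (Omega : set V) (hcirc : standard_circular Omega).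

Lemma norm_normc (u : C) : nc u = 1 -> `|u| = 1.
Proof. by move=> u1; rewrite normr_normc u1. Qed.

Lemma differentiable_scale (u : C) (z : V) : differentiable (fun z : V => u *: z) z.
Proof. by apply: (@differentiableZ _ _ _ id u z); exact: ex_diff. Qed.

Lemma continuous_scale (u : C) : continuous (fun z : V => u *: z).
Proof. by move=> z; apply: differentiable_continuous; exact: differentiable_scale. Qed.

Lemma closure_circular (u : C) t : nc u = 1 -> closure Omega t -> closure Omega (u *: t).
Proof.
move=> u1 ct A /continuous_scale /ct[s [Os As]].
by exists (u *: s); split => //; apply: (sc_circular hcirc) => //; exact: norm_normc.
Qed.

Lemma closure_circularE (u : C) t : nc u = 1 -> closure Omega (u *: t) <-> closure Omega t.
Proof.
move=> u1; split; last exact: closure_circular.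
have u0 : u != 0 by rewrite -normc_gt0 u1.
move=> /(@closure_circular u^-1); rewrite scalerA mulVf // scale1r; apply.
by rewrite normcV u1 invr1.
Qed.

Lemma closure_contract (w : C) t : nc w < 1 -> closure Omega t -> Omega (w *: t).
Proof.
move=> w1 ct; have [->|w0] := eqVneq w 0; first by rewrite scale0r; exact: (sc_zero hcirc).
have nw0 : 0 < nc w by rewrite normc_gt0.
have -> : w = w / (nc w)%:C * (nc w)%:C.
  by rewrite divfK // (inj_eq (@complexI R)) gt_eqF.
rewrite -scalerA; apply: (sc_circular hcirc).
  apply: norm_normc; rewrite normcM normcV.
  by rewrite normcR gtr0_norm // divff // gt_eqF.
by apply: (sc_radial hcirc) => //; rewrite normc_ge0.
Qed.

Lemma isotropy_scale (u : C) : nc u = 1 -> isotropy Omega (fun z => u *: z).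
Proof.
move=> u1; have u0 : u != 0 by rewrite -normc_gt0 u1.
split; last 2 first.
- by rewrite scaler0.
- by apply: continuous_subspaceT; exact: continuous_scale.
split; first by move=> z _; exact: differentiable_scale.
exists (fun z => u^-1 *: z); split.
- by move=> z _; exact: differentiable_scale.
- by move=> z Oz; apply: (sc_circular hcirc) => //; exact: norm_normc.
- move=> z Oz; apply: (sc_circular hcirc) => //; apply: norm_normc.
  by rewrite normcV u1 invr1.
- by move=> z _; rewrite scalerA mulVf // scale1r.
- by move=> z _; rewrite scalerA mulfV // scale1r.
Qed.

Variables (S : set V) (Theta : probability B R).
Hypotheses (cS : closed S) (hTheta : invariant_measure Omega S Theta).

Lemma boundary_full : Theta (~` S) = 0%E.
Proof.
have mS : measurable (S : set B) by exact: closed_borel.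
by rewrite probability_setC // (proj1 hTheta) subee.
Qed.

Lemma measure_boundary (A : set B) : measurable A -> Theta (S `&` A) = Theta A.
Proof.
move=> mA; have mS : measurable (S : set B) by exact: closed_borel.
rewrite [RHS](measureDI _ mA mS) setIC [X in (_ = X + _)%E](_ : _ = 0%E) ?add0e //.
apply/eqP; rewrite -measure_le0 -boundary_full; apply: le_measure; rewrite ?inE.
- exact: measurableD.
- exact: measurableC.
- by move=> x [].
Qed.

Lemma rotation_scale : rotation_action Theta (fun (u : R[i]) (t : B) => (u : C) *: (t : V) : B).
Proof.
split=> u u1.
  by apply: (@continuous_borel R n (fun z : V => (u : C) *: z)); exact: continuous_scale.
move=> A mA; have mpre : measurable ((fun t : B => (u : C) *: (t : V) : B) @^-1` A).
  rewrite -[X in measurable X]setTI.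
  exact: (@continuous_borel R n (fun z : V => (u : C) *: z) (@continuous_scale u)).
exact: etrans (esym (measure_boundary mpre)) (proj2 hTheta _ (isotropy_scale u1) A mA).
Qed.

Lemma integral_boundary (g : B -> \bar R) : measurable_fun setT g -> (forall t, 0 <= g t)%E ->
  ((\int[ Theta ]_(t in S) g t) = \int[ Theta ]_t g t)%E.
Proof.
move=> mg g0; have mS : measurable (S : set B) by exact: closed_borel.
rewrite [RHS](@ge0_negligible_integral _ B R Theta setT (~` (S : set B)) g) //.
- by rewrite setTD setCK.
- exact: measurableC.
- exact: boundary_full.
Qed.

End CircularDomain.

(** * Boundary values on the image of the Shilov boundary *)

Section BoundaryValue.
Variables (R : realType) (n : nat).
Local Notation C := (Cplx R).
Local Notation V := (Cn R n).
Local Notation B := (borelCn R n).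
Local Notation nc := (@normc R).
Implicit Types (f g : V -> C) (w : V).

Lemma cmeasurable_comp (d : measure_display) (T : measurableType d) (g : B -> C) (phi : T -> B) :
  cmeasurable g -> measurable_fun setT phi -> cmeasurable (fun t => g (phi t)).
Proof.
by move=> [g1 g2] mphi; split; [exact: measurableT_comp g1 mphi|exact: measurableT_comp g2 mphi].
Qed.

Lemma cmeasurableM (d : measure_display) (T : measurableType d) (g h : T -> C) :
  cmeasurable g -> cmeasurable h -> cmeasurable (fun t => g t * h t).
Proof.
move=> [g1 g2] [h1 h2]; split.
  have -> : (fun t => complex.Re (g t * h t)) = (fun t => complex.Re (g t) * complex.Re (h t) -
      complex.Im (g t) * complex.Im (h t)).
    by apply: funext => t; case: (g t) => a b; case: (h t).
  by apply: measurable_funB; exact: measurable_funM.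
have -> : (fun t => complex.Im (g t * h t)) = (fun t => complex.Re (g t) * complex.Im (h t) +
    complex.Im (g t) * complex.Re (h t)).
  by apply: funext => t; case: (g t) => a b; case: (h t).
by apply: measurable_funD; exact: measurable_funM.
Qed.

Lemma cmeasurableD (d : measure_display) (T : measurableType d) (g h : T -> C) :
  cmeasurable g -> cmeasurable h -> cmeasurable (fun t => g t + h t).
Proof.
move=> [g1 g2] [h1 h2]; split.
  by under eq_fun do rewrite raddfD; exact: measurable_funD.
by under eq_fun do rewrite raddfD; exact: measurable_funD.
Qed.

Lemma cmeasurable_cst (d : measure_display) (T : measurableType d) (c : C) :
  cmeasurable (fun _ : T => c).
Proof. by split; exact: measurable_cst. Qed.

Lemma cmeasurable_eq (d : measure_display) (T : measurableType d) (g h : T -> C) :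
  cmeasurable g -> cmeasurable h -> measurable [set t | g t = h t].
Proof.
move=> [g1 g2] [h1 h2].
have part (p q : T -> R) : measurable_fun setT p -> measurable_fun setT q ->
    measurable [set t | p t = q t].
  move=> mp mq; have := measurable_funB mp mq measurableT (measurable_set1 0).
  rewrite setTI; congr measurable; apply/seteqP; split=> t /=.
    by move=> /subr0_eq.
  by move=> ->; rewrite subrr.
have -> : [set t | g t = h t] = [set t | complex.Re (g t) = complex.Re (h t)] `&`
    [set t | complex.Im (g t) = complex.Im (h t)].
  apply/seteqP; split=> t /=; first by move=> ->.
  by move=> [e1 e2]; apply/eqP; rewrite eq_complex e1 e2 !eqxx.
by apply: measurableI; exact: part.
Qed.

Variable deg : 'I_n -> nat.

Definition dilates f w (k : nat) : C :=
  truncate_continuous f (weighted_dilation deg (shrink R k)%:C w).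

(** The limit of [f] along the weighted dilations of [w]. The upper limits of the real
    and imaginary parts make it a Borel function on the whole space, equal to the limit
    wherever that exists ([boundary_value_lim]). *)
Definition boundary_value f w : C :=
  fine (limn_esup (fun k => (complex.Re (dilates f w k))%:E)) +i*
  fine (limn_esup (fun k => (complex.Im (dilates f w k))%:E)).

Lemma cmeasurable_boundary_value f : cmeasurable (boundary_value f : B -> C).
Proof.
have mk k : cmeasurable (fun w : B => dilates f w k).
  apply: (cmeasurable_comp (cmeasurable_truncate f)
    (phi := fun w : B => weighted_dilation deg (shrink R k)%:C w)).
  apply: (@continuous_borel R n (weighted_dilation deg (shrink R k)%:C)).
  exact: continuous_weighted_dilation.
split.
  apply: (measurableT_comp (f := @fine R)) => //.
  apply: (measurable_fun_limn_esup (f := fun k (w : B) => (complex.Re (dilates f w k))%:E)) => k.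
  by apply/measurable_EFinP; case: (mk k).
apply: (measurableT_comp (f := @fine R)) => //.
apply: (measurable_fun_limn_esup (f := fun k (w : B) => (complex.Im (dilates f w k))%:E)) => k.
by apply/measurable_EFinP; case: (mk k).
Qed.

Lemma boundary_value_lim f w (a : C) :
  (dilates f w k @[k --> \oo] --> a) -> boundary_value f w = a.
Proof.
move=> /cvg_normcP H; have part (p : C -> R) :
   (forall z z', `|p z - p z'| <= nc (z - z')) ->
   fine (limn_esup (fun k => (p (dilates f w k))%:E)) = p a.
  move=> pL; have lim : (fun k => (p (dilates f w k))%:E) @ \oo --> (p a)%:E.
    apply/fine_cvgP; split; first exact: nearW.
    apply/cvgrPdist_le => e e0; apply: filterS (H e e0) => k /=; apply: le_trans.
    by rewrite distrC.
  by have [_ ->] := cvg_limn_einf_sup lim.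
have p1 := part (@complex.Re R); have p2 := part (@complex.Im R).
rewrite /boundary_value p1 ?p2; first by case: a {H p1 p2 part}.
  by move=> z z'; have := normc_ge_normIm (z - z'); rewrite raddfB.
by move=> z z'; have := normc_ge_normRe (z - z'); rewrite raddfB.
Qed.

End BoundaryValue.

Section PullBack.
Variables (R : realType) (n : nat).
Local Notation C := (Cplx R).
Local Notation V := (Cn R n).
Local Notation B := (borelCn R n).
Local Notation nc := (@normc R).
Variables (Omega : set V) (hcirc : standard_circular Omega).
Variables (theta : n.-tuple (polyCn R n)) (deg : 'I_n -> nat).
Hypothesis theta_deg : forall i, tnth theta i \is ishomog1 (deg i) (@mdeg n).
Variables (m : nat) (l : 'I_m -> 'rV[C]_n) (c : 'I_m -> nat).
Local Notation th := (basic_map theta).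
Local Notation ell := (ell_rho l c).
Local Notation rot := (fun (u : R[i]) (t : B) => (u : C) *: (t : V) : B).
Implicit Types (f g : V -> C).

(** The slices of the holomorphic function [ell * (f o theta)], extended by 0 to the
    parameters outside the closure of the domain. *)
Definition pull_back f (w : R[i]) (t : B) : R[i] :=
  if t \in closure Omega then ell ((w : C) *: (t : V)) * f (th ((w : C) *: (t : V))) else 0.

Lemma pull_backE f w t : closure Omega t ->
  pull_back f w t = ell ((w : C) *: t) * f (th ((w : C) *: t)).
Proof. by move=> ct; rewrite /pull_back mem_set. Qed.

Lemma holomorphic_continuity_set f : holomorphic_on (th @` Omega) f ->
  forall (w : C) t, nc w < 1 -> closure Omega t -> continuity_set f (th (w *: t)).
Proof.
move=> hf w t w1 ct; apply: differentiable_continuous; apply: hf.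
by exists (w *: t) => //; exact: closure_contract.
Qed.

(** Along a slice the basic map is a weighted dilation, so the slice of [f o theta] is the
    composition of [f] with a curve whose coordinates are monomials. *)
Lemma hardy_family_pull_back f : holomorphic_on (th @` Omega) f ->
  hardy_family rot (pull_back f).
Proof.
move=> hf; split.
- move=> t w w1; rewrite /pull_back.
  have [/set_mem ct|_] := boolP (t \in closure Omega); last exact: cdiff_cst.
  have -> : (fun z : R[i] => ell ((z : C) *: (t : V)) * f (th ((z : C) *: (t : V))) : R[i]) =
      (fun z : R[i] => z ^+ (\sum_i c i) * ell t * f (weighted_dilation deg z (th t)) : R[i]).
    by apply: funext => z; rewrite ell_rho_homogeneous (basic_map_weighted theta_deg).
  apply: cdiffM; first by apply: cdiffM; [exact: cdiffX|exact: cdiff_cst].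
  apply/cdiff_differentiable.
  apply: (@differentiable_comp _ C V C (fun z : C => weighted_dilation deg z (th t)) f).
    exact: differentiable_weighted_dilation.
  rewrite -(basic_map_weighted theta_deg); apply: hf.
  by exists ((w : C) *: (t : V)) => //; exact: closure_contract.
- move=> w w1; apply: (@cmeasurable_restrict_continuous R n (closure Omega)
    (fun t => ell ((w : C) *: t) * f (th ((w : C) *: t)))).
    by apply: closed_borel; exact: closed_closure.
  move=> t ct; apply: (@continuous_mulc R V (fun t => ell ((w : C) *: t))
    (fun t => f (th ((w : C) *: t)))).
    apply: (@continuous_comp V V C (fun t => (w : C) *: t) ell).
      exact: continuous_scale.
    exact: continuous_ell_rho.
  apply: (@continuous_comp V V C (fun t => th ((w : C) *: t)) f).
    apply: (@continuous_comp V V V (fun t => (w : C) *: t) th).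
      exact: continuous_scale.
    exact: continuous_basic_map.
  exact: holomorphic_continuity_set.
- move=> w u t u1; rewrite /pull_back.
  have -> : (((u : C) *: (t : V) : B) \in closure Omega) = (t \in closure Omega).
    apply/idP/idP => /set_mem H; apply: mem_set.
      exact: (proj1 (closure_circularE hcirc t u1) H).
    exact: (closure_circular hcirc u1 H).
  by have -> : (w : C) *: ((u : C) *: (t : V)) = (w * u : C) *: (t : V) := scalerA _ _ _.
Qed.

Lemma dilates_boundary f : holomorphic_on (th @` Omega) f ->
  forall t k, closure Omega t -> dilates deg f (th t) k = f (th ((shrink R k)%:C *: t)).
Proof.
move=> hf t k ct; rewrite /dilates -(basic_map_weighted theta_deg) /truncate_continuous.
rewrite mem_set //; apply: holomorphic_continuity_set => //.
by have /andP[k0 k1] := @shrink01 R k; rewrite normcR gtr0_norm.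
Qed.

Lemma cvg_mulc (T : Type) (F : set_system T) {FF : Filter F} (f g : T -> C) (a b : C) :
  f x @[x --> F] --> a -> g x @[x --> F] --> b -> (f x * g x : C) @[x --> F] --> (a * b : C).
Proof. by move=> fa gb; exact: (@cvgM R[i] T F FF f g a b fa gb). Qed.

Lemma cvg_addc (T : Type) (F : set_system T) {FF : Filter F} (f g : T -> C) (a b : C) :
  f x @[x --> F] --> a -> g x @[x --> F] --> b -> (f x + g x : C) @[x --> F] --> (a + b : C).
Proof. by move=> fa gb; exact: (@cvgD R[i] C T F FF f g a b fa gb). Qed.

Lemma dilates_cvg f : holomorphic_on (th @` Omega) f ->
  forall t (a : C), closure Omega t -> ell t != 0 ->
  (pull_back f r%:C t : C) @[r --> 1^'-] --> a ->
  dilates deg f (th t) k @[k --> \oo] --> a / ell t.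
Proof.
move=> hf t a ct l0 /cvg_normcP Pa.
pose D := (\sum_i c i)%N.
have s0 k : (shrink R k)%:C != 0 :> C.
  by rewrite (inj_eq (@complexI R)) gt_eqF //; case/andP: (@shrink01 R k).
have Pk : (pull_back f (shrink R k)%:C t : C) @[k --> \oo] --> a.
  apply/cvg_normcP => e e0; have /near_left1[dl dl0 dlP] := Pa e e0.
  apply: filterS (shrink_near dl0) => k kj; apply: dlP; rewrite kj.
  by case/andP: (@shrink01 R k).
have sk : ((shrink R k)%:C : C) @[k --> \oo] --> (1 : C).
  apply/cvg_normcP => e e0; apply: filterS (shrink_near e0) => k kj.
  rewrite -(rmorph1 (real_complex R)) -rmorphB normcR distrC.
  have /andP[k0 k1] := @shrink01 R k.
  by rewrite ger0_norm ?subr_ge0 ?ltW //; lra.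
have skD j : ((shrink R k)%:C ^+ j : C) @[k --> \oo] --> (1 : C).
  elim: j => [|j IH].
    by under eq_fun do rewrite expr0; exact: cvg_cst.
  under eq_fun do rewrite exprS.
  have H := cvg_mulc sk IH; rewrite mulr1 in H; exact: H.
have -> : (fun k => dilates deg f (th t) k) =
    (fun k => pull_back f (shrink R k)%:C t * (((shrink R k)%:C ^+ D)^-1 * (ell t)^-1)).
  apply: funext => k; rewrite dilates_boundary // pull_backE // ell_rho_homogeneous -/D.
  rewrite -invfM mulrAC divff ?mul1r // mulf_neq0 // expf_neq0 //.
have -> : a / ell t = a * (1^-1 * (ell t)^-1) by rewrite invr1 mul1r.
apply: (cvg_mulc Pk); apply: cvg_mulc; last exact: cvg_cst.
by apply: (@cvgV R[i]); [exact: oner_neq0|exact: skD].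
Qed.

(** Where [ell t] is zero both sides are zero, since [ell] is homogeneous; elsewhere
    one can divide by [ell]. *)
Lemma boundary_value_radial f t (a : C) : holomorphic_on (th @` Omega) f ->
  closure Omega t -> (pull_back f r%:C t : C) @[r --> 1^'-] --> a ->
  (ell ((r%:C : C) *: t) * f (th ((r%:C : C) *: t)) : C) @[r --> (1 : R)^'-] -->
    ell t * boundary_value deg f (th t).
Proof.
move=> hf ct Pa.
have E : (fun r : R => ell ((r%:C : C) *: t) * f (th ((r%:C : C) *: t)) : C) =
    (fun r : R => pull_back f r%:C t) by apply: funext => r; rewrite pull_backE.
have [l0|l0] := eqVneq (ell t) 0.
  have -> : (fun r : R => ell ((r%:C : C) *: t) * f (th ((r%:C : C) *: t)) : C) = (fun=> 0).
    by apply: funext => r; rewrite ell_rho_homogeneous l0 mulr0 mul0r.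
  by rewrite l0 mul0r; exact: cvg_cst.
by rewrite E (boundary_value_lim (dilates_cvg hf ct l0 Pa)) mulrC divfK.
Qed.

End PullBack.

(** * The isometric embedding *)

Section AlmostEverywhere.
Context d (T : measurableType d) (R : realType) (mu : {measure set T -> \bar R}).
Implicit Types P Q W : T -> Prop.

Lemma ae_imp P Q : (forall t, P t -> Q t) ->
  {ae mu, forall t, P t} -> {ae mu, forall t, Q t}.
Proof. by move=> PQ; apply: filterS. Qed.

Lemma ae_imp2 P Q W : (forall t, P t -> Q t -> W t) ->
  {ae mu, forall t, P t} -> {ae mu, forall t, Q t} -> {ae mu, forall t, W t}.
Proof. by move=> PQ; apply: filterS2. Qed.

End AlmostEverywhere.

Section Assembly.
Variables (R : realType) (n : nat).
Local Notation C := (Cplx R).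
Local Notation V := (Cn R n).
Local Notation B := (borelCn R n).
Local Notation nc := (@normc R).
Variables (Omega : set V) (hcirc : standard_circular Omega).
Variables (S : set V) (hS : shilov_boundary Omega S).
Variables (Theta : probability B R) (hTheta : invariant_measure Omega S Theta).
Variables (theta : n.-tuple (polyCn R n)) (deg : 'I_n -> nat).
Hypothesis theta_deg : forall i, tnth theta i \is ishomog1 (deg i) (@mdeg n).
Variables (m : nat) (l : 'I_m -> 'rV[C]_n) (c : 'I_m -> nat).
Local Notation th := (basic_map theta).
Local Notation ell := (ell_rho l c).
Variables (Theta_rho : {measure set B -> \bar R}).
Hypothesis hTheta_rho : weighted_image S Theta th ell Theta_rho.
Local Notation H2 := (hardy_rho S Theta th ell Omega).
Local Notation K := (c_rho S Theta ell ^- 2).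
Local Notation pb := (pull_back Omega theta l c).
Local Notation rot := (fun (u : R[i]) (t : B) => (u : C) *: (t : V) : B).
Implicit Types (f g : V -> C).

Let cS : closed S. Proof. by case: hS => -[]. Qed.
Let SX t : S t -> closure Omega t. Proof. by case: hS => -[_ sub _] _; exact: sub. Qed.
Let mS : measurable (S : set B). Proof. exact: closed_borel. Qed.
Let ra : rotation_action Theta rot. Proof. exact: (rotation_scale hcirc cS hTheta). Qed.

(** The square of the norm of [ell * (f o theta)] in the Hardy space of the domain. *)
Definition energy f : \bar R :=
  radial_sup S Theta (fun z => nc (f (th z)) ^+ 2 * nc (ell z) ^+ 2)%R.

Lemma cmeasurable_continuous (h : V -> C) : (forall t, {for t, continuous h}) ->
  cmeasurable (h : B -> C).
Proof.
move=> hc; have := @cmeasurable_restrict_continuous R n setT h measurableT (fun t _ => hc t).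
by congr cmeasurable; apply: funext => t; rewrite mem_set.
Qed.

Lemma cmeasurable_ell : cmeasurable (ell : B -> C).
Proof. by apply: cmeasurable_continuous => t; exact: continuous_ell_rho. Qed.

Lemma measurable_basic_map : measurable_fun setT (th : B -> B).
Proof. by apply: (@continuous_borel R n th) => t; exact: continuous_basic_map. Qed.

Lemma integral_dilate f r : holomorphic_on (th @` Omega) f -> 0 < r < 1 ->
  (\int[ Theta ]_(t in S)
     (nc (f (th ((r%:C : C) *: (t : V)))) ^+ 2 * nc (ell ((r%:C : C) *: (t : V))) ^+ 2)%:E)%E =
  mean_square Theta (pb f) r.
Proof.
move=> hf r01; have hp := hardy_family_pull_back hcirc theta_deg l c hf.
rewrite /mean_square -(integral_boundary cS hTheta (g := fun t => (nc (pb f r%:C t) ^+ 2)%:E)).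
- apply: eq_integral => t /set_mem /SX ct.
  by rewrite pull_backE // normcM exprMn mulrC.
- apply/measurable_EFinP; apply: measurable_sqr_normc; apply: (hf_measurable_real hp).
  by case/andP: r01 => /ltW -> ->.
- by move=> t; rewrite lee_fin sqr_ge0.
Qed.

Lemma energy_pull_back f : holomorphic_on (th @` Omega) f ->
  energy f = ereal_sup [set mean_square Theta (pb f) r | r in [set r : R | 0 < r < 1]].
Proof.
move=> hf; congr ereal_sup; apply/seteqP; split=> _ [r r01 <-]; exists r => //.
  by rewrite integral_dilate.
by rewrite -integral_dilate.
Qed.

Lemma energy_ge0 f : (0 <= energy f)%E.
Proof.
apply: (@le_trans _ _ (\int[ Theta ]_(t in S)
  (nc (f (th ((2^-1%:C : C) *: (t : V)))) ^+ 2 * nc (ell ((2^-1%:C : C) *: (t : V))) ^+ 2)%:E)%E).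
  by apply: integral_ge0 => t _; rewrite lee_fin mulr_ge0 ?sqr_ge0.
by apply: ereal_sup_ubound; exists 2^-1 => //=; apply/andP; split; lra.
Qed.

(** The factor [c_rho ^- 2] is 0 by convention when [c_rho] is 0, and then the finiteness
    of the norm of [f] gives no information on its energy. *)
Lemma energy_fin f : K != 0 -> H2 f -> energy f \is a fin_num.
Proof.
move=> K0 [hf]; rewrite /hardy_rho_norm -/(energy f) => fin.
rewrite ge0_fin_numE ?energy_ge0 //.
have Kpos : 0 < K by rewrite lt0r K0 invr_ge0 sqr_ge0.
case: (energy f) fin (energy_ge0 f) => [x| |] // fin _; first by rewrite ltry.
by move: fin; rewrite gt0_muley ?lte_fin // poweRyr.
Qed.

Lemma mean_square_energy f : K != 0 -> H2 f ->
  (forall r, 0 < r < 1 -> (mean_square Theta (pb f) r <= (fine (energy f))%:E)%E) /\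
  (forall e, 0 < e -> exists2 r, 0 < r < 1 &
     ((fine (energy f) - e)%:E <= mean_square Theta (pb f) r)%E).
Proof.
move=> K0 Hf; have efin := energy_fin K0 Hf; have [hf _] := Hf; split.
  by move=> r r01; rewrite fineK // energy_pull_back //; apply: ereal_sup_ubound; exists r.
move=> e e0; have : ((fine (energy f) - e)%:E < energy f)%E.
  by rewrite EFinB fineK // lteBlDr // lteDl ?lte_fin.
rewrite {2}energy_pull_back // => /ereal_sup_gt[_ [r r01 <-] /ltW H].
by exists r.
Qed.

Lemma differentiable_ell z : differentiable ell z.
Proof.
have lin i : differentiable (fun z : V => (l i *m z) ord0 ord0 : C) z.
  have -> : (fun z : V => (l i *m z) ord0 ord0 : C) =
      \sum_j (fun z : V => l i ord0 j *: (z j ord0 : C) : C).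
    by apply: funext => w; rewrite fct_sumE mxE.
  apply: differentiable_sum => j; apply: differentiableZ.
  exact: differentiable_coord.
rewrite /ell_rho; elim: (index_enum _) => [|i s IH].
  have -> : (fun z : V => \prod_(i <- [::]) (l i *m z) ord0 ord0 ^+ c i : C) = cst 1.
    by apply: funext => w; rewrite big_nil.
  exact: differentiable_cst.
have -> : (fun z : V => \prod_(i <- i :: s) (l i *m z) ord0 ord0 ^+ c i : C) =
    (fun z : V => (l i *m z) ord0 ord0 ^+ c i : C) *
    (fun z : V => \prod_(i <- s) (l i *m z) ord0 ord0 ^+ c i : C).
  by apply: funext => w; rewrite big_cons.
apply: differentiableM => //.
elim: (c i) => [|k IHk].
  have -> : (fun z : V => (l i *m z) ord0 ord0 ^+ 0 : C) = cst 1 by apply: funext => w.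
  exact: differentiable_cst.
have -> : (fun z : V => (l i *m z) ord0 ord0 ^+ k.+1 : C) =
   (fun z : V => (l i *m z) ord0 ord0 : C) * (fun z : V => (l i *m z) ord0 ord0 ^+ k : C).
  by apply: funext => w; rewrite exprS.
exact: differentiableM.
Qed.

(** The maximum principle on the Shilov boundary. *)
Lemma ell_bounded : exists M : R, forall z, closure Omega z -> nc (ell z) <= M.
Proof.
have [[_ _ maxS] _] := hS.
have [|z _|w _ wmax] := maxS ell; last by exists (nc (ell w)).
  by apply: continuous_subspaceT => z; exact: continuous_ell_rho.
exact: differentiable_ell.
Qed.

(** In the degenerate case [c_rho = 0] the form [ell] vanishes almost everywhere on the
    Shilov boundary: its mean square at radius 1/2 is 0, and it is homogeneous. That
    [c_rho] is not 0 as the value of [fine] at infinity comes from [ell_bounded]. *)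
Lemma ell_ae0 : K = 0 -> {ae Theta, forall t, S t -> ell t = 0}.
Proof.
move=> /eqP; rewrite invr_eq0 expf_eq0 /= => /eqP.
rewrite /c_rho /hardy_norm; set s := radial_sup _ _ _.
have term r : 0 < r < 1 -> (\int[ Theta ]_(t in S) (nc (ell ((r%:C : C) *: (t : V))) ^+ 2)%:E <=
  s)%E.
  by move=> r01; apply: ereal_sup_ubound; exists r.
have half01 : 0 < (2^-1 : R) < 1 by apply/andP; split; lra.
have s0 : (0 <= s)%E.
  apply: le_trans (term _ half01); apply: integral_ge0 => t _; by rewrite lee_fin sqr_ge0.
have [M MP] := ell_bounded.
have sM : (s <= (M ^+ 2)%:E)%E.
  apply/ereal_supP => _ [r /andP[r0 r1] <-].
  apply: (@le_trans _ _ (\int[ Theta ]_(t in S) (cst (M ^+ 2)%:E t))%E).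
    apply: ge0_le_integral => //.
    - by move=> t _; rewrite lee_fin sqr_ge0.
    - apply: measurable_funTS; apply/measurable_EFinP; apply: measurable_sqr_normc.
      apply: (cmeasurable_comp cmeasurable_ell (phi := fun t : B => (r%:C : C) *: (t : V) : B)).
      by apply: (@continuous_borel R n (fun z : V => (r%:C : C) *: z)); exact: continuous_scale.
    - move=> t /SX ct; rewrite lee_fin.
      have b : nc (ell ((r%:C : C) *: (t : V))) <= M.
        apply: MP; apply: subset_closure; apply: (closure_contract hcirc) => //.
        by rewrite normcR gtr0_norm.
      by rewrite ler_pXn2r ?nnegrE ?normc_ge0 //; apply: le_trans b; exact: normc_ge0.
  rewrite integral_cst // -[leRHS]mule1; apply: lee_wpmul2l; first by rewrite lee_fin sqr_ge0.
  exact: probability_le1.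
have sfin : s \is a fin_num by rewrite ge0_fin_numE // (le_lt_trans sM) // ltry.
rewrite -(fineK sfin) poweR_EFin /= => /eqP; rewrite powR_eq0 => /andP[/eqP fs0 _].
have s00 : s = 0%E by rewrite -(fineK sfin) fs0.
have : (\int[ Theta ]_(t in S) `|(nc (ell ((2^-1%:C : C) *: (t : V))) ^+ 2)%:E| = 0)%E.
  under eq_integral do rewrite gee0_abs ?lee_fin ?sqr_ge0 //.
  apply/eqP; rewrite eq_le -{1}s00 term //=.
  by apply: integral_ge0 => t _; rewrite lee_fin sqr_ge0.
move=> /ae_eq_integral_abs => /(_ mS) H.
have /H : measurable_fun (S : set B) (fun t : B => (nc (ell ((2^-1%:C : C) *: (t : V))) ^+ 2)%:E).
  apply: measurable_funTS; apply/measurable_EFinP; apply: measurable_sqr_normc.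
  apply: (cmeasurable_comp cmeasurable_ell (phi := fun t : B => (2^-1%:C : C) *: (t : V) : B)).
  by apply: (@continuous_borel R n (fun z : V => (2^-1%:C : C) *: z)); exact: continuous_scale.
apply: filterS => t Ht St.
have [] := Ht St; move/eqP; rewrite expf_eq0 normc_eq0 ell_rho_homogeneous mulf_eq0 =>
  /orP[|/eqP//].
rewrite expf_eq0 => /andP[_]; rewrite (inj_eq (@complexI R)) invr_eq0.
by rewrite pnatr_eq0.
Qed.

Lemma radial_limit_exists f : H2 f -> {ae Theta, forall t, S t -> ell t != 0 ->
  exists a : C, (pb f r%:C t : C) @[r --> 1^'-] --> a}.
Proof.
move=> Hf; have [K0|K0] := eqVneq K 0.
  by apply: ae_imp (ell_ae0 K0) => t l0 /l0 ->; rewrite eqxx.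
have [hf _] := Hf; have hp := hardy_family_pull_back hcirc theta_deg l c hf.
have [L1 L2] := mean_square_energy K0 Hf.
by apply: ae_imp (radial_limit_ae ra hp L1 L2) => t H _ _.
Qed.

Lemma boundary_value_radial_ae f : H2 f -> {ae Theta, forall t, S t ->
  (ell ((r%:C : C) *: (t : V)) * f (th ((r%:C : C) *: (t : V))) : C) @[r --> (1 : R)^'-]
  --> ell t * boundary_value deg f (th t)}.
Proof.
move=> Hf; apply: ae_imp (radial_limit_exists Hf) => t H St.
have [hf _] := Hf; have ct := SX St.
have [l0|l0] := eqVneq (ell t) 0; last first.
  by have [a Pa] := H St l0; exact: (boundary_value_radial hcirc theta_deg hf ct Pa).
rewrite l0 mul0r.
have -> : (fun r : R => ell ((r%:C : C) *: (t : V)) * f (th ((r%:C : C) *: (t : V))) : C) =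
  (fun=> 0).
  by apply: funext => r; rewrite ell_rho_homogeneous l0 mulr0 mul0r.
exact: cvg_cst.
Qed.

(** The measure [Theta_rho] does not see the zeros of [ell], where the radial limits
    give no information on [f]. *)
Lemma image_ae (A : set B) : measurable A ->
  {ae Theta, forall t, S t -> ell t != 0 -> A (th t)} -> {ae Theta_rho, forall w, A w}.
Proof.
move=> mA Aae; exists (~` A); split => //; first exact: measurableC.
have mcA := measurableC mA.
have := hTheta_rho (h := fun w => (\1_(~` A) w)%:E).
rewrite integral_indic // setIT => ->; last 2 first.
- by apply/measurable_EFinP; exact: measurable_indic.
- by move=> w; rewrite lee_fin.
rewrite (_ : (\int[ Theta ]_(t in S) _)%E = 0%E) ?mule0 //.
rewrite (ae_eq_integral (cst 0%E)) ?integral0 //.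
- apply: measurable_funTS; apply: emeasurable_funM.
    apply: (measurableT_comp (f := fun w : B => (\1_(~` A) w)%:E)).
      by apply/measurable_EFinP; exact: measurable_indic.
    exact: measurable_basic_map.
  by apply/measurable_EFinP; exact: (measurable_sqr_normc cmeasurable_ell).
- apply: ae_imp Aae => t At St; have [l0|l0] := eqVneq (ell t) 0.
    by rewrite l0 normc0 expr0n /= mule0.
  by rewrite indicE memNset ?mul0e //= => nA; exact: nA (At St l0).
Qed.

Lemma integral_boundary_value f : H2 f ->
  (\int[ Theta_rho ]_w (nc (boundary_value deg f w) ^+ 2)%:E)%E = (K%:E * energy f)%E.
Proof.
move=> Hf; have [hf _] := Hf; have mJ := cmeasurable_boundary_value deg f.
rewrite (hTheta_rho (h := fun w => (nc (boundary_value deg f w) ^+ 2)%:E)); last 2 first.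
- by apply/measurable_EFinP; exact: measurable_sqr_normc.
- by move=> w; rewrite lee_fin sqr_ge0.
have [->|K0] := eqVneq K 0; first by rewrite !mul0e.
have hp := hardy_family_pull_back hcirc theta_deg l c hf.
have efin := energy_fin K0 Hf.
have [L1 L2] := mean_square_energy K0 Hf.
pose Psi (t : B) := ell t * boundary_value deg f (th t) : R[i].
have mPsi : cmeasurable Psi.
  apply: cmeasurableM; first exact: cmeasurable_ell.
  exact: (cmeasurable_comp mJ measurable_basic_map).
have Plim : {ae Theta, forall t, (pb f r%:C t : C) @[r --> 1^'-] --> (Psi t : C)}.
  have Sae : {ae Theta, forall t, S t}.
    by exists (~` S); split => //; [exact: measurableC|exact: (boundary_full cS hTheta)].
  apply: ae_imp2 Sae (boundary_value_radial_ae Hf) => t St /(_ St).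
  suff -> : (fun r : R => pb f r%:C t : C) =
    (fun r : R => ell ((r%:C : C) *: (t : V)) * f (th ((r%:C : C) *: (t : V))) : C) by [].
  by apply: funext => r; rewrite pull_backE //; exact: SX.
have := radial_limit_mean_square ra hp L1 L2 mPsi Plim.
rewrite fineK // => <-; congr (_ * _)%E.
rewrite -(integral_boundary cS hTheta (g := fun t => (nc (Psi t) ^+ 2)%:E)).
- apply: eq_integral => t _.
  by rewrite -EFinM /Psi normcM exprMn mulrC.
- by apply/measurable_EFinP; exact: measurable_sqr_normc.
- by move=> t; rewrite lee_fin sqr_ge0.
Qed.

Lemma L2_norm_boundary_value f : H2 f ->
  L2_norm Theta_rho (boundary_value deg f) = hardy_rho_norm S Theta th ell f.
Proof.
move=> Hf; rewrite /L2_norm /hardy_rho_norm -/(energy f) -integral_boundary_value //.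
rewrite Lnorm.unlock /=; congr (_ `^ _)%E; apply: eq_integral => w _.
by rewrite ger0_norm ?normc_ge0 // powR_mulrn ?normc_ge0.
Qed.

Lemma boundary_value_comb_ae (u v : C) f g : H2 f -> H2 g ->
  {ae Theta_rho, forall w, boundary_value deg (fun x => u * f x + v * g x) w =
    u * boundary_value deg f w + v * boundary_value deg g w}.
Proof.
move=> Hf Hg; have [hf _] := Hf; have [hg _] := Hg.
have hfg : holomorphic_on (th @` Omega) (fun x => u * f x + v * g x : C).
  move=> z Oz.
  exact: (differentiableD (differentiableZ u (hf z Oz)) (differentiableZ v (hg z Oz))).
apply: (image_ae (A := [set w | boundary_value deg (fun x => u * f x + v * g x) w =
    u * boundary_value deg f w + v * boundary_value deg g w])).
  apply: cmeasurable_eq; first exact: cmeasurable_boundary_value.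
  apply: cmeasurableD; apply: cmeasurableM; try exact: cmeasurable_cst;
    exact: cmeasurable_boundary_value.
apply: ae_imp2 (radial_limit_exists Hf) (radial_limit_exists Hg) => t Ef Eg St l0.
have ct := SX St.
have [a Pa] := Ef St l0; have [b Pb] := Eg St l0.
have Da := dilates_cvg hcirc theta_deg hf ct l0 Pa.
have Db := dilates_cvg hcirc theta_deg hg ct l0 Pb.
rewrite /= (boundary_value_lim Da) (boundary_value_lim Db).
apply: boundary_value_lim.
have -> : (fun k => dilates deg (fun x => u * f x + v * g x) (th t) k) =
   (fun k => u * dilates deg f (th t) k + v * dilates deg g (th t) k).
  by apply: funext => k; rewrite !(dilates_boundary hcirc theta_deg).
exact: cvg_addc (cvg_mulc (cvg_cst u) Da) (cvg_mulc (cvg_cst v) Db).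
Qed.

Lemma boundary_value_ext_ae f g : H2 f -> H2 g ->
  (forall w, (th @` Omega) w -> f w = g w) ->
  {ae Theta_rho, forall w, boundary_value deg f w = boundary_value deg g w}.
Proof.
move=> [hf _] [hg _] fg.
apply: (image_ae (A := [set w | boundary_value deg f w = boundary_value deg g w])).
  by apply: cmeasurable_eq; exact: cmeasurable_boundary_value.
apply: aeW => t St _ /=; have ct := SX St.
have E : dilates deg f (th t) = dilates deg g (th t).
  apply: funext => k; rewrite !(dilates_boundary hcirc theta_deg) //; apply: fg.
  exists ((shrink R k)%:C *: t) => //; apply: (closure_contract hcirc) => //.
  by have /andP[k0 k1] := @shrink01 R k; rewrite normcR gtr0_norm.
by rewrite /boundary_value E.
Qed.

End Assembly.

Theorem lemma3p15 (R : realType) (n : nat)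
  (Omega : set (Cn R n))
  (hOmega : bounded_symmetric_domain Omega) (hcirc : standard_circular Omega)
  (S : set (Cn R n)) (hS : shilov_boundary Omega S)
  (Theta : probability (borelCn R n) R) (hTheta : invariant_measure Omega S Theta)
  (G : set 'M[Cplx R]_n) (hG : finite_reflection_group G)
  (hGOmega : forall A, G A -> automorphism Omega (fun z => A *m z))
  (theta : n.-tuple (polyCn R n)) (htheta : basic_polynomials G theta)
  (rho : 'M[Cplx R]_n -> Cplx R) (hrho : linear_character G rho)
  (m : nat) (H : 'I_m -> set (Cn R n)) (l : 'I_m -> 'rV[Cplx R]_n)
  (a : 'I_m -> 'M[Cplx R]_n) (hH : hyperplane_data G H l a)
  (c : 'I_m -> nat) (hc : least_exponents rho a c)
  (Theta_rho : {measure set (borelCn R n) -> \bar R})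
  (hTheta_rho : weighted_image S Theta (basic_map theta) (ell_rho l c) Theta_rho) :
  exists J : (Cn R n -> Cplx R) -> (Cn R n -> Cplx R),
  let H2 := hardy_rho S Theta (basic_map theta) (ell_rho l c) Omega in
  [/\ forall f, H2 f -> L2_space Theta_rho (J f),
      forall f, H2 f -> {ae Theta, forall t, S t ->
        ell_rho l c ((r%:C : Cplx R) *: t) *
          f (basic_map theta ((r%:C : Cplx R) *: t)) @[r --> (1 : R)^'-]
        --> ell_rho l c t * J f (basic_map theta t)},
      forall f g, H2 f -> H2 g ->
        (forall w, (basic_map theta @` Omega) w -> f w = g w) ->
        {ae Theta_rho, forall w, J f w = J g w},
      forall (u v : Cplx R) f g, H2 f -> H2 g ->
        {ae Theta_rho, forall w, J (fun x => u * f x + v * g x) w = u * J f w + v * J g w} &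
      forall f, H2 f ->
        L2_norm Theta_rho (J f) =
        hardy_rho_norm S Theta (basic_map theta) (ell_rho l c) f].
Proof.
have cS : closed S by case: hS => -[].
have [deg theta_deg] := choice (bp_homogeneous htheta).
exists (boundary_value deg); split.
- move=> f Hf; split.
    exact: (cmeasurable_borelC (cmeasurable_boundary_value deg f)).
  rewrite (L2_norm_boundary_value hcirc hS hTheta theta_deg hTheta_rho Hf).
  by case: Hf.
- by move=> f; exact: (boundary_value_radial_ae hcirc hS hTheta theta_deg).
- move=> f g.
  exact: (boundary_value_ext_ae hcirc hS theta_deg hTheta_rho).
- move=> u v f g.
  exact: (boundary_value_comb_ae hcirc hS hTheta theta_deg hTheta_rho).
- by move=> f; exact: (L2_norm_boundary_value hcirc hS hTheta theta_deg hTheta_rho).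
Qed.
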